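(* Let $N\ge 0$, $c\in\mathbb{R}$ with $c+1>0$, and $a>0$. Let $\mu$ be the measure $d\mu(z)=y^c e^{-a|z|^2}\,dz$ on $\mathbb{R}^{N+1}_+$. Then the immersion $H^1_\mu(\mathbb{R}^{N+1}_+)\hookrightarrow L^2_\mu(\mathbb{R}^{N+1}_+)$ is compact.
   Context: Notation: $\mathbb{R}^{N+1}_+=\{z=(x,y): x\in\mathbb{R}^N,\ y>0\}$, $|z|^2=|x|^2+y^2$. $L^2_\mu(\mathbb{R}^{N+1}_+):=L^2(\mathbb{R}^{N+1}_+, y^c e^{-a|z|^2}dz)$, and $H^1_\mu(\mathbb{R}^{N+1}_+):=\{u\in L^2_\mu(\mathbb{R}^{N+1}_+): \nabla u\in L^2_\mu(\mathbb{R}^{N+1}_+)\}$, where $\nabla u$ is the weak (distributional) gradient in the open half-space $\mathbb{R}^{N+1}_+$ with respect to all variables $(x,y)$. $H^1_\mu(\mathbb{R}^{N+1}_+)$ is equipped with the inner product $\langle u,v\rangle_{L^2_\mu}+\langle\nabla u,\nabla v\rangle_{L^2_\mu}$. *)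

(* Defs.v *)
From HB Require Import structures.
From mathcomp Require Import all_boot all_order all_algebra.
From mathcomp Require Import all_classical all_reals all_analysis.
From mathcomp Require Import measurable_realfun.

Set Implicit Arguments.
Unset Strict Implicit.
Unset Printing Implicit Defensive.
Import Order.TTheory GRing.Theory Num.Theory.
Import numFieldNormedType.Exports.

Local Open Scope classical_set_scope.
Local Open Scope ring_scope.

(* Row vectors carry the product sigma-algebra, as tuples do in the library:
   the one generated by the coordinate projections. *)
Definition measure_rV_display : measure_display -> measure_display.
Proof. exact. Qed.

Section measurable_rV.
Context {d} {T : measurableType d} (n : nat).

Let coord (i : 'I_n) (z : 'rV[T]_n) : T := z ord0 i.

Let rV_set0 : g_sigma_preimage coord set0.
Proof. exact: sigma_algebra0. Qed.

Let rV_setC A : g_sigma_preimage coord A -> g_sigma_preimage coord (~` A).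
Proof. exact: sigma_algebraC. Qed.

Let rV_bigcup (F : _^nat) : (forall i, g_sigma_preimage coord (F i)) ->
  g_sigma_preimage coord (\bigcup_i (F i)).
Proof. exact: sigma_algebra_bigcup. Qed.

HB.instance Definition _ := @isMeasurable.Build (measure_rV_display d)
  'rV[T]_n (g_sigma_preimage coord) rV_set0 rV_setC rV_bigcup.

Lemma measurable_coord_rV (i : 'I_n) :
  measurable_fun [set: 'rV[T]_n] (fun z => z ord0 i).
Proof.
move=> _ Y mY; rewrite setTI; apply: sub_sigma_algebra => /=.
rewrite -bigcup_seq/=; exists i => /=; first by rewrite mem_index_enum.
by exists Y => //; rewrite setTI.
Qed.

Lemma measurable_fun_rV d' (S : measurableType d') (f : S -> 'rV[T]_n) :
  (forall i, measurable_fun [set: S] (fun x => f x ord0 i)) ->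
  measurable_fun [set: S] f.
Proof.
move=> mf _ B mB; rewrite setTI.
have sB : [set A : set 'rV[T]_n | measurable (f @^-1` A)] B.
  apply: mB; split => [|C].
    split => [|A EA|F EF]; rewrite /mkset.
    - by rewrite preimage_set0.
    - by rewrite setTD preimage_setC; exact: measurableC.
    - by rewrite preimage_bigcup; exact: bigcupT_measurable.
  rewrite -bigcup_seq/= => -[i _ [A mA <-]]; rewrite /mkset setTI.
  by have := mf i measurableT A mA; rewrite setTI.
exact: sB.
Qed.

End measurable_rV.

Definition rV_snoc {T : Type} n (p : 'rV[T]_n * T) : 'rV[T]_n.+1 :=
  \row_i oapp (p.1 ord0) p.2 (unlift ord_max i).

Section lebesgue_snoc.
Local Open Scope ereal_scope.
Context {R : realType} (n : nat) (m : {sigma_finite_measure set 'rV[R]_n -> \bar R}).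

Let leb : {sigma_finite_measure set (measurableTypeR R) -> \bar R} :=
  @lebesgue_measure R.

Definition lebesgue_snoc : set 'rV[R]_n.+1 -> \bar R :=
  pushforward (m \x leb) (@rV_snoc R n).

Let measurable_snoc : measurable_fun [set: 'rV[R]_n * measurableTypeR R]
  (@rV_snoc R n).
Proof.
apply: measurable_fun_rV => i.
under eq_fun do rewrite mxE.
case: (unlift ord_max i) => [j|] /=; last exact: measurable_snd.
exact: (measurableT_comp (measurable_coord_rV j) measurable_fst).
Qed.

Let mE A : measurable A -> measurable (@rV_snoc R n @^-1` A).
Proof.
by move=> mA; rewrite -[X in measurable X]setTI; exact: measurable_snoc.
Qed.

Let lebesgue_snoc0 : lebesgue_snoc set0 = 0.
Proof. by rewrite /lebesgue_snoc/pushforward preimage_set0 measure0. Qed.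

Let lebesgue_snoc_ge0 A : 0 <= lebesgue_snoc A.
Proof. exact: measure_ge0. Qed.

Let lebesgue_snoc_sigma_additive : semi_sigma_additive lebesgue_snoc.
Proof.
move=> F mF tF mUF; rewrite /lebesgue_snoc/pushforward preimage_bigcup.
apply: measure_semi_sigma_additive.
- by move=> k; exact: mE.
- apply/trivIsetP => /= i j _ _ ij; rewrite -preimage_setI.
  by move/trivIsetP : tF => /(_ _ _ _ _ ij) ->//; rewrite preimage_set0.
- by rewrite -preimage_bigcup; exact: mE.
Qed.

HB.instance Definition _ := isMeasure.Build _ _ _ lebesgue_snoc
  lebesgue_snoc0 lebesgue_snoc_ge0 lebesgue_snoc_sigma_additive.

Let lebesgue_snoc_sigma_finite : sigma_finite setT lebesgue_snoc.
Proof.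
have /sigma_finiteP[F [TF ndF Foo]] := sigma_finiteT m.
have /sigma_finiteP[G [TG ndG Goo]] := sigma_finiteT leb.
pose f (z : 'rV[R]_n.+1) : 'rV[R]_n * measurableTypeR R :=
  (\row_j z ord0 (lift ord_max j), z ord0 ord_max).
have fK : cancel (@rV_snoc R n) f.
  move=> [x y]; rewrite /f/rV_snoc mxE unlift_none/=; congr pair.
  by apply/rowP => j; rewrite !mxE liftK.
have mf : measurable_fun setT f.
  apply/measurable_fun_pair.
    apply: measurable_fun_rV => j; under eq_fun do rewrite mxE.
    exact: measurable_coord_rV.
  exact: measurable_coord_rV.
exists (fun k => f @^-1` (F k `*` G k)).
  rewrite -preimage_bigcup (_ : \bigcup_k _ = setT) ?preimage_setT//.
  rewrite -setXTT TF TG predeqE => -[x y]; split=> [[k _ [/= Fx Gy]]|].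
    by split; exists k.
  move=> [/= [k _ Fkx] [l _ Gly]]; exists (maxn k l) => //; split.
  - by move: x Fkx; exact/subsetPset/ndF/leq_maxl.
  - by move: y Gly; exact/subsetPset/ndG/leq_maxr.
move=> k; have [mF Fk] := Foo k; have [mG Gk] := Goo k; split.
  by rewrite -[X in measurable X]setTI; apply: mf => //; exact: measurableX.
rewrite /lebesgue_snoc/pushforward -comp_preimage.
rewrite (_ : f \o _ = id); last by apply/funext => p /=; rewrite fK.
by rewrite product_measure1E// lte_mul_pinfty// ge0_fin_numE.
Qed.

HB.instance Definition _ := Measure_isSigmaFinite.Build _ _ _ lebesgue_snoc
  lebesgue_snoc_sigma_finite.

End lebesgue_snoc.

Fixpoint lebesgue_rV {R : realType} n :
    {sigma_finite_measure set 'rV[R]_n -> \bar R} :=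
  match n with
  | 0%N => \d_(0 : 'rV[R]_0)
  | n'.+1 => lebesgue_snoc (lebesgue_rV n')
  end.

Lemma lebesgue_rV_box {R : realType} n (I : 'I_n -> set R) :
  (forall i, measurable (I i)) ->
  lebesgue_rV n [set z | forall i, I i (z ord0 i)]
  = (\prod_(i < n) lebesgue_measure (I i))%E.
Proof.
elim: n I => [|n IH] I mI; first by rewrite big_ord0 /= diracE mem_set// => -[].
have wE (j : 'I_n) : widen_ord (leqnSn n) j = lift ord_max j.
  by apply/val_inj; rewrite /= /bump leqNgt ltn_ord.
pose J : set 'rV[R]_n :=
  [set x | forall j, I (widen_ord (leqnSn n) j) (x ord0 j)].
have mJ : measurable J.
  rewrite (_ : J = \bigcap_(j in [set: 'I_n])
      ((fun x : 'rV[R]_n => x ord0 j) @^-1` I (widen_ord (leqnSn n) j))).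
    apply: fin_bigcap_measurable => // j _.
    by rewrite -[X in measurable X]setTI; exact: measurable_coord_rV.
  by apply/seteqP; split => [x Hx j _|x Hx j]; exact: Hx.
have E : rV_snoc (n:=n) @^-1` [set z | forall i, I i (z ord0 i)] =
    J `*` (I ord_max : set (measurableTypeR R)).
  apply/seteqP; split => -[x y] /=.
    move=> H; split => [j|]; last by have := H ord_max; rewrite mxE unlift_none.
    by have := H (widen_ord (leqnSn n) j); rewrite mxE wE liftK.
  move=> [H1 H2] i; rewrite mxE; case: unliftP => [j ->|->] //=.
  by rewrite -wE; exact: H1.
rewrite big_ord_recr/= -(IH (fun j => I (widen_ord (leqnSn n) j)))//.
rewrite -[LHS]/((lebesgue_rV n \x @lebesgue_measure R)%E
  (rV_snoc (n:=n) @^-1` [set z | forall i, I i (z ord0 i)])) E.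
by rewrite product_measure1E//; exact: mI.
Qed.

(* The Lp-distance on the library's space of classes of functions modulo
   equality almost everywhere. *)
Section Lspace_metric.
Context d (T : measurableType d) (R : realType).
Variables (mu : {measure set T -> \bar R}) (p : \bar R) (p1 : (1 <= p)%E).

HB.instance Definition _ := gen_eqMixin (LspaceType mu p1).
HB.instance Definition _ := gen_choiceMixin (LspaceType mu p1).

Definition Lspace_dist (u v : LspaceType mu p1) : R :=
  fine 'N[mu]_p[EFin \o ((u : T -> R) \- (v : T -> R))%R]%E.

Let measurable_Lspace (u : LspaceType mu p1) :
  measurable_fun [set: T] (u : T -> R).
Proof. exact: (@measurable_funPT _ _ T (measurableTypeR R) (repr (LebesgueSpace.sort u))). Qed.

Let NB (u v : LspaceType mu p1) :
  'N[mu]_p[EFin \o ((u : T -> R) \- (v : T -> R))%R]%E = (Lspace_dist u v)%:E.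
Proof.
rewrite /Lspace_dist fineK// fin_numElt (lt_le_trans ltNy0) ?Lnorm_ge0//=.
apply: (@le_lt_trans _ _ ('N[mu]_p[EFin \o (u : T -> R)%R] +
    'N[mu]_p[EFin \o (\- (v : T -> R))%R])%E).
  by apply: eminkowski => //; exact: measurableT_comp.
rewrite (_ : EFin \o (\- _)%R = (\- (EFin \o (v : T -> R)))%E)// oppe_Lnorm.
by rewrite lte_add_pinfty//; exact: Lebesgue_finite.
Qed.

Let dist_xx u : Lspace_dist u u = 0.
Proof.
apply: EFin_inj; rewrite -NB (_ : _ \o _ = cst 0%E); last first.
  by apply/funext => x /=; rewrite subrr.
by rewrite Lnorm0// gt_eqF// (lt_le_trans _ p1).
Qed.

Let dist_sym u v : Lspace_dist u v = Lspace_dist v u.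
Proof.
apply: EFin_inj; rewrite -!NB -oppe_Lnorm; congr Lnorm.
by apply/funext => x /=; rewrite opprB.
Qed.

Let dist_triangle v u w : Lspace_dist u w <= Lspace_dist u v + Lspace_dist v w.
Proof.
rewrite -lee_fin EFinD -!NB.
rewrite (_ : (u : T -> R) \- (w : T -> R) = ((u : T -> R) \- (v : T -> R)) \+
    ((v : T -> R) \- (w : T -> R))); last first.
  by apply/funext => x /=; rewrite addrA subrK.
by apply: eminkowski => //; exact: measurable_funB.
Qed.

Let dist_eq0 u v : Lspace_dist u v = 0 -> u = v.
Proof.
move=> uv; have uv0 : 'N[mu]_p[EFin \o ((u : T -> R) \- (v : T -> R))%R]%E = 0%E.
  by rewrite NB uv.
have uvae : (u : T -> measurableTypeR R) = v %[ae mu].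
  have /Lnorm_eq0_eq0 : measurable_fun [set: T]
      (EFin \o ((u : T -> R) \- (v : T -> R))%R).
    by apply/measurable_EFinP; exact: measurable_funB.
  move=> /(_ _ p (lt_le_trans lte01 p1) uv0); apply: filterS => x + _.
  by move=> /(_ I) /= [] /eqP; rewrite subr_eq0 => /eqP.
have {uvae} : LebesgueSpace.sort u = LebesgueSpace.sort v.
  rewrite -[LHS]reprK -[RHS]reprK; apply/eqP.
  exact/ae_eqP.
case: u v uv uv0 => [u [[Hu]]] [v [[Hv]]] /= _ _ uv.
by rewrite -uv in Hv *; rewrite (Prop_irrelevance Hu Hv).
Qed.

HB.instance Definition _ := @isMetric.Build R (LspaceType mu p1) Lspace_dist
  dist_xx dist_eq0 dist_sym dist_triangle.

End Lspace_metric.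

Section weighted_measure.
Context {R : realType} (N : nat) (c a : R).

(* A point z of R^(N+1) is (x, y) with y the last coordinate. *)
Definition half_space : set 'rV[R]_N.+1 := [set z | 0 < z ord0 ord_max].

Definition weight (z : 'rV[R]_N.+1) : R :=
  (z ord0 ord_max) `^ c * expR (- (a * \sum_i z ord0 i ^+ 2)).

(* A measure on all of R^(N+1), carried by the half-space. *)
Definition weighted_measure (A : set 'rV[R]_N.+1) : \bar R :=
  (\int[lebesgue_rV N.+1]_(z in A `&` half_space) (weight z)%:E)%E.

Lemma measurable_half_space : measurable half_space.
Proof.
rewrite (_ : half_space = (fun z : 'rV[R]_N.+1 => z ord0 ord_max) @^-1` `]0, +oo[).
  by rewrite -[X in measurable X]setTI; exact: measurable_coord_rV.
by apply/seteqP; split => z /=; rewrite in_itv/= andbT.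
Qed.

Lemma measurable_weight : measurable_fun [set: 'rV[R]_N.+1] weight.
Proof.
apply: measurable_funM.
  exact: (measurableT_comp (measurable_powR c) (measurable_coord_rV ord_max)).
apply: measurableT_comp => //; apply: measurableT_comp => //.
apply: measurable_funM => //; apply: measurable_sum => i.
by apply: measurable_funX; exact: measurable_coord_rV.
Qed.

Lemma weight_ge0 z : 0 <= weight z.
Proof. by rewrite mulr_ge0 ?powR_ge0 ?expR_ge0. Qed.

Let weighted0 : weighted_measure set0 = 0%E.
Proof. by rewrite /weighted_measure set0I integral_set0. Qed.

Let weighted_ge0 A : (0 <= weighted_measure A)%E.
Proof. by apply: integral_ge0 => z _; rewrite lee_fin weight_ge0. Qed.

Let weighted_sigma_additive : semi_sigma_additive weighted_measure.
Proof.
move=> F mF tF mUF; rewrite /weighted_measure setI_bigcupl.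
rewrite ge0_integral_bigcup//=.
- apply: is_cvg_ereal_nneg_natsum_cond => n _ _.
  by apply: integral_ge0 => z _; rewrite lee_fin weight_ge0.
- by move=> k; apply: measurableI => //; exact: measurable_half_space.
- apply/measurable_EFinP; apply: measurable_funTS; exact: measurable_weight.
- by move=> z _; rewrite lee_fin weight_ge0.
- exact: trivIset_setIr.
Qed.

HB.instance Definition _ := isMeasure.Build _ _ _ weighted_measure
  weighted0 weighted_ge0 weighted_sigma_additive.

End weighted_measure.

Arguments half_space {R} N.

Section test_functions.
Context {R : realType} (N : nat).
Implicit Types phi : 'rV[R]_N.+1 -> R.

Definition partial (i : 'I_N.+1) phi : 'rV[R]_N.+1 -> R :=
  'D_(delta_mx ord0 i) phi.

Definition smooth phi := forall s : seq 'I_N.+1,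
  let psi := foldr partial phi s in
  continuous psi /\ forall i z, derivable psi z (delta_mx ord0 i).

(* C_c^infty of the open half-space, each function extended by 0. *)
Definition test_function phi :=
  [/\ smooth phi, compact (closure [set z | phi z != 0]) &
      closure [set z | phi z != 0] `<=` half_space N].

End test_functions.

Section weighted_sobolev.
Context {R : realType} (N : nat) (c a : R).

Let mu : {measure set 'rV[R]_N.+1 -> \bar R} := weighted_measure c a.

Definition L2_mu := LspaceType2 mu.

Definition L2_dot (u v : L2_mu) : R :=
  \int[mu]_z ((u z : R) * (v z : R)).

(* Unweighted Lebesgue measure: distributional derivatives. *)
Definition is_weak_gradient (u : L2_mu) (g : 'I_N.+1 -> L2_mu) :=
  forall phi, test_function phi -> forall i,
    \int[lebesgue_rV N.+1]_(z in half_space N) ((u z : R) * partial i phi z) =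
    - \int[lebesgue_rV N.+1]_(z in half_space N) ((g i z : R) * phi z).

(* The weak gradient is determined by the function, so that H1_mu is identified
   with the set of its first components. *)
Record H1_mu := {
  H1_val : L2_mu;
  H1_grad : 'I_N.+1 -> L2_mu;
  H1_gradP : is_weak_gradient H1_val H1_grad }.

Definition H1_dot (u v : H1_mu) : R :=
  L2_dot (H1_val u) (H1_val v) + \sum_i L2_dot (H1_grad u i) (H1_grad v i).

Definition H1_norm (u : H1_mu) : R := Num.sqrt (H1_dot u u).

End weighted_sobolev.

(* Bounded sets, with respect to a norm on the source, have relatively compact
   images. *)
Definition compact_map {R : realType} {X : Type} (norm : X -> R)
    {Y : topologicalType} (f : X -> Y) :=
  forall B : set X, (exists M, forall x, B x -> norm x <= M) ->
    precompact (f @` B).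

(* Main.v *)
(* The weight is a product of one-dimensional weights w_i.  A weak derivative
   along a coordinate, tested against products of bumps, yields on almost every
   line |v(s) - v(t)|^2 <= |q - p| * int_p^q g^2 for s, t in ]p, q[ off a null
   set.  From this, on one line,
     int (v - P v)^2 w <= eps (int v^2 w + int g^2 w)
   where P averages over finitely many cells and is 0 elsewhere: inside the cells
   this is Poincare's inequality; the mass of v near infinity and near 0 is small
   because a chain of blocks there is compared with a parallel chain of much
   heavier ones (for t -> 0 this is where c + 1 > 0 enters).  The w-averages P_i
   are contractions, so replacing u by P_0 ... P_N u costs little, uniformly on
   bounded sets of H^1, and P_0 ... P_N u is determined by finitely many bounded
   numbers.  Bounded sets are thus totally bounded in L^2, which is complete. *)

From HB Require Import structures.
Require Import Defs.
From mathcomp Require Import all_boot all_order all_algebra.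
From mathcomp Require Import all_classical all_reals all_analysis.
From mathcomp Require Import measurable_realfun.
From mathcomp Require Import ring lra zify.

Set Implicit Arguments.
Unset Strict Implicit.
Unset Printing Implicit Defensive.
Import Order.TTheory GRing.Theory Num.Theory.
Import numFieldNormedType.Exports.

Local Open Scope classical_set_scope.
Local Open Scope ring_scope.

(** * Integrals *)

(** The weight may blow up or vanish at y = 0, and neither traces nor extensions across the boundary
    are used: the mass near the boundary, like the mass near infinity, is charged to heavier blocks
    inside, and on what remains of a line the weight is comparable to a constant. No continuous
    representative is chosen either; the inequality between almost all pairs of points of a line is
    all that is kept of the derivative. The averages P_i u are step functions in the variable i, so
    they leave the Sobolev space and the one-dimensional estimate cannot be iterated on them.
    Instead, with S u an average in other directions, u - P_i S u is split as (u - P_i u) + P_i (u -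
    S u): only u itself is estimated through its gradient, the rest is contraction. *)

Section integral_tools.
Context d (T : measurableType d) (R : realType).
Local Open Scope ereal_scope.

(** Cauchy-Schwarz for the measure w dm, obtained from Hoelder's inequality for f sqrt(w) and
    sqrt(w), both cut off outside D. *)
Lemma sqr_fine_integral_le (m : {measure set T -> \bar R}) (D : set T)
    (f w : T -> R) :
  measurable D -> measurable_fun setT f -> measurable_fun setT w ->
  (forall x, 0 <= w x)%R ->
  ((fine (\int[m]_(x in D) (f x * w x)%:E)) ^+ 2)%:E <=
  \int[m]_(x in D) (w x)%:E * \int[m]_(x in D) (f x ^+ 2 * w x)%:E.
Proof.
move=> mD mf mw w0.
pose s x := Num.sqrt (w x).
have ms : measurable_fun setT s.
  by apply: measurableT_comp mw; apply: continuous_measurable_fun; exact: sqrt_continuous.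
pose F := ((fun x => f x * s x) \* \1_D)%R; pose G := (s \* \1_D)%R.
have mF : measurable_fun setT F.
  by apply: measurable_funM; [exact: measurable_funM|exact: measurable_indic].
have mG : measurable_fun setT G.
  by apply: measurable_funM => //; exact: measurable_indic.
have half : (2^-1 + 2^-1 = 1 :> R)%R by rewrite [RHS]splitr !div1r.
have H := @hoelder _ _ _ m F G 2 2 mF mG (ltr0n _ 2) (ltr0n _ 2) half.
have N2 (h : T -> R) : 'N[m]_2%:E[EFin \o h] ^+ 2 = \int[m]_x (h x ^+ 2)%:E.
  have sq (x : \bar R) : 0 <= x -> x ^+ 2 = x `^ 2%:R.
    case: x => [r r0|_|//]; first by rewrite poweR_EFin powR_mulrn// EFin_expe.
    by rewrite poweRyr// expe2 mulyy.
  rewrite sq ?Lnorm_ge0// poweR_Lnorm//.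
  by apply: eq_integral => x _ /=; rewrite powR_mulrn// real_normK// num_real.
have E1 : \int[m]_x (F x ^+ 2)%:E = \int[m]_(x in D) (f x ^+ 2 * w x)%:E.
  rewrite [RHS]integral_mkcond; apply: eq_integral => x _.
  rewrite /F/= patchE indicE; case: (x \in D); rewrite ?mulr1 ?mulr0 ?expr0n//=.
  by rewrite exprMn sqr_sqrtr.
have E2 : \int[m]_x (G x ^+ 2)%:E = \int[m]_(x in D) (w x)%:E.
  rewrite [RHS]integral_mkcond; apply: eq_integral => x _.
  rewrite /G/= patchE indicE; case: (x \in D); rewrite ?mulr1 ?mulr0 ?expr0n//=.
  by rewrite sqr_sqrtr.
have E3 : `|\int[m]_(x in D) (f x * w x)%:E| <= 'N[m]_1[EFin \o (F \* G)%R].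
  apply: (le_trans (le_abse_integral _ _ _)) => //.
    by apply: measurable_funTS; apply/measurable_EFinP; exact: measurable_funM.
  rewrite Lnorm1 integral_mkcond; apply: ge0_le_integral => //.
  - by move=> x _; rewrite patchE; case: ifP.
  - apply/(measurable_restrictT _ _).1 => //; apply: measurable_funTS.
    by apply: measurableT_comp => //; apply/measurable_EFinP; exact: measurable_funM.
  - by apply: measurableT_comp => //; apply/measurable_EFinP; exact: measurable_funM.
  - move=> x _; rewrite patchE /F /G /= !indicE.
    case: (x \in D); rewrite ?mulr1 ?mulr0 ?normr0//=.
    by rewrite -mulrA -expr2 sqr_sqrtr.
(* [fine] sends an infinite integral to 0, which only lowers the left side. *)
apply: (@le_trans _ _ (`|\int[m]_(x in D) (f x * w x)%:E| ^+ 2)).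
  rewrite expe2; case: (\int[m]_(x in D) _) => [r| |] /=.
  - by rewrite -EFinM lee_fin -expr2 real_normK// num_real.
  - by rewrite expr0n leey.
  - by rewrite expr0n leey.
apply: (@le_trans _ _ (('N[m]_2%:E[EFin \o F] * 'N[m]_2%:E[EFin \o G]) ^+ 2)).
  rewrite !expe2 lee_pmul// ?mule_ge0 ?Lnorm_ge0 ?(le_trans E3)//.
by rewrite expe2 muleACA -!expe2 !N2 E1 E2 muleC.
Qed.

Import HBNNSimple.

(** Simple functions increasing to f and monotone convergence on both sides reduce this to
    indicators, where it is the hypothesis on [nu]. *)
Lemma ge0_integral_density (m nu : {measure set T -> \bar R}) (w : T -> R)
    (f : T -> \bar R) :
  measurable_fun setT w -> (forall x, (0 <= w x)%R) ->
  (forall A, measurable A -> nu A = \int[m]_(x in A) (w x)%:E) ->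
  measurable_fun setT f -> (forall x, 0 <= f x) ->
  \int[nu]_x f x = \int[m]_x (f x * (w x)%:E).
Proof.
move=> mw w0 nuE mf f0.
have mwE : measurable_fun setT (fun x => (w x)%:E) by exact/measurable_EFinP.
pose h := nnsfun_approx measurableT mf.
have hf x : (h n x)%:E @[n --> \oo] --> f x.
  by apply: cvg_nnsfun_approx => // y _; exact: f0.
have ndh x : {homo (fun n => (h n x)%:E) : a b / (a <= b)%N >-> a <= b}.
  by move=> a b ab; rewrite lee_fin; exact/lefP/nd_nnsfun_approx.
have mh n : measurable_fun setT (fun x => (h n x)%:E).
  by apply/measurable_EFinP.
transitivity (limn (fun n => \int[nu]_x (h n x)%:E)).
  rewrite -monotone_convergence//.
  - by apply: eq_integral => x _; apply/esym/cvg_lim => //; exact: hf.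
  - by move=> n x _; rewrite lee_fin.
transitivity (limn (fun n => \int[m]_x ((h n x)%:E * (w x)%:E))); last first.
  rewrite -monotone_convergence//.
  - apply: eq_integral => x _; apply/cvg_lim => //.
    by apply: cvgeZr => //; exact: hf.
  - by move=> n; exact: emeasurable_funM.
  - by move=> n x _; rewrite mule_ge0 ?lee_fin.
  - by move=> x _ a b ab; rewrite lee_wpmul2r ?lee_fin//; exact: ndh.
apply/congr_lim/funext => n.
transitivity (\sum_(y \in range (h n)) y%:E * nu (h n @^-1` [set y])).
  by rewrite integralT_nnsfun sintegralE.
transitivity (\int[m]_x (\sum_(y \in range (h n))
    ((y * \1_(h n @^-1` [set y]) x)%:E * (w x)%:E))); last first.
  apply: eq_integral => x _; rewrite -ge0_mule_fsuml; last first.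
    by move=> y; exact: nnfun_muleindic_ge0.
  by rewrite fsumEFin// -(fimfunE _ x).
rewrite ge0_integral_fsum//; last 2 first.
  - by move=> y; apply: emeasurable_funM => //; apply/measurable_EFinP; exact: measurable_funM.
  - by move=> y x _; rewrite mule_ge0 ?nnfun_muleindic_ge0 ?lee_fin.
apply: eq_fsbigr => y; rewrite inE => -[x _ <-].
rewrite nuE//; under [RHS]eq_integral do rewrite EFinM -muleA.
rewrite ge0_integralZl//=.
- rewrite integral_mkcond; congr (_ * _); apply: eq_integral => z _.
  by rewrite epatch_indic muleC.
- by apply: emeasurable_funM => //; exact/measurable_EFinP.
- by move=> z _; rewrite mule_ge0 ?lee_fin.
- by rewrite lee_fin.
Qed.

(** The sets over which f has integral 0 form a Dynkin system, so a generating family closed under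
    intersection decides; a function with integral 0 over every measurable set vanishes almost
    everywhere. *)
Lemma ae_eq0_generators (m : {measure set T -> \bar R}) (G : set (set T))
    (D : set T) (f : T -> \bar R) :
  @measurable _ T = <<s G >> -> setI_closed G ->
  measurable D -> m.-integrable D f -> \int[m]_(x in D) f x = 0 ->
  (forall A, G A -> \int[m]_(x in D `&` A) f x = 0) ->
  ae_eq m D f (cst 0).
Proof.
move=> mG GI mD fi f0 fG; apply: integral_ae_eq => // E ED mE.
rewrite integral0 -(setIidr ED); have mf := measurable_int _ fi.
have iDA A : measurable A -> m.-integrable (D `&` A) f.
  move=> mA; apply: integrableS fi => //; exact: measurableI.
apply: (dynkin_induction (P := fun A => \int[m]_(x in D `&` A) f x = 0) mG GI).
- by rewrite setIT.
- by [].
- move=> A mA fA.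
  have : \int[m]_(x in (D `&` A) `|` (D `&` ~` A)) f x = 0.
    by rewrite -setIUr setUv setIT.
  rewrite integral_setU//; [|exact: measurableI| |
      |by rewrite disj_set2E setIACA setICr setI0].
  - by rewrite fA add0e.
  - by apply: measurableI => //; exact: measurableC.
  - by rewrite -setIUr setUv setIT.
- move=> F mF tF F0; rewrite setI_bigcupr integral_bigcup.
  - by rewrite eseries0// => i _ _; exact: F0.
  - exact: trivIset_setIl.
  - by move=> k; exact: measurableI.
  - rewrite -setI_bigcupr; apply: iDA; exact: bigcupT_measurable.
- by rewrite -mG.
Qed.

(* Sets that meet only when their indices differ by at most K cover each point
   at most K + 1 times. *)
Lemma nneseries_integral_overlap (m : {measure set T -> \bar R}) (K : nat)
    (A : nat -> set T) (f : T -> \bar R) :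
  (forall n, measurable (A n)) ->
  (forall n k, (n + K < k)%N -> A n `&` A k = set0) ->
  measurable_fun setT f -> (forall x, 0 <= f x) ->
  \sum_(n <oo) \int[m]_(x in A n) f x <= K.+1%:R%:E * \int[m]_x f x.
Proof.
move=> mA AK mf f0.
under eq_eseriesr do rewrite integral_mkcond.
have mfA n : measurable_fun setT (f \_ (A n)).
  by apply/(measurable_restrictT _ _).1 => //; exact: measurable_funTS.
have fA0 n x : 0 <= (f \_ (A n)) x by rewrite patchE; case: ifP.
rewrite -integral_nneseries// -ge0_integralZl//.
apply: ge0_le_integral => //.
- by move=> x _; apply: nneseries_ge0.
- by apply: ge0_emeasurable_sum.
- by apply: emeasurable_funM => //; exact: measurable_cst.
move=> x _; apply: lime_le; first exact: is_cvg_nneseries.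
apply: nearW => N; rewrite big_mkord.
have [[n0 An0]|nA] := pselect (exists n, A n x); last first.
  rewrite big1 ?mule_ge0 ?lee_fin// => i _; rewrite patchE memNset// => Ai.
  by apply: nA; exists i.
pose P := fun n => `[< A n x >].
have [|n1 /asboolP An1 n1_min] := @ex_minnP P; first by exists n0; exact/asboolP.
(* [n1] is the first index whose set contains x, so only the K + 1 indices from [n1] to [n1 + K]
   contribute. *)
have F0 i : ~~ (n1 <= i < n1 + K.+1)%N -> (f \_ (A i)) x = 0.
  move=> ni; rewrite patchE memNset// => Ai; move: ni.
  rewrite n1_min ?addnS ?ltnS//=; last exact/asboolP.
  by rewrite -ltnNge => /AK A0; have : (A n1 `&` A i) x by []; rewrite A0.
apply: (@le_trans _ _ (\sum_(0 <= i < n1 + K.+1 + N) (f \_ (A i)) x)).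
  rewrite -(big_mkord xpredT (fun i => (f \_ (A i)) x)).
  apply: lee_sum_nneg_natr => //; exact: leq_addl.
rewrite (big_cat_nat _ (n := n1)) ?addnA//=; last first.
  by rewrite -addnA leq_addr.
rewrite big_nat big1 ?add0e; last first.
  by move=> i /andP[_ i1]; rewrite F0// leqNgt i1.
rewrite (big_cat_nat _ (n := (n1 + K.+1)%N)) ?leq_addr//=.
rewrite [X in _ + X]big_nat [X in _ + X]big1 ?adde0; last first.
  by move=> i /andP[i1 _]; rewrite F0// negb_and -!leqNgt i1 orbT.
apply: (@le_trans _ _ (\sum_(n1 <= i < n1 + K.+1) f x)).
  by apply: lee_sum => i _; rewrite patchE; case: ifP.
rewrite big_const_nat addKn.
have -> k : iter k (fun y => f x + y) 0 = k%:R%:E * f x.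
  elim: k => [|k IH]; first by rewrite mul0e.
  by rewrite iterS IH -natr1 EFinD ge0_muleDl ?lee_fin// mul1e addeC.
by [].
Qed.

End integral_tools.

(** * Test functions *)

Section smooth_bump.
Context {R : realType}.
Implicit Types (p r : {poly R}) (b : R -> R).

(** For s >= 0 the k-th term of the exponential series gives s^k e^(-s) <= k!; the bounds are summed
    over the coefficients. *)
Lemma expR_bounded_horner p :
  exists2 C : R, 0 <= C & forall s, 0 <= s -> `|p.[s]| * expR (- s) <= C.
Proof.
have key k (s : R) : 0 <= s -> s ^+ k * expR (- s) <= k`!%:R.
  move=> s0; rewrite expRN ler_pdivrMr ?expR_gt0//.
  case: k => [|k]; first by rewrite expr0 mul1r (le_trans _ (expR_ge1Dx s))// lerDl.
  rewrite mulrC -ler_pdivrMr ?ltr0n ?fact_gt0//.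
  by rewrite (le_trans _ (expR_ge1Dxn k s0))// lerDr.
exists (\sum_(k < size p) `|p`_k| * k`!%:R).
  by apply: sumr_ge0 => k _; rewrite mulr_ge0.
move=> s s0; rewrite horner_coef.
apply: (@le_trans _ _ ((\sum_(k < size p) `|p`_k| * s ^+ k) * expR (- s))).
  rewrite ler_wpM2r ?expR_ge0//; apply: le_trans (ler_norm_sum _ _ _) _.
  by apply: ler_sum => k _; rewrite normrM normrX (ger0_norm s0).
by rewrite mulr_suml; apply: ler_sum => k _; rewrite -mulrA ler_wpM2l// key.
Qed.

(* With s = 1/x the function is p(s) e^(-s), and d/dx = - s^2 d/ds: the
   derivative stays in this class. *)
Definition flat_exp p (x : R) : R :=
  if 0 < x then p.[x^-1] * expR (- x^-1) else 0.

Definition flat_exp_deriv p : {poly R} := 'X^2 * (p - p^`()).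

Lemma flat_exp_le0 p x : x <= 0 -> flat_exp p x = 0.
Proof. by rewrite /flat_exp ltNge => ->. Qed.

(** Trading a factor x for a factor ['X] shows that [flat_exp] is O(x) at 0, and makes its
    difference quotient at 0 a function of the same class. *)
Lemma flat_exp_mulX p x : flat_exp ('X * p) x * x = flat_exp p x.
Proof.
rewrite /flat_exp; case: ifPn => [x0|_]; last by rewrite mul0r.
by rewrite !hornerE mulrAC [_ * x]mulrAC mulVf ?gt_eqF// mul1r.
Qed.

Lemma flat_exp_continuous0 p : {for 0, continuous (flat_exp p)}.
Proof.
have [C C0 HC] := expR_bounded_horner ('X * p).
have bd x : `|flat_exp p x| <= C * `|x|.
  rewrite -flat_exp_mulX normrM ler_wpM2r// /flat_exp.
  case: ifPn => x0; last by rewrite normr0.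
  by rewrite normrM (ger0_norm (expR_ge0 _)) HC// invr_ge0 ltW.
have F0 : flat_exp p 0 = 0 by rewrite flat_exp_le0.
rewrite /prop_for /continuous_at F0; apply/norm_cvg0P.
apply: (@squeeze_cvgr _ _ _ _ (cst 0) (fun x => C * `|x|)).
- by apply: nearW => x; rewrite normr_ge0 bd.
- exact: cvg_cst.
- rewrite -[X in _ --> X](mulr0 C); apply: cvgMr => //.
  by have := @norm_continuous _ R^o 0; rewrite /continuous_at normr0.
Qed.

Lemma is_derive_flat_exp p (x : R) :
  is_derive x 1 (flat_exp p) (flat_exp (flat_exp_deriv p) x).
Proof.
have [x0|x0|->] := ltgtP x 0.
- rewrite flat_exp_le0 ?ltW//; apply: (@near_eq_is_derive _ _ _ (cst 0)).
    near=> y; rewrite flat_exp_le0//.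
    by apply: ltW; near: y; exact: lt_nbhsl.
- apply: (@near_eq_is_derive _ _ _ ((horner p \o GRing.inv) * (expR \o (fun y => - y^-1)))).
    near=> y; rewrite /flat_exp ifT//.
    by near: y; exact: lt_nbhsr.
  have xn0 : x != 0 by rewrite gt_eqF.
  have dV : is_derive x 1 (fun y : R => y^-1) (- x ^- 2).
    by apply: is_derive_eq (is_deriveV xn0 (is_derive_id x 1)) _; rewrite [LHS]mulr1.
  have dp : is_derive x 1 (horner p \o GRing.inv) (p^`().[x^-1] * (- x ^- 2)).
    exact: is_derive1_comp.
  have de : is_derive x 1 (expR \o (fun y => - y^-1)) (expR (- x^-1) * (x ^- 2)).
    have dN : is_derive x 1 (fun y : R => - y^-1) (x ^- 2).
      by rewrite -[X in is_derive _ _ _ X]opprK; exact: is_deriveN.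
    exact: is_derive1_comp.
  apply: is_derive_eq (is_deriveM dp de) _.
  rewrite /flat_exp x0 /flat_exp_deriv !hornerE/= -!exprVn /GRing.scale/=.
  ring.
- rewrite flat_exp_le0//; apply/is_derive1_caratheodory.
  exists (flat_exp ('X * p)); split.
  + by move=> z; rewrite subr0 flat_exp_mulX [X in _ - X]flat_exp_le0// subr0.
  + exact: flat_exp_continuous0.
  + by rewrite flat_exp_le0.
Unshelve. all: by end_near. Qed.

(** Smoothness is carried by an explicit sequence of successive derivatives, so that a partial
    derivative of a product of such functions is a mere shift of indices. *)
Definition smooth_seq (d : nat -> R -> R) :=
  forall n (x : R), is_derive x 1 (d n) (d n.+1 x).

Lemma smooth_seq_continuous d : smooth_seq d -> forall n, continuous (d n).
Proof.
move=> sd n x; apply/differentiable_continuous/derivable1_diffP.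
by have [] := sd n x.
Qed.

Section bump.
Variable q : {poly R}.

Let val (s : seq ({poly R} * {poly R})) (x : R) : R :=
  \sum_(rp <- s) rp.1.[x] * flat_exp rp.2 q.[x].

(** A pair (r, p) stands for r times [flat_exp p] composed with q. Such sums are closed under
    differentiation, and [D] is the product and chain rule on their lists. *)
Let D (s : seq ({poly R} * {poly R})) :=
  flatten [seq [:: (rp.1^`(), rp.2); (rp.1 * q^`(), flat_exp_deriv rp.2)]
          | rp <- s].

Lemma flat_exp_comp_smooth :
  exists2 d, smooth_seq d & d 0%N = (fun x => flat_exp 1 q.[x]).
Proof.
exists (fun n => val (iter n D [:: (1, 1)])); last first.
  by apply/funext => x; rewrite /val /= big_seq1 hornerC mul1r.
move=> n x /=; move: (iter n D _) => s {n}.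
elim: s => [|[r p] s IH].
  rewrite (_ : val [::] = cst 0); first exact: is_derive_cst.
  by apply/funext => y; rewrite /val big_nil.
rewrite (_ : val _ = (horner r * (flat_exp p \o horner q)) + val s); last first.
  by apply/funext => y; rewrite /val big_cons.
have dq := is_derive_poly q x.
have dr := is_derive_poly r x.
have dp : is_derive x 1 (flat_exp p \o horner q)
    (flat_exp (flat_exp_deriv p) q.[x] * q^`().[x]).
  by apply: is_derive1_comp; exact: is_derive_flat_exp.
apply: is_derive_eq (is_deriveD (is_deriveM dr dp) IH) _.
rewrite /val /D/= !big_cons /= -/(D s) addrA; congr (_ + _).
by rewrite hornerM /GRing.scale/=; ring.
Qed.

End bump.

End smooth_bump.

(** * Singling out one coordinate: Fubini's theorem on row vectors *)

Definition ins {T : Type} n (i : 'I_n.+1) (p : 'rV[T]_n * T) : 'rV[T]_n.+1 :=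
  \row_j oapp (p.1 ord0) p.2 (unlift i j).

Lemma insE_at {T : Type} n (i : 'I_n.+1) (x : 'rV[T]_n) (t : T) :
  ins i (x, t) ord0 i = t.
Proof. by rewrite mxE unlift_none. Qed.

Lemma insE_lift {T : Type} n (i : 'I_n.+1) (x : 'rV[T]_n) (t : T) j :
  ins i (x, t) ord0 (lift i j) = x ord0 j.
Proof. by rewrite mxE liftK. Qed.

Section rV_boxes.
Context {R : realType} (n : nat).

Definition rV_box (I : 'I_n -> set R) : set 'rV[R]_n :=
  [set z | forall i, I i (z ord0 i)].

Lemma measurable_rV_box (I : 'I_n -> set R) :
  (forall i, measurable (I i)) -> measurable (rV_box I).
Proof.
move=> mI; rewrite (_ : rV_box I = \bigcap_(j in [set: 'I_n])
      ((fun x : 'rV[R]_n => x ord0 j) @^-1` I j)).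
  apply: fin_bigcap_measurable => // j _.
  by rewrite -[X in measurable X]setTI; exact: measurable_coord_rV.
by apply/seteqP; split => [x Hx j _|x Hx j]; exact: Hx.
Qed.

Lemma measurable_rV_gen (G : set (set 'rV[R]_n)) :
  G `<=` measurable ->
  (forall i (A : set (measurableTypeR R)), measurable A ->
     <<s G >> [set z : 'rV[R]_n | A (z ord0 i)]) ->
  @measurable _ 'rV[R]_n = <<s G >>.
Proof.
move=> mG cylG; apply/seteqP; split; last first.
  apply: smallest_sub => //; split.
  - exact: measurable0.
  - by move=> A mA; rewrite setTD; exact: measurableC.
  - by move=> F mF; exact: bigcupT_measurable.
apply: smallest_sub.
  exact: smallest_sigma_algebra.
move=> A; rewrite -bigcup_seq/= => -[i _ [B mB <-]].
by rewrite setTI; exact: cylG.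
Qed.

End rV_boxes.

Section fubini_coordinate.
Context {R : realType} (n : nat) (i : 'I_n.+1).
Let leb : {sigma_finite_measure set (measurableTypeR R) -> \bar R} :=
  @lebesgue_measure R.

Lemma measurable_ins : measurable_fun [set: 'rV[R]_n * measurableTypeR R]
  (@ins R n i).
Proof.
apply: measurable_fun_rV => j.
under eq_fun do rewrite mxE.
case: (unlift i j) => [k|] /=; last exact: measurable_snd.
exact: (measurableT_comp (measurable_coord_rV k) measurable_fst).
Qed.

HB.instance Definition _ := isMeasurableFun.Build _ _
  ('rV[R]_n * measurableTypeR R)%type 'rV[R]_n.+1 (@ins R n i) measurable_ins.

Lemma preimage_ins_box (I : 'I_n.+1 -> set R) :
  @ins R n i @^-1` rV_box I =
  rV_box (fun j => I (lift i j)) `*` (I i : set (measurableTypeR R)).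
Proof.
apply/seteqP; split => -[x t] /=.
  move=> H; split => [j|]; last by have := H i; rewrite insE_at.
  by have := H (lift i j); rewrite insE_lift.
move=> [H1 H2] j; case: (unliftP i j) => [k ->|->]; last by rewrite insE_at.
by rewrite insE_lift; exact: H1.
Qed.

(** [lebesgue_rV] is built by adjoining the last coordinate, whereas here any coordinate is split
    off. Both measures give a box the product of its side lengths, boxes generate and are closed
    under intersection, and the cubes [g k] of finite measure exhaust the space. *)
Lemma lebesgue_rV_ins (A : set 'rV[R]_n.+1) : measurable A ->
  lebesgue_rV n.+1 A = pushforward (lebesgue_rV n \x leb)%E (@ins R n i) A.
Proof.
move=> mA.
pose G := [set B : set 'rV[R]_n.+1 | exists2 I : 'I_n.+1 -> set (measurableTypeR R),
  (forall j, measurable (I j)) & B = rV_box I].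
pose g (k : nat) : set 'rV[R]_n.+1 := rV_box (fun=> `]- k%:R, k%:R[%classic).
pose m2 := measure_function_pushforward__canonical__measure_function_Measure
  (lebesgue_rV n \x leb)%E measurable_ins.
apply: (@measure_unique _ _ _ G g _ _ _ _ (lebesgue_rV n.+1) m2 _ _ A mA).
- apply: measurable_rV_gen; first by move=> _ [I mI ->]; exact: measurable_rV_box.
  move=> j B mB; apply: sub_sigma_algebra => /=.
  exists (fun l => if l == j then B else setT); first by move=> l; case: ifP.
  apply/seteqP; split => z /=; last by move=> /(_ j); rewrite eqxx.
  by move=> Bz l; case: eqP => // ->.
- move=> _ _ [I mI ->] [J mJ ->]; exists (fun j => I j `&` J j).
    by move=> j; exact: measurableI.
  apply/seteqP; split => z /=; first by move=> [H1 H2] j; split.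
  by move=> H; split=> j; have [] := H j.
- by move=> k; exists (fun=> `]- k%:R, k%:R[%classic).
- apply/seteqP; split => // z _.
  pose M := \sum_j `|z ord0 j|.
  exists (Num.truncn M).+1 => // j /=.
  rewrite in_itv/= -ltr_norml (le_lt_trans _ (truncnS_gt _))//.
  by rewrite /M (bigD1 j)//= lerDl sumr_ge0.
- move=> _ [I mI ->].
  rewrite -[RHS]/((lebesgue_rV n \x leb)%E (@ins R n i @^-1` rV_box I)).
  rewrite preimage_ins_box product_measure1E; last 2 first.
  - by apply: measurable_rV_box => j; exact: mI.
  - exact: mI.
  rewrite [LHS](lebesgue_rV_box mI) (bigD1_ord i)//= muleC; congr (_ * _)%E.
  rewrite -(lebesgue_rV_box (I := fun j => I (lift i j))); last first.
    by move=> j; exact: mI.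
  by [].
- move=> k; rewrite [ltLHS]lebesgue_rV_box//.
  suff : (0 <= \prod_(j < n.+1) leb `](- k%:R)%R, k%:R[%classic < +oo)%E.
    by case/andP.
  elim/big_ind : _ => /=; first by rewrite lee01 ltry.
    move=> x y /andP[x0 xy] /andP[y0 yy]; rewrite mule_ge0//=.
    by rewrite lte_mul_pinfty// ge0_fin_numE.
  move=> j _; rewrite measure_ge0/= lebesgue_measure_itv/=.
  by case: ifP; rewrite -?EFinD ltry.
Qed.

Lemma ge0_integral_lebesgue_rV (f : 'rV[R]_n.+1 -> \bar R) :
  measurable_fun setT f -> (forall z, 0 <= f z)%E ->
  (\int[lebesgue_rV n.+1]_z f z =
   \int[lebesgue_rV n]_x \int[leb]_t f (ins i (x, t)))%E.
Proof.
move=> mf f0.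
rewrite (eq_measure_integral
    (measure_function_pushforward__canonical__measure_function_Measure
      (lebesgue_rV n \x leb)%E measurable_ins)); last first.
  by move=> A mA _; rewrite [LHS](lebesgue_rV_ins mA).
rewrite (ge0_integral_pushforward measurable_ins)//.
rewrite preimage_setT fubini_tonelli1//.
  exact: measurableT_comp mf measurable_ins.
by move=> x; exact: f0.
Qed.

Lemma integrable_ins (f : 'rV[R]_n.+1 -> \bar R) :
  (lebesgue_rV n.+1).-integrable setT f ->
  (lebesgue_rV n \x leb)%E.-integrable setT (f \o @ins R n i).
Proof.
move=> /integrableP[mf foo]; apply/integrableP; split.
  exact: measurableT_comp mf measurable_ins.
rewrite fubini_tonelli1//; last first.
  apply: measurableT_comp => //; exact: measurableT_comp mf measurable_ins.
move: foo; rewrite ge0_integral_lebesgue_rV//.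
exact: measurableT_comp.
Qed.

Lemma integral_lebesgue_rV (f : 'rV[R]_n.+1 -> \bar R) :
  (lebesgue_rV n.+1).-integrable setT f ->
  (\int[lebesgue_rV n.+1]_z f z =
   \int[lebesgue_rV n]_x \int[leb]_t f (ins i (x, t)))%E.
Proof.
move=> fi; have fi' := integrable_ins fi.
rewrite (eq_measure_integral
    (measure_function_pushforward__canonical__measure_function_Measure
      (lebesgue_rV n \x leb)%E measurable_ins)); last first.
  by move=> A mA _; rewrite [LHS](lebesgue_rV_ins mA).
rewrite (integral_pushforward measurable_ins)//.
- by rewrite preimage_setT -integral12_prod_meas1.
- exact: measurable_int fi.
Qed.

End fubini_coordinate.

Section product_test_functions.
Context {R : realType} (N : nat).

(** [m] is a multi-index of orders of derivation. *)
Definition prod_rV (d : 'I_N.+1 -> nat -> R -> R) (m : 'I_N.+1 -> nat)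
  (z : 'rV[R]_N.+1) : R := \prod_j d j (m j) (z ord0 j).

Variable d : 'I_N.+1 -> nat -> R -> R.
Hypothesis sd : forall j, smooth_seq (d j).

Lemma is_derive_prod_rV m i z :
  is_derive z (delta_mx ord0 i) (prod_rV d m)
    (prod_rV d (fun j => m j + (j == i))%N z).
Proof.
pose C := \prod_(j | j != i) d j (m j) (z ord0 j).
have E h : prod_rV d m (h *: delta_mx ord0 i + z) =
    C * d i (m i) (h *: (1 : R) + z ord0 i).
  rewrite /prod_rV (bigD1 i)//= mulrC !mxE !eqxx/= mulr1 [h *: 1]mulr1.
  congr (_ * _); apply: eq_bigr => j ji.
  by rewrite !mxE eqxx (negPf ji)/= mulr0 add0r.
have E0 : prod_rV d m z = C * d i (m i) (z ord0 i).
  by have := E 0; rewrite !scale0r !add0r.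
have dC : is_derive (z ord0 i) (1 : R) (C *: (d i (m i) : R -> R^o))
    (C *: (d i (m i).+1 (z ord0 i) : R^o)).
  by apply: is_deriveZ; exact: sd.
(* Along axis i the product is a constant times a function of one variable, so the two difference
   quotients are the same function of h. *)
have Q : (fun h : R => h^-1 *: ((prod_rV d m \o shift z) (h *: delta_mx ord0 i) -
      prod_rV d m z)) =
   (fun h : R => h^-1 *: (((C *: (d i (m i) : R -> R^o)) \o shift (z ord0 i))
      (h *: (1 : R)) - (C *: (d i (m i) : R -> R^o)) (z ord0 i))).
  by apply/funext => h /=; rewrite E E0.
have [dC1 dC2] := dC.
apply: DeriveDef; first by rewrite /derivable Q.
rewrite /derive Q -/(derive _ _ _) dC2.
rewrite /prod_rV (bigD1 i)//= eqxx addn1 mulrC; congr (_ * _).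
by apply: eq_bigr => j /negPf ->; rewrite addn0.
Qed.

Lemma partial_prod_rV m i :
  partial i (prod_rV d m) = prod_rV d (fun j => m j + (j == i))%N.
Proof. by apply/funext => z; rewrite /partial; have [_ ->] := is_derive_prod_rV m i z. Qed.

Lemma continuous_prod_rV m : continuous (prod_rV d m).
Proof.
apply: (@continuous_big R^o _ _ _ xpredT).
  exact: mul_continuous.
move=> j _ z.
apply: (@continuous_comp _ _ _ (fun z : 'rV[R]_N.+1 => z ord0 j) (d j (m j))).
  exact: coord_continuous.
exact: smooth_seq_continuous.
Qed.

Lemma smooth_prod_rV m : smooth (prod_rV d m).
Proof.
move=> s /=.
have [m' ->] : exists m', foldr (@partial R N) (prod_rV d m) s = prod_rV d m'.
  elim: s => [|i s [m' IH]] /=; first by exists m.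
  by rewrite IH partial_prod_rV; eexists.
split; first exact: continuous_prod_rV.
by move=> i z; have [] := is_derive_prod_rV m' i z.
Qed.

Lemma test_function_prod_rV (P Q : 'I_N.+1 -> R) :
  (forall j t, d j 0%N t != 0 -> P j <= t <= Q j) -> 0 < P ord_max ->
  test_function (prod_rV d (fun=> 0%N)).
Proof.
move=> supp P0.
pose K : set 'rV[R]_N.+1 := [set z | forall j, `[P j, Q j]%classic (z ord0 j)].
have cK : compact K.
  by apply: (@rV_compact R _ (fun j => `[P j, Q j]%classic)) => j; exact: segment_compact.
have clK : closed K.
  apply: compact_closed => //; exact: norm_hausdorff.
have sK : closure [set z | prod_rV d (fun=> 0%N) z != 0] `<=` K.
  rewrite closureE; apply: smallest_sub => // z /= /prodf_neq0 H j /=.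
  by rewrite in_itv/=; apply/supp/H.
split; first exact: smooth_prod_rV.
- apply: subclosed_compact cK sK; exact: closed_closure.
- move=> z /sK /(_ ord_max)/=; rewrite in_itv/= => /andP[+ _].
  exact: lt_le_trans.
Qed.

End product_test_functions.

Section bumps.
Context {R : realType}.
Local Notation leb := (@lebesgue_measure R).

(** For p <= q and t in ]p, q[ this is exp(-1 / ((k + 1) (t - p) (q - t))), which increases to 1
    with k: smooth approximations from below of the indicator of ]p, q[. *)
Definition bump (p q : R) (k : nat) (t : R) : R :=
  flat_exp 1 (k.+1%:R * ((t - p) * (q - t))).

Lemma bump_smooth p q k :
  exists2 d, smooth_seq d & d 0%N = bump p q k.
Proof.
have [d sd d0] := flat_exp_comp_smooth
  (k.+1%:R *: (('X - p%:P) * (q%:P - 'X)) : {poly R}).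
exists d => //; rewrite d0; apply/funext => t; rewrite /bump.
by rewrite !hornerE.
Qed.

Lemma bump_continuous p q k : continuous (bump p q k).
Proof.
have [d sd d0] := bump_smooth p q k.
by rewrite -d0; apply: (smooth_seq_continuous sd).
Qed.

Lemma measurable_bump p q k : measurable_fun [set: R] (bump p q k).
Proof. by apply: continuous_measurable_fun; exact: bump_continuous. Qed.

Lemma bump_ge0 p q k t : 0 <= bump p q k t.
Proof.
by rewrite /bump /flat_exp; case: ifP => // _; rewrite hornerC mul1r expR_ge0.
Qed.

Lemma bump_le1 p q k t : bump p q k t <= 1.
Proof.
rewrite /bump /flat_exp; case: ifP => // x0.
rewrite hornerC mul1r -[leRHS]expR0 ler_expR oppr_le0 invr_ge0.
exact: ltW.
Qed.

Lemma bump_out p q k t : p <= q -> ~~ (p < t < q) -> bump p q k t = 0.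
Proof.
move=> pq ptq; rewrite /bump flat_exp_le0// pmulr_rle0 ?ltr0n//.
move: ptq; rewrite negb_and -!leNgt => /orP[tp|qt].
  by rewrite mulr_le0_ge0 ?subr_le0 ?subr_ge0// (le_trans tp).
by rewrite mulr_ge0_le0 ?subr_le0 ?subr_ge0// (le_trans pq).
Qed.

Lemma bump_le_indic p q k t : p <= q -> bump p q k t <= \1_(`]p, q[%classic) t.
Proof.
move=> pq; rewrite indicE; have [ptq|ptq] := boolP (p < t < q).
  by rewrite mem_set/= ?in_itv// bump_le1.
by rewrite bump_out.
Qed.

Lemma cvg_bump p q t : p <= q ->
  bump p q k t @[k --> \oo] --> (\1_(`]p, q[%classic) t : R).
Proof.
move=> pq; rewrite indicE; have [ptq|ptq] := boolP (p < t < q); last first.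
  rewrite memNset/= ?in_itv//=; last exact/negP.
  by under eq_fun do rewrite bump_out//; exact: cvg_cst.
rewrite mem_set/= ?in_itv//.
have c0 : 0 < (t - p) * (q - t).
  by case/andP: ptq => pt tq; rewrite mulr_gt0 ?subr_gt0.
rewrite (_ : (fun k => _) =
    (fun k => expR (- (((t - p) * (q - t))^-1 * k.+1%:R^-1)))); last first.
  apply/funext => k; rewrite /bump /flat_exp mulr_gt0 ?ltr0n// hornerC mul1r.
  by rewrite invfM [X in - X]mulrC.
rewrite -[X in _ --> X]expR0 -oppr0 -(mulr0 ((t - p) * (q - t))^-1).
apply: continuous_cvg; first exact: continuous_expR.
apply: cvgN; apply: cvgMr => //; exact: cvg_harmonic.
Qed.

Lemma integrable_itv_indic (p q : R) (D : set R) : measurable D ->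
  leb.-integrable D (EFin \o \1_(`]p, q[%classic)).
Proof.
move=> mD; apply: (@integrableS _ _ _ _ setT) => //.
exact: integrable_indic_itv.
Qed.

Lemma integrable_bump p q k (D : set R) : p <= q -> measurable D ->
  leb.-integrable D (EFin \o bump p q k).
Proof.
move=> pq mD; apply: le_integrable (integrable_itv_indic p q mD) => //.
  by apply/measurable_EFinP; apply: measurable_funTS; exact: measurable_bump.
by move=> t _ /=; rewrite lee_fin !ger0_norm ?bump_ge0// bump_le_indic.
Qed.

Definition bump_primitive p q k (t : R) : R :=
  (\int[leb]_(x in `]-oo, t]) bump p q k x)%R.

Definition bump_mass p q k : R := (\int[leb]_x bump p q k x)%R.

Definition itv_primitive p q (t : R) : R :=
  (\int[leb]_(x in `]-oo, t]) \1_(`]p, q[%classic) x)%R.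

Lemma is_derive_bump_primitive p q k (t : R) : p <= q ->
  is_derive t 1 (bump_primitive p q k) (bump p q k t).
Proof.
move=> pq; have tt : t < t + 1 by rewrite ltrDl.
have fi : leb.-integrable [set` Interval -oo%O (BRight (t + 1))]
  (EFin \o bump p q k) by exact: integrable_bump.
have [d1 d2] := @continuous_FTC1 _ (bump p q k) -oo%O t _ tt fi (ltNyr _)
  (@bump_continuous p q k t).
apply: DeriveDef; first exact: d1.
by rewrite -derive1E; exact: d2.
Qed.

Lemma bump_mass_ge0 p q k : 0 <= bump_mass p q k.
Proof. by apply: Rintegral_ge0 => x _; exact: bump_ge0. Qed.

Lemma bump_primitive_ge0 p q k t : 0 <= bump_primitive p q k t.
Proof. by apply: Rintegral_ge0 => x _; exact: bump_ge0. Qed.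

Lemma bump_primitive_out p q k t : p <= q -> t <= p ->
  bump_primitive p q k t = 0.
Proof.
move=> pq tp; rewrite /bump_primitive; under eq_Rintegral => x.
  rewrite inE/= in_itv/= => xt.
  rewrite bump_out//; last by rewrite negb_and -leNgt (le_trans xt tp).
  over.
by rewrite Rintegral_cst// mul0r.
Qed.

Lemma bump_primitive_mass p q k t : p <= q -> q <= t ->
  bump_primitive p q k t = bump_mass p q k.
Proof.
move=> pq qt; rewrite /bump_primitive /bump_mass Rintegral_mkcond.
apply: eq_Rintegral => x _; rewrite patchE; case: ifPn => //.
rewrite notin_setE/= in_itv/= => /negP; rewrite -ltNge => tx.
by rewrite bump_out// negb_and -!leNgt (le_trans qt (ltW tx)) orbT.
Qed.

Lemma bump_primitive_le p q k t : p <= q ->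
  bump_primitive p q k t <= bump_mass p q k.
Proof.
move=> pq; rewrite /bump_primitive /bump_mass Rintegral_mkcond.
apply: le_Rintegral => //.
- by rewrite -restrict_EFin -integrable_mkcond//; exact: integrable_bump.
- exact: integrable_bump.
- by move=> x _; rewrite patchE; case: ifPn => // _; exact: bump_ge0.
Qed.

Lemma cvg_Rintegral_bump p q (D : set R) : p <= q -> measurable D ->
  (\int[leb]_(x in D) bump p q k x)%R @[k --> \oo] -->
  (\int[leb]_(x in D) \1_(`]p, q[%classic) x)%R.
Proof.
move=> pq mD.
have := @dominated_cvg _ _ _ leb D mD (fun k => EFin \o bump p q k)
  (EFin \o \1_(`]p, q[%classic)) (EFin \o \1_(`]p, q[%classic)) _ _ _
  (integrable_itv_indic p q mD) _.
move=> H; apply: fine_cvg; rewrite fineK; last first.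
  exact: integrable_fin_num (integrable_itv_indic p q mD).
apply: H => //.
- move=> k; apply/measurable_EFinP; apply: measurable_funTS.
  exact: measurable_bump.
- by move=> x _; apply: cvg_EFin; [exact: nearW|exact: cvg_bump].
- by move=> k x _; rewrite lee_fin ger0_norm ?bump_ge0// bump_le_indic.
Qed.

Lemma cvg_bump_primitive p q t : p <= q ->
  bump_primitive p q k t @[k --> \oo] --> itv_primitive p q t.
Proof. by move=> pq; exact: cvg_Rintegral_bump. Qed.

Lemma Rintegral_itv_indic p q : p <= q ->
  (\int[leb]_x \1_(`]p, q[%classic) x)%R = q - p.
Proof.
move=> pq; rewrite /Rintegral integral_indic// setIT.
rewrite [X in fine X](lebesgue_measure_itv `]p, q[)/= lte_fin.
by move: pq; rewrite le_eqVlt => /predU1P[->|->]//; rewrite ltxx subrr.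
Qed.

Lemma cvg_bump_mass p q : p <= q -> bump_mass p q k @[k --> \oo] --> q - p.
Proof.
move=> pq; have := cvg_Rintegral_bump pq (@measurableT _ R).
by rewrite Rintegral_itv_indic.
Qed.

Lemma bump_mass_le p q k : p <= q -> bump_mass p q k <= q - p.
Proof.
move=> pq; rewrite -(Rintegral_itv_indic pq); apply: le_Rintegral => //.
- exact: integrable_bump.
- exact: integrable_itv_indic.
- by move=> x _; exact: bump_le_indic.
Qed.

End bumps.

(** * Weak derivatives along lines *)

Section dominated_multiplier.
Context d (T : measurableType d) (R : realType) (m : {measure set T -> \bar R}).
Variables (D K : set T) (h : T -> R) (chi_ : nat -> T -> R) (chi : T -> R) (C : R).
Hypotheses (mD : measurable D) (mK : measurable K).
Hypothesis mh : measurable_fun setT h.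
Hypothesis hK : m.-integrable K (EFin \o h).
Hypothesis mchi_ : forall k, measurable_fun setT (chi_ k).
Hypothesis chi_C : forall k z, `|chi_ k z| <= C.
Hypothesis chi_K : forall k z, ~ K z -> chi_ k z = 0.
Hypothesis chi_cvg : forall z, chi_ k z @[k --> \oo] --> chi z.


Let f_ k z : \bar R := (h z * chi_ k z)%:E.
Let G z : \bar R := (`|C| * (Num.norm \o h \_ K) z)%:E.

Let mchi : measurable_fun setT chi.
Proof. by apply: measurable_fun_cvg mchi_ _ => z _; exact: chi_cvg. Qed.

Let iG : m.-integrable D G.
Proof.
apply: (@integrableS _ _ _ _ setT) => //.
apply: (eq_integrable _ (fun z => (`|C|)%:E * (EFin \o (Num.norm \o h \_ K)) z)%E) => //.
apply: integrableZl => //.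
have -> : EFin \o (Num.norm \o h \_ K) = (abse \o (EFin \o h)) \_ K.
  by apply/funext => z /=; rewrite !patchE; case: ifP => //=; rewrite normr0.
by apply/(integrable_mkcond _ _).1 => //; exact: integrable_abse.
Qed.

Let f_G k z : D z -> (`|f_ k z| <= G z)%E.
Proof.
move=> _; rewrite /f_ /G lee_fin normrM /= patchE.
case: ifPn => [_|]; last by rewrite notin_setE => Kz; rewrite chi_K// normr0 !mulr0.
by rewrite mulrC ler_wpM2r// (le_trans (chi_C k z))// ler_norm.
Qed.

Let mf_ k : measurable_fun D (f_ k).
Proof. by apply/measurable_EFinP; apply: measurable_funTS; exact: measurable_funM. Qed.

Lemma integrable_multiplier : m.-integrable D (fun z => (h z * chi z)%:E).
Proof.
apply: le_integrable iG => //.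
  by apply/measurable_EFinP; apply: measurable_funTS; exact: measurable_funM.
move=> z Dz; rewrite [leRHS]gee0_abs; last by rewrite lee_fin mulr_ge0 ?normr_ge0//= patchE; case: ifP.
rewrite [leLHS]/= lee_fin.
have c : `|h z * chi_ k z| @[k --> \oo] --> `|h z * chi z|.
  by apply: cvg_norm; apply: cvgMr.
rewrite -(cvg_lim _ c)//; apply: limr_le; first by apply/cvg_ex; eexists; exact: c.
by apply: nearW => k; have := f_G k Dz; rewrite lee_fin.
Qed.

(** Dominated convergence with [G]: all [chi_ k] are bounded by C and live on K, where h is
    integrable. *)
Lemma cvg_multiplier :
  (\int[m]_(z in D) (h z * chi_ k z))%R @[k --> \oo] -->
  (\int[m]_(z in D) (h z * chi z))%R.
Proof.
apply: fine_cvg; rewrite fineK; last first.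
  by apply: integrable_fin_num => //; exact: integrable_multiplier.
apply: (@dominated_cvg _ _ _ m D mD f_ (fun z => (h z * chi z)%:E) G) => //.
by move=> z _; apply: cvg_EFin; [exact: nearW|apply: cvgMr].
Qed.

End dominated_multiplier.

Section bump_pair.
Context {R : realType} (p1 q1 p2 q2 : R).
Hypotheses (pq1 : p1 <= q1) (pq2 : p2 <= q2).

(** Each bump is weighted by the mass of the other, so that the combination has integral 0. Its
    primitive then vanishes on both sides of the two intervals and can serve as a test function in
    one variable. *)
Definition pair_bump k t : R :=
  bump_mass p2 q2 k * bump p1 q1 k t - bump_mass p1 q1 k * bump p2 q2 k t.

Definition pair_primitive k t : R :=
  bump_mass p2 q2 k * bump_primitive p1 q1 k t -
  bump_mass p1 q1 k * bump_primitive p2 q2 k t.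

Definition pair_indic (t : R) : R :=
  (q2 - p2) * \1_(`]p1, q1[%classic) t - (q1 - p1) * \1_(`]p2, q2[%classic) t.

Definition pair_itv_primitive t : R :=
  (q2 - p2) * itv_primitive p1 q1 t - (q1 - p1) * itv_primitive p2 q2 t.

Lemma pair_smooth k : exists2 d, smooth_seq d &
  d 0%N = pair_primitive k /\ d 1%N = pair_bump k.
Proof.
have [d1 sd1 d10] := bump_smooth p1 q1 k.
have [d2 sd2 d20] := bump_smooth p2 q2 k.
pose dd n t := bump_mass p2 q2 k * d1 n t - bump_mass p1 q1 k * d2 n t.
exists (fun n => if n is n'.+1 then dd n' else pair_primitive k).
  move=> [|n] x.
    have D1 := is_derive_bump_primitive k x pq1.
    have D2 := is_derive_bump_primitive k x pq2.
    rewrite /dd d10 d20.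
    exact: (is_deriveB (is_deriveZ (bump_mass p2 q2 k) D1)
      (is_deriveZ (bump_mass p1 q1 k) D2)).
  exact: (is_deriveB (is_deriveZ (bump_mass p2 q2 k) (sd1 n x))
    (is_deriveZ (bump_mass p1 q1 k) (sd2 n x))).
by split => //; apply/funext => t; rewrite /dd d10 d20.
Qed.

Lemma cvg_pair_bump t : pair_bump k t @[k --> \oo] --> pair_indic t.
Proof.
by apply: cvgB; (apply: cvgM; [exact: cvg_bump_mass|exact: cvg_bump]).
Qed.

Lemma cvg_pair_primitive t :
  pair_primitive k t @[k --> \oo] --> pair_itv_primitive t.
Proof.
by apply: cvgB; (apply: cvgM; [exact: cvg_bump_mass|exact: cvg_bump_primitive]).
Qed.

Lemma pair_bump_le k t : `|pair_bump k t| <= (q2 - p2) + (q1 - p1).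
Proof.
have b (p q p' q' : R) : p' <= q' ->
    `|bump_mass p' q' k * bump p q k t| <= q' - p'.
  move=> pq'; rewrite ger0_norm ?mulr_ge0 ?bump_mass_ge0 ?bump_ge0//.
  rewrite (le_trans _ (bump_mass_le k pq'))// ler_piMr ?bump_mass_ge0//.
  exact: bump_le1.
by rewrite (le_trans (ler_normB _ _))// lerD// b.
Qed.

Lemma pair_primitive_le k t : `|pair_primitive k t| <= (q1 - p1) * (q2 - p2).
Proof.
(* Both terms of the difference lie between 0 and the product of the two masses. *)
apply: (@le_trans _ _ (bump_mass p1 q1 k * bump_mass p2 q2 k)); last first.
  by rewrite ler_pM ?bump_mass_ge0 ?bump_mass_le.
have := bump_mass_ge0 p1 q1 k; have := bump_mass_ge0 p2 q2 k.
have := bump_primitive_ge0 p1 q1 k t; have := bump_primitive_ge0 p2 q2 k t.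
have := bump_primitive_le k t pq1; have := bump_primitive_le k t pq2.
rewrite /pair_primitive.
set m1 := bump_mass _ _ _; set m2 := bump_mass _ _ _.
set r1 := bump_primitive _ _ _ _; set r2 := bump_primitive _ _ _ _.
by move=> *; rewrite ler_norml; apply/andP; split; nra.
Qed.

Lemma pair_itv_primitive_le t :
  `|pair_itv_primitive t| <= (q1 - p1) * (q2 - p2).
Proof.
have c : `|pair_primitive k t| @[k --> \oo] --> `|pair_itv_primitive t|.
  by apply: cvg_norm; exact: cvg_pair_primitive.
rewrite -(cvg_lim _ c)//; apply: limr_le; first by apply/cvg_ex; eexists; exact: c.
by apply: nearW => k; exact: pair_primitive_le.
Qed.

Variables a b : R.
Hypotheses (ap1 : a <= p1) (ap2 : a <= p2) (qb1 : q1 <= b) (qb2 : q2 <= b).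

Lemma pair_bump_out k t : ~~ (a <= t <= b) -> pair_bump k t = 0.
Proof.
rewrite negb_and -!ltNge => H; rewrite /pair_bump !bump_out ?mulr0 ?subrr//.
- rewrite negb_and -!leNgt; case/orP: H => ab.
    by rewrite (le_trans (ltW ab)).
  by rewrite (le_trans qb2 (ltW ab)) orbT.
- rewrite negb_and -!leNgt; case/orP: H => ab.
    by rewrite (le_trans (ltW ab)).
  by rewrite (le_trans qb1 (ltW ab)) orbT.
Qed.

Lemma pair_primitive_out k t : ~~ (a <= t <= b) -> pair_primitive k t = 0.
Proof.
rewrite negb_and -!ltNge /pair_primitive => /orP[ta|bt].
  by rewrite !bump_primitive_out ?mulr0 ?subrr//; apply: (le_trans (ltW ta)).
rewrite !bump_primitive_mass//; first by rewrite mulrC subrr.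
- exact: le_trans qb2 (ltW bt).
- exact: le_trans qb1 (ltW bt).
Qed.

Lemma pair_indic_out t : ~~ (a <= t <= b) -> pair_indic t = 0.
Proof.
move=> tab; rewrite -(cvg_lim _ (@cvg_pair_bump t))//.
by apply: lim_near_cst => //; apply: nearW => k; exact: pair_bump_out.
Qed.

Lemma pair_itv_primitive_out t : ~~ (a <= t <= b) -> pair_itv_primitive t = 0.
Proof.
move=> tab; rewrite -(cvg_lim _ (@cvg_pair_primitive t))//.
by apply: lim_near_cst => //; apply: nearW => k; exact: pair_primitive_out.
Qed.

End bump_pair.

Section weak_derivative_boxes.
Context {R : realType} (N : nat) (i : 'I_N.+1).
Variables u g : 'rV[R]_N.+1 -> R.
Hypotheses (mu : measurable_fun setT u) (mg : measurable_fun setT g).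

Definition cbox (P Q : 'I_N.+1 -> R) : set 'rV[R]_N.+1 :=
  rV_box (fun j => `[P j, Q j]%classic).

Hypothesis iu : forall P Q, 0 < P ord_max ->
  (lebesgue_rV N.+1).-integrable (cbox P Q) (EFin \o u).
Hypothesis ig : forall P Q, 0 < P ord_max ->
  (lebesgue_rV N.+1).-integrable (cbox P Q) (EFin \o g).
Hypothesis weak : forall phi, test_function phi ->
  (\int[lebesgue_rV N.+1]_(z in half_space N) (u z * partial i phi z) =
  - \int[lebesgue_rV N.+1]_(z in half_space N) (g z * phi z))%R.

Definition indic_box (P Q : 'I_N.+1 -> R) (z : 'rV[R]_N.+1) : R :=
  \prod_(j | j != i) \1_(`]P j, Q j[%classic) (z ord0 j).

Lemma measurable_cbox P Q : measurable (cbox P Q).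
Proof. by apply: measurable_rV_box => j; exact: measurable_itv. Qed.

Lemma measurable_coord_comp (f : R -> R) j : measurable_fun setT f ->
  measurable_fun setT (fun z : 'rV[R]_N.+1 => f (z ord0 j)).
Proof. by move=> mf; exact: (measurableT_comp mf (measurable_coord_rV j)). Qed.

Section limit.
Variables (P Q : 'I_N.+1 -> R) (p1 q1 p2 q2 : R).
Hypotheses (pq1 : p1 <= q1) (pq2 : p2 <= q2).
Hypotheses (PQ : forall j, P j <= Q j) (P0 : 0 < P ord_max).
Hypotheses (Pp1 : P i <= p1) (Pp2 : P i <= p2) (qQ1 : q1 <= Q i) (qQ2 : q2 <= Q i).

Let bumps k (z : 'rV[R]_N.+1) := \prod_(j | j != i) bump (P j) (Q j) k (z ord0 j).

Let bumps_le k z : `|bumps k z| <= 1.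
Proof.
rewrite normr_prod; apply: prodr_ile1 => j _.
by rewrite normr_ge0 ger0_norm ?bump_ge0// bump_le1.
Qed.

Let mbumps k : measurable_fun setT (bumps k).
Proof.
rewrite /bumps; under eq_fun do rewrite big_mkcond/=.
apply: measurable_prod => j _; case: (j != i) => //.
by apply: measurable_coord_comp; exact: measurable_bump.
Qed.

Let cvg_bumps z : bumps k z @[k --> \oo] --> indic_box P Q z.
Proof.
apply: (@cvg_big R^o _ _ _ (fun j => j != i)).
  exact: mul_continuous.
by move=> j _; exact: cvg_bump.
Qed.

(** The weak derivative is tested against bumps in the variables other than i times [pair_primitive]
    in the variable i, whose i-th derivative has the factor [pair_bump]; then k tends to infinity on
    both sides. *)
Lemma weak_derivative_box :
  (\int[lebesgue_rV N.+1]_(z in half_space N)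
     (u z * (indic_box P Q z * pair_indic p1 q1 p2 q2 (z ord0 i))) =
   - \int[lebesgue_rV N.+1]_(z in half_space N)
     (g z * (indic_box P Q z * pair_itv_primitive p1 q1 p2 q2 (z ord0 i))))%R.
Proof.
pose chi1 k z := bumps k z * pair_bump p1 q1 p2 q2 k (z ord0 i).
pose chi2 k z := bumps k z * pair_primitive p1 q1 p2 q2 k (z ord0 i).
have mchi1 k : measurable_fun setT (chi1 k).
  apply: measurable_funM => //; apply: measurable_coord_comp.
  have [d sd [_ <-]] := pair_smooth pq1 pq2 k.
  by apply: continuous_measurable_fun; exact: (smooth_seq_continuous sd).
have mchi2 k : measurable_fun setT (chi2 k).
  apply: measurable_funM => //; apply: measurable_coord_comp.
  have [d sd [<- _]] := pair_smooth pq1 pq2 k.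
  by apply: continuous_measurable_fun; exact: (smooth_seq_continuous sd).
have out k z : ~ cbox P Q z -> chi1 k z = 0 /\ chi2 k z = 0.
  move=> /existsNP[j /=]; rewrite in_itv/= => /negP zj.
  have [ji|ji] := eqVneq j i.
    rewrite ji in zj.
    by rewrite /chi1 /chi2 (pair_bump_out _ _ _ _ _ _ _ zj)//
      (pair_primitive_out _ _ _ _ _ _ _ zj)// !mulr0.
  have b0 : bumps k z = 0.
    rewrite /bumps (bigD1 j)//= bump_out ?mul0r//.
    apply: contra zj => /andP[/ltW -> /ltW ->//].
  by rewrite /chi1 /chi2 b0 !mul0r.
have E k : (\int[lebesgue_rV N.+1]_(z in half_space N) (u z * chi1 k z) =
  - \int[lebesgue_rV N.+1]_(z in half_space N) (g z * chi2 k z))%R.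
  have [d sd [d0 d1]] := pair_smooth pq1 pq2 k.
  have /choice[e eP] j : exists e, smooth_seq e /\ e 0%N = bump (P j) (Q j) k.
    by have [e ? ?] := bump_smooth (P j) (Q j) k; exists e.
  pose dd j := if j == i then d else e j.
  have sdd j : smooth_seq (dd j).
    by rewrite /dd; case: ifP => // _; case: (eP j).
  have phiE (m : nat) z : prod_rV dd (fun j => if j == i then m else 0%N) z =
      bumps k z * d m (z ord0 i).
    rewrite /prod_rV (bigD1 i)//= /dd eqxx mulrC; congr (_ * _).
    by apply: eq_bigr => j /negPf ->; case: (eP j) => _ ->.
  have tf : test_function (prod_rV dd (fun=> 0%N)).
    apply: (test_function_prod_rV sdd (P := P) (Q := Q)) => // j t.
    rewrite /dd; case: (j =P i) => [->|_]; last first.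
      case: (eP j) => _ ->; apply: contraNT => Pt; rewrite bump_out//.
      by apply: contra Pt => /andP[/ltW -> /ltW ->].
    rewrite d0; apply: contraNT => Pt; apply/eqP.
    exact: (pair_primitive_out _ _ _ _ _ _ _ Pt).
  have E2 : prod_rV dd (fun=> 0%N) = chi2 k.
    apply: funext => z; rewrite /chi2 -d0 -phiE; congr prod_rV.
    by apply: funext => j; case: (j == i).
  have E1 : prod_rV dd (fun j => 0 + (j == i))%N = chi1 k.
    have -> : (fun j : 'I_N.+1 => 0 + (j == i))%N =
        (fun j => if j == i then 1%N else 0%N).
      by apply/funext => j; case: (j == i).
    by apply/funext => z; rewrite /chi1 -d1 -phiE.
  by have := weak tf; rewrite partial_prod_rV// E1 E2.
have mK : measurable (cbox P Q) := measurable_cbox P Q.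
have C1 := @cvg_multiplier _ _ _ (lebesgue_rV N.+1) (half_space N) (cbox P Q)
  u chi1 _ ((q2 - p2) + (q1 - p1)) (@measurable_half_space R N) mK mu (iu Q P0) mchi1.
have C2 := @cvg_multiplier _ _ _ (lebesgue_rV N.+1) (half_space N) (cbox P Q)
  g chi2 _ ((q1 - p1) * (q2 - p2)) (@measurable_half_space R N) mK mg (ig Q P0) mchi2.
have L1 : (- \int[lebesgue_rV N.+1]_(z in half_space N) (g z * chi2 k z))%R
    @[k --> \oo] --> (\int[lebesgue_rV N.+1]_(z in half_space N)
     (u z * (indic_box P Q z * pair_indic p1 q1 p2 q2 (z ord0 i))))%R.
  under eq_fun do rewrite -E; apply: C1.
  - move=> k z; rewrite normrM -[leRHS]mul1r ler_pM//.
    exact: pair_bump_le.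
  - by move=> k z /(out k)[].
  - by move=> z; apply: cvgM => //; exact: cvg_pair_bump.
rewrite -(cvg_lim (@norm_hausdorff _ R^o) L1).
apply: (cvg_lim (@norm_hausdorff _ R^o)); apply: cvgN; apply: C2.
- move=> k z; rewrite normrM -[leRHS]mul1r ler_pM//.
  exact: pair_primitive_le.
- by move=> k z /(out k)[].
- by move=> z; apply: cvgM => //; exact: cvg_pair_primitive.
Qed.

End limit.
End weak_derivative_boxes.

Section rays.
Context {R : realType} (n : nat).

(** Intersecting an open box with such a set gives an open box again, so the identity on boxes
    applies to these generators directly. *)
Definition rays : set (set 'rV[R]_n) :=
  [set A | exists r : 'I_n -> R, A = rV_box (fun j => `]r j, +oo[%classic)].

Lemma rays_setI_closed : setI_closed rays.
Proof.
move=> _ _ [r ->] [s ->]; exists (fun j => Num.max (r j) (s j)).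
apply/seteqP; split => z /=.
  move=> [rz sz] j; have := rz j; have := sz j.
  by rewrite /= !in_itv/= !andbT gt_max => -> ->.
by move=> H; split => j; have := H j; rewrite /= !in_itv/= !andbT gt_max => /andP[].
Qed.

Lemma measurable_rays : @measurable _ 'rV[R]_n = <<s rays >>.
Proof.
apply: measurable_rV_gen.
  by move=> _ [r ->]; apply: measurable_rV_box => j; exact: measurable_itv.
move=> i A mA.
pose P (B : set (measurableTypeR R)) := <<s rays >> [set z : 'rV[R]_n | B (z ord0 i)].
have sP : measurable `<=` P; last exact: sP.
rewrite [X in X `<=` _](RGenOInfty.measurableE R).
have sG : sigma_algebra setT <<s rays >> := smallest_sigma_algebra _ _.
apply: smallest_sub.
  split.
  - by rewrite /P; case: sG.
  - move=> B PB; rewrite /P setTD; case: sG => _ + _ => /(_ _ PB).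
    by rewrite setTD.
  - move=> F PF; rewrite /P.
    by case: sG => _ _ /(_ (fun k => [set z : 'rV[R]_n | F k (z ord0 i)]) PF);
      congr (_ _); apply/seteqP; split => z [k _ Fk]; exists k.
move=> _ [x ->]; rewrite /P.
(* A cylinder over coordinate i is the union over k of the rays whose other sides start at -k. *)
rewrite (_ : [set z | _] = \bigcup_k rV_box
    (fun j : 'I_n => `](if j == i then x else - k%:R), +oo[%classic)).
  case: sG => _ _; apply => k; apply: sub_sigma_algebra; by eexists.
apply/seteqP; split => z /=.
  move=> xz; pose M := \sum_j `|z ord0 j|.
  exists (Num.truncn M).+1 => // j /=; case: eqP => [->//|_].
  rewrite in_itv/= andbT ltrNl (le_lt_trans _ (truncnS_gt _))//.
  rewrite /M (bigD1 j)//= -[leLHS]addr0 lerD ?sumr_ge0//.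
  by rewrite -normrN ler_norm.
by move=> [k _ /(_ i)]; rewrite eqxx.
Qed.

End rays.

(** Up to the factor (q1 - p1) (q2 - p2), two means of v differ by at most the integral of |g|. The
    last hypothesis is the weak derivative identity on one line, and that same factor bounds
    [pair_itv_primitive]. *)
Lemma pair_mean_ineq {R : realType} (v g : R -> R) (p1 q1 p2 q2 a b : R) :
  let leb := @lebesgue_measure R in
  p1 <= q1 -> p2 <= q2 -> a <= p1 -> a <= p2 -> q1 <= b -> q2 <= b ->
  leb.-integrable `[a, b] (EFin \o v) -> leb.-integrable `[a, b] (EFin \o g) ->
  (\int[leb]_t ((v t * (\1_(`[a, b]%classic) t * pair_indic p1 q1 p2 q2 t))%:E +
     (g t * (\1_(`[a, b]%classic) t * pair_itv_primitive p1 q1 p2 q2 t))%:E) = 0)%E ->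
  `|(q2 - p2) * (\int[leb]_(t in `]p1, q1[) v t)%R -
    (q1 - p1) * (\int[leb]_(t in `]p2, q2[) v t)%R| <=
  (q1 - p1) * (q2 - p2) * (\int[leb]_(t in `[a, b]) `|g t|)%R.
Proof.
move=> leb pq1 pq2 ap1 ap2 qb1 qb2 iv ig.
set S := `[a, b]%classic => H0.
have mS : measurable (S : set (measurableTypeR R)) by exact: measurable_itv.
have ivS : leb.-integrable setT (EFin \o (v \_ S)).
  by rewrite -restrict_EFin; exact/(integrable_mkcond _ _).1.
have igS : leb.-integrable setT (EFin \o (g \_ S)).
  by rewrite -restrict_EFin; exact/(integrable_mkcond _ _).1.
have iI p q : a <= p -> q <= b -> leb.-integrable setT (EFin \o (v \_ `]p, q[)).
  move=> ap qb; rewrite -restrict_EFin; apply/(integrable_mkcond _ _).1 => //.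
  apply: integrableS iv => //; apply: subset_itv; rewrite bnd_simp//.
have Ev t : v t * (\1_S t * pair_indic p1 q1 p2 q2 t) =
    (q2 - p2) * (v \_ `]p1, q1[) t - (q1 - p1) * (v \_ `]p2, q2[) t.
  have -> : \1_S t * pair_indic p1 q1 p2 q2 t = pair_indic p1 q1 p2 q2 t.
    rewrite indicE; have [|] := boolP (t \in S); first by rewrite mul1r.
    rewrite notin_setE /S/= in_itv/= => /negP tS.
    by rewrite (@pair_indic_out _ _ _ _ _ pq1 pq2 a b)// mulr0.
  by rewrite /pair_indic !patch_indic /=; ring.
have pp_le := @pair_itv_primitive_le R p1 q1 p2 q2 pq1 pq2.
have mpp : measurable_fun setT (pair_itv_primitive p1 q1 p2 q2).
  apply: (@measurable_fun_cvg _ _ _ setT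
    (fun k => pair_primitive p1 q1 p2 q2 k)) => [k|t _]; last exact: cvg_pair_primitive.
  have [d sd [<- _]] := pair_smooth pq1 pq2 k.
  by apply: continuous_measurable_fun; exact: (smooth_seq_continuous sd).
have Eg t : g t * (\1_S t * pair_itv_primitive p1 q1 p2 q2 t) =
    (g \_ S) t * pair_itv_primitive p1 q1 p2 q2 t.
  by rewrite patch_indic /=; ring.
have iE1 : leb.-integrable setT
    (fun t => ((q2 - p2) * (v \_ `]p1, q1[) t - (q1 - p1) * (v \_ `]p2, q2[) t)%:E).
  apply: (@integrableB _ _ _ leb setT measurableT
    (fun t => (q2 - p2)%:E * ((v \_ `]p1, q1[) t)%:E)%E
    (fun t => (q1 - p1)%:E * ((v \_ `]p2, q2[) t)%:E)%E);
    by apply: integrableZl => //; exact: iI.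
have iE2 : leb.-integrable setT
    (fun t => ((g \_ S) t * pair_itv_primitive p1 q1 p2 q2 t)%:E).
  have := @integrableMl _ _ _ leb setT measurableT (EFin \o (g \_ S))
    (pair_itv_primitive p1 q1 p2 q2) igS.
  apply; first exact: measurable_funTS.
  exists ((q1 - p1) * (q2 - p2)); split; first exact: num_real.
  by move=> x Mx t _ /=; rewrite (le_trans (pp_le t))// ltW.
move: H0; under eq_integral do rewrite Ev Eg.
rewrite integralD//.
rewrite -[X in (X + _)%E]fineK; last exact: integrable_fin_num.
rewrite -[X in (_ + X)%E]fineK; last exact: integrable_fin_num.
rewrite -EFinD => -[] /eqP; rewrite addr_eq0 => /eqP H1.
have -> : (q2 - p2) * (\int[leb]_(t in `]p1, q1[) v t)%R -
    (q1 - p1) * (\int[leb]_(t in `]p2, q2[) v t)%R =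
    (\int[leb]_t ((q2 - p2) * (v \_ `]p1, q1[) t - (q1 - p1) * (v \_ `]p2, q2[) t))%R.
  have sc k p q : a <= p -> q <= b ->
      leb.-integrable setT (EFin \o (fun t => k * (v \_ `]p, q[) t)).
    by move=> ap qb; exact: (integrableZl measurableT k (iI p q ap qb)).
  rewrite [RHS](RintegralB measurableT (sc (q2 - p2) p1 q1 ap1 qb1)
    (sc (q1 - p1) p2 q2 ap2 qb2)).
  rewrite (RintegralZl (q2 - p2) measurableT (iI p1 q1 ap1 qb1)).
  rewrite (RintegralZl (q1 - p1) measurableT (iI p2 q2 ap2 qb2)).
  by rewrite -!Rintegral_mkcond.
rewrite /Rintegral H1 normrN -/(Rintegral _ _ _).
apply: (le_trans (le_normr_Rintegral _ _)) => //.
have igN : leb.-integrable setT (EFin \o ((fun t => `|g t|) \_ S)).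
  rewrite -restrict_EFin; apply/(integrable_mkcond _ _).1 => //.
  exact: integrable_norm.
rewrite [X in _ * X]Rintegral_mkcond.
rewrite -(RintegralZl ((q1 - p1) * (q2 - p2)) measurableT igN).
apply: le_Rintegral => //.
- exact: (integrable_norm iE2).
- exact: (integrableZl measurableT ((q1 - p1) * (q2 - p2)) igN).
- move=> t _; rewrite normrM !patchE mulrC; case: ifP => _.
    by rewrite ler_wpM2r.
  by rewrite normr0 !mulr0.
Qed.

Section weak_derivative_sections.
Context {R : realType} (N : nat) (i : 'I_N.+1).
Let leb : {sigma_finite_measure set (measurableTypeR R) -> \bar R} :=
  @lebesgue_measure R.
Variables u g : 'rV[R]_N.+1 -> R.
Hypotheses (mu : measurable_fun setT u) (mg : measurable_fun setT g).
Hypothesis iu : forall P Q : 'I_N.+1 -> R, 0 < P ord_max ->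
  (lebesgue_rV N.+1).-integrable (cbox P Q) (EFin \o u).
Hypothesis ig : forall P Q : 'I_N.+1 -> R, 0 < P ord_max ->
  (lebesgue_rV N.+1).-integrable (cbox P Q) (EFin \o g).
Hypothesis weak : forall phi, test_function phi ->
  (\int[lebesgue_rV N.+1]_(z in half_space N) (u z * partial i phi z) =
  - \int[lebesgue_rV N.+1]_(z in half_space N) (g z * phi z))%R.

Section fixed_box.
Variables (P Q : 'I_N.+1 -> R) (p1 q1 p2 q2 : R).
Hypotheses (pq1 : p1 <= q1) (pq2 : p2 <= q2).
Hypotheses (PQ : forall j, P j <= Q j) (P0 : 0 < P ord_max).
Hypotheses (Pp1 : P i <= p1) (Pp2 : P i <= p2) (qQ1 : q1 <= Q i) (qQ2 : q2 <= Q i).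

Let K := cbox P Q.
Let mK : measurable K := measurable_cbox P Q.

Let K_half : K `<=` half_space N.
Proof. by move=> z /(_ ord_max)/=; rewrite in_itv/= => /andP[+ _]; exact: lt_le_trans. Qed.

Lemma integrable_cbox_multiplier (D : set 'rV[R]_N.+1) (h : 'rV[R]_N.+1 -> R)
    (chi : 'rV[R]_N.+1 -> R) (C : R) :
  measurable D -> measurable_fun setT h ->
  (lebesgue_rV N.+1).-integrable K (EFin \o h) -> measurable_fun setT chi ->
  (forall z, `|chi z| <= C) -> (forall z, ~ K z -> chi z = 0) ->
  (lebesgue_rV N.+1).-integrable D (fun z => (h z * chi z)%:E).
Proof.
move=> mD mh hK mchi chiC chiK.
apply: (@integrable_multiplier _ _ _ _ D K h (fun=> chi) chi C) => //.
by move=> z; exact: cvg_cst.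
Qed.

Let pim t := pair_indic p1 q1 p2 q2 t.
Let pp t := pair_itv_primitive p1 q1 p2 q2 t.
Let C1 := (q2 - p2) + (q1 - p1).
Let C2 := (q1 - p1) * (q2 - p2).

Let pim_le t : `|pim t| <= C1.
Proof.
have c : `|pair_bump p1 q1 p2 q2 k t| @[k --> \oo] --> `|pim t|.
  by apply: cvg_norm; exact: cvg_pair_bump.
rewrite -(cvg_lim _ c)//; apply: limr_le; first by apply/cvg_ex; eexists; exact: c.
by apply: nearW => k; exact: pair_bump_le.
Qed.

Let mpim : measurable_fun setT pim.
Proof.
apply: (@measurable_fun_cvg _ _ _ setT
    (fun k => pair_bump p1 q1 p2 q2 k)) => [k|t _]; last exact: cvg_pair_bump.
have [d sd [_ <-]] := pair_smooth pq1 pq2 k.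
by apply: continuous_measurable_fun; exact: (smooth_seq_continuous sd).
Qed.

Let mpp : measurable_fun setT pp.
Proof.
apply: (@measurable_fun_cvg _ _ _ setT
    (fun k => pair_primitive p1 q1 p2 q2 k)) => [k|t _]; last exact: cvg_pair_primitive.
have [d sd [<- _]] := pair_smooth pq1 pq2 k.
by apply: continuous_measurable_fun; exact: (smooth_seq_continuous sd).
Qed.

Let fD (z : 'rV[R]_N.+1) : \bar R :=
  ((u z * (\1_K z * pim (z ord0 i)))%:E + (g z * (\1_K z * pp (z ord0 i)))%:E)%E.

Let mchi (f : R -> R) : measurable_fun setT f ->
  measurable_fun setT (fun z => \1_K z * f (z ord0 i)).
Proof.
move=> mf; apply: measurable_funM; first exact: measurable_indic.
exact: measurable_coord_comp.
Qed.

Let chi_le (f : R -> R) C z : (forall t, `|f t| <= C) ->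
  `|\1_K z * f (z ord0 i)| <= C.
Proof.
move=> fC; rewrite normrM -[leRHS]mul1r ler_pM// indicE.
by case: (z \in K); rewrite ?normr1 ?normr0.
Qed.

Let chi_out (f : R -> R) z : ~ K z -> \1_K z * f (z ord0 i) = 0.
Proof. by move=> Kz; rewrite indicE memNset// mul0r. Qed.

Let iuK (D : set 'rV[R]_N.+1) : measurable D ->
  (lebesgue_rV N.+1).-integrable D (fun z => (u z * (\1_K z * pim (z ord0 i)))%:E).
Proof.
move=> mD; apply: (@integrable_cbox_multiplier _ _ _ C1) => //; first exact: iu.
- exact: mchi.
- by move=> z; exact: chi_le.
- exact: chi_out.
Qed.

Let igK (D : set 'rV[R]_N.+1) : measurable D ->
  (lebesgue_rV N.+1).-integrable D (fun z => (g z * (\1_K z * pp (z ord0 i)))%:E).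
Proof.
move=> mD; apply: (@integrable_cbox_multiplier _ _ _ C2) => //; first exact: ig.
- exact: mchi.
- by move=> z; apply: chi_le => t; exact: pair_itv_primitive_le.
- exact: chi_out.
Qed.

Let ifD : (lebesgue_rV N.+1).-integrable setT fD.
Proof. by apply: integrableD => //; [exact: iuK|exact: igK]. Qed.

(** The defect of the one-dimensional identity on the line through x. Its integrals over open boxes
    vanish by the identity on boxes, hence it vanishes almost everywhere on [obox P Q]. *)
Let H (x : 'rV[R]_N) : \bar R := (\int[leb]_t fD (ins i (x, t)))%E.

Let iH : (lebesgue_rV N).-integrable setT H.
Proof. exact: (integrable_fubini_F (integrable_ins i ifD)). Qed.

Let obox (P Q : 'I_N.+1 -> R) : set 'rV[R]_N :=
  rV_box (fun j => `]P (lift i j), Q (lift i j)[%classic).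

Let mobox P' Q' : measurable (obox P' Q').
Proof. by apply: measurable_rV_box => j; exact: measurable_itv. Qed.

Let indic_box_ins P' Q' x t : indic_box i P' Q' (ins i (x, t)) = \1_(obox P' Q') x.
Proof.
rewrite /indic_box big_mkcond (bigD1_ord i)//= eqxx/= mul1r.
rewrite (eq_bigr (fun j => \1_(`]P' (lift i j), Q' (lift i j)[%classic) (x ord0 j) : R)); last first.
  by move=> j _; rewrite eq_sym neq_lift insE_lift.
rewrite indicE; have [xO|xO] := boolP (x \in obox P' Q').
  rewrite big1// => j _; rewrite indicE mem_set//.
  by move: xO; rewrite inE; exact.
move: xO; rewrite notin_setE => /existsNP[j xj].
by rewrite (bigD1 j)//= indicE memNset// mul0r.
Qed.

Let H_obox P' Q' : (forall j, P' j <= Q' j) -> (forall j, P j <= P' j) ->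
  P' i = P i -> Q' i = Q i ->
  (forall j t, j != i -> P' j < t < Q' j -> P j <= t <= Q j) ->
  (\int[lebesgue_rV N]_(x in obox P' Q') H x = 0)%E.
Proof.
move=> PQ' PP' Pi Qi sub.
have P0' : 0 < P' ord_max := lt_le_trans P0 (PP' _).
have key (f : R -> R) z : (forall t, ~~ (P i <= t <= Q i) -> f t = 0) ->
    indic_box i P' Q' z * (\1_K z * f (z ord0 i)) = indic_box i P' Q' z * f (z ord0 i).
  move=> f0; rewrite indicE; have [|] := boolP (z \in K); first by rewrite mul1r.
  rewrite notin_setE => /existsNP[j /=]; rewrite in_itv/= => /negP zj.
  rewrite mul0r mulr0; have [ji|ji] := eqVneq j i.
    by rewrite f0 ?mulr0// -ji.
  rewrite /indic_box (bigD1 j)//= indicE memNset ?mul0r//= in_itv/= => zj'.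
  by move/negP: zj; apply; exact: sub.
have pim0 : forall t, ~~ (P i <= t <= Q i) -> pim t = 0.
  by move=> t; exact: pair_indic_out.
have pp0 : forall t, ~~ (P i <= t <= Q i) -> pp t = 0.
  by move=> t; exact: pair_itv_primitive_out.
pose F1 z := (u z * (indic_box i P' Q' z * pim (z ord0 i)))%:E.
pose F2 z := (g z * (indic_box i P' Q' z * pp (z ord0 i)))%:E.
have mib : measurable_fun setT (indic_box i P' Q').
  rewrite /indic_box; under eq_fun do rewrite big_mkcond/=.
  apply: measurable_prod => j _; case: (j != i) => //.
  by apply: measurable_coord_comp; exact: measurable_indic.
have ib_le z : `|indic_box i P' Q' z| <= 1.
  rewrite /indic_box normr_prod; apply: prodr_ile1 => j _; rewrite indicE.
  by case: (_ \in _); rewrite ?normr1 ?normr0 ?ler01 ?lexx.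
have iF (h : 'rV[R]_N.+1 -> R) (f : R -> R) (C : R) D : measurable D ->
    measurable_fun setT h -> (lebesgue_rV N.+1).-integrable K (EFin \o h) ->
    measurable_fun setT f -> (forall t, `|f t| <= C) ->
    (forall t, ~~ (P i <= t <= Q i) -> f t = 0) ->
    (lebesgue_rV N.+1).-integrable D
      (fun z => (h z * (indic_box i P' Q' z * f (z ord0 i)))%:E).
  move=> mD mh hK mf fC f0; apply: (@integrable_cbox_multiplier _ _ _ C) => //.
  - by apply: measurable_funM => //; exact: measurable_coord_comp.
  - by move=> z; rewrite normrM -[leRHS]mul1r ler_pM.
  - by move=> z Kz; rewrite -key// chi_out// mulr0.
have iF1 D : measurable D -> (lebesgue_rV N.+1).-integrable D F1.
  by move=> mD; apply: (@iF u pim C1) => //; exact: iu.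
have iF2 D : measurable D -> (lebesgue_rV N.+1).-integrable D F2.
  move=> mD; apply: (@iF g pp C2) => //; first exact: ig.
  by move=> t; exact: pair_itv_primitive_le.
have toHalf (F : 'rV[R]_N.+1 -> \bar R) : (forall z, ~ K z -> F z = 0%E) ->
    (\int[lebesgue_rV N.+1]_z F z = \int[lebesgue_rV N.+1]_(z in half_space N) F z)%E.
  move=> F0; rewrite [RHS]integral_mkcond; apply: eq_integral => z _.
  rewrite patchE; case: ifPn => //; rewrite notin_setE => zh.
  by rewrite F0// => /K_half.
have -> : (\int[lebesgue_rV N]_(x in obox P' Q') H x =
    \int[lebesgue_rV N.+1]_z (F1 z + F2 z))%E.
  rewrite (integral_lebesgue_rV i); last by apply: integrableD => //; [exact: iF1|exact: iF2].
  rewrite integral_mkcond; apply: eq_integral => x _; rewrite patchE.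
  case: ifPn => xO.
    apply: eq_integral => t _; rewrite /fD /F1 /F2.
    by rewrite -!key// !indic_box_ins [\1_(obox _ _) _]indicE xO !mul1r.
  rewrite integral0_eq// => t _; rewrite /F1 /F2 indic_box_ins indicE (negPf xO).
  by rewrite !mul0r !mulr0 adde0.
rewrite integralD//; [|exact: iF1|exact: iF2].
rewrite toHalf; last first.
  by move=> z Kz; rewrite /F1 -key// chi_out// mulr0 mulr0.
rewrite [X in (_ + X)%E]toHalf; last first.
  by move=> z Kz; rewrite /F2 -key// chi_out// mulr0 mulr0.
have mh := @measurable_half_space R N.
rewrite -[X in (X + _)%E]fineK; last by apply: integrable_fin_num => //; exact: iF1.
rewrite -[X in (_ + X)%E]fineK; last by apply: integrable_fin_num => //; exact: iF2.
have := weak_derivative_box mu mg iu ig weak pq1 pq2 PQ' P0'.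
rewrite Pi Qi => /(_ Pp1 Pp2 qQ1 qQ2).
by rewrite /Rintegral => ->; rewrite EFinN -EFinD addNr.
Qed.

Let ae_H0 : {ae lebesgue_rV N, forall x, obox P Q x -> H x = 0}%E.
Proof.
apply: (ae_eq0_generators (@measurable_rays R N) (@rays_setI_closed R N)) => //.
- exact: integrableS iH.
- by apply: H_obox => // j t _ /andP[/ltW -> /ltW ->].
move=> _ [r ->].
(* The ray raises the lower ends of all sides but the i-th. The upper ends are raised along where
   needed, so that an empty intersection becomes a degenerate box with P' <= Q'. *)
pose P' j := if unlift i j is Some k then Num.max (P j) (r k) else P j.
pose Q' j := Num.max (P' j) (Q j).
have inP'Q' j t : P' j < t < Q' j = (P' j < t < Q j).
  rewrite /Q' lt_max; apply/idP/idP => /andP[h1 h2]; rewrite h1 ?h2 ?orbT//=.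
  by case/orP: h2 => // h2; have := lt_trans h1 h2; rewrite ltxx.
have PP' j : P j <= P' j.
  by rewrite /P'; case: unlift => [k|]//; rewrite le_max lexx.
have -> : obox P Q `&` rV_box (fun j => `]r j, +oo[%classic) = obox P' Q'.
  apply/seteqP; split => x /=.
    move=> [Ox rx] j; have := Ox j; have := rx j.
    by rewrite /= !in_itv/= andbT inP'Q' /P' liftK gt_max => -> /andP[-> ->].
  move=> Ox; split => j; have := Ox j; rewrite /= !in_itv/= ?andbT inP'Q' /P' liftK.
    by rewrite gt_max => /andP[/andP[-> _] ->].
  by rewrite gt_max => /andP[/andP[_ ->] _].
have P'i : P' i = P i by rewrite /P' unlift_none.
apply: H_obox => //.
- by move=> j; rewrite le_max lexx.
- by rewrite /Q' P'i max_r.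
- move=> j t _; rewrite inP'Q' => /andP[h1 /ltW ->].
  by rewrite (le_trans (PP' j) (ltW h1)).
Qed.

Let K_ins x t : obox P Q x -> (ins i (x, t) \in K) = (t \in `[P i, Q i]%classic).
Proof.
move=> Ox; apply/idP/idP; rewrite !inE/=.
  by move=> /(_ i); rewrite insE_at.
move=> tPQ j; case: (unliftP i j) => [k ->|->]; last by rewrite insE_at.
rewrite insE_lift; have := Ox k; rewrite /= !in_itv/= => /andP[h1 h2].
by rewrite !ltW.
Qed.

Lemma ae_pair_mean_ineq : {ae lebesgue_rV N, forall x : 'rV[R]_N,
  (forall j, P (lift i j) < x ord0 j < Q (lift i j)) ->
  [/\ leb.-integrable `[P i, Q i] (fun t => (u (ins i (x, t)))%:E),
     leb.-integrable `[P i, Q i] (fun t => (g (ins i (x, t)))%:E) &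
  `|(q2 - p2) * (\int[leb]_(t in `]p1, q1[) u (ins i (x, t)))%R -
    (q1 - p1) * (\int[leb]_(t in `]p2, q2[) u (ins i (x, t)))%R| <=
  (q1 - p1) * (q2 - p2) * (\int[leb]_(t in `[P i, Q i]) `|g (ins i (x, t))|)%R]}.
Proof.
have sec (h : 'rV[R]_N.+1 -> R) : (lebesgue_rV N.+1).-integrable K (EFin \o h) ->
    {ae lebesgue_rV N, forall x, obox P Q x ->
      leb.-integrable `[P i, Q i] (fun t => (h (ins i (x, t)))%:E)}.
  move=> hK; have hK' : (lebesgue_rV N.+1).-integrable setT ((EFin \o h) \_ K).
    exact/(integrable_mkcond _ _).1.
  have := ae_integrable1 (integrable_ins i hK').
  apply: filterS => x ix Ox; apply/(integrable_mkcond _ _).2 => //.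
  apply: eq_integrable ix => // t _; rewrite /= !patchE.
  by rewrite K_ins.
have := sec u (iu Q P0); have := sec g (ig Q P0); have := ae_H0.
apply: filterS3 => x Hx gx ux Ox'.
have Ox : obox P Q x by move=> j /=; rewrite in_itv/=.
split; [exact: ux|exact: gx|].
apply: pair_mean_ineq => //; [exact: ux|exact: gx|].
rewrite -(Hx Ox); apply: eq_integral => t _; rewrite /fD insE_at.
by rewrite !indicE K_ins.
Qed.

End fixed_box.
End weak_derivative_sections.

Section grid.
Context {R : realType}.
Local Notation leb := (@lebesgue_measure R).

(** The null set of exceptional lines depends on the intervals compared, so the endpoints are taken
    from a countable set. *)
Definition grid (n : nat) (z : int) : R := z%:~R / n.+1%:R.

(** Three grid steps, the middle one holding x: this keeps x in the interior and the endpoints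
    within 2 / (n + 1) of it. *)
Definition grid_itv (x : R) (n : nat) : set R :=
  `]grid n (Num.floor (x * n.+1%:R) - 1), grid n (Num.floor (x * n.+1%:R) + 2)[%classic.

Lemma grid_floor (x : R) n :
  grid n (Num.floor (x * n.+1%:R)) <= x < grid n (Num.floor (x * n.+1%:R)) + n.+1%:R^-1.
Proof.
have n0 : 0 < n.+1%:R :> R by rewrite ltr0n.
apply/andP; split; first by rewrite /grid ler_pdivrMr// Num.Theory.floor_le.
rewrite /grid -[X in _ + X]div1r -mulrDl ltr_pdivlMr//.
by have := Num.Theory.floorD1_gt (x * n.+1%:R); rewrite intrD.
Qed.

Lemma gridB1 n z : grid n (z - 1) = grid n z - n.+1%:R^-1.
Proof. by rewrite /grid intrD mulrDl mulrN1z mulN1r. Qed.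

Lemma gridD2 n z : grid n (z + 2) = grid n z + 2 * n.+1%:R^-1.
Proof. by rewrite /grid intrD mulrDl. Qed.

Lemma grid_itv_bounds (x : R) n :
  x - 2 * n.+1%:R^-1 <= grid n (Num.floor (x * n.+1%:R) - 1) /\
  grid n (Num.floor (x * n.+1%:R) + 2) <= x + 2 * n.+1%:R^-1.
Proof.
have := grid_floor x n; rewrite gridB1 gridD2.
by move: (n.+1%:R^-1) => e /andP[h1 h2]; split; lra.
Qed.

Lemma grid_itv_mem (x : R) n :
  grid n (Num.floor (x * n.+1%:R) - 1) < x < grid n (Num.floor (x * n.+1%:R) + 2).
Proof.
have n0 : 0 < n.+1%:R^-1 :> R by rewrite invr_gt0 ltr0n.
have := grid_floor x n; rewrite gridB1 gridD2; move: n0.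
by move: (n.+1%:R^-1) => e e0 /andP[h1 h2]; apply/andP; split; lra.
Qed.

Lemma grid_itv_length (x : R) n :
  grid n (Num.floor (x * n.+1%:R) + 2) - grid n (Num.floor (x * n.+1%:R) - 1) =
  3 * n.+1%:R^-1.
Proof. by rewrite gridB1 gridD2; move: (n.+1%:R^-1) => e; lra. Qed.

Lemma lebesgue_grid_itv (x : R) n : leb (grid_itv x n) = (3 * n.+1%:R^-1)%:E.
Proof.
have /andP[h1 h2] := grid_itv_mem x n.
rewrite [LHS](lebesgue_measure_itv `]_, _[)/= lte_fin (lt_trans h1 h2).
by rewrite -EFinB grid_itv_length.
Qed.

Lemma grid_itv_nicely_shrinking (x : R) : nicely_shrinking x (grid_itv x).
Proof.
have r0 n : 0 < 2 * n.+1%:R^-1 :> R by rewrite mulr_gt0 ?invr_gt0 ?ltr0n.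
split; first by move=> n; exact: measurable_itv.
(* The ball of radius 2 / (n + 1) has measure 4 / (n + 1), at most twice the length 3 / (n + 1) of
   the interval. *)
exists (2, fun n => PosNum (r0 n)); split => //=.
- rewrite -(mulr0 2); apply: cvgMr => //; exact: cvg_harmonic.
- move=> n y; rewrite /grid_itv/= in_itv/= => /andP[h1 h2].
  have [h3 h4] := grid_itv_bounds x n.
  rewrite /ball/= ltr_norml; move: h1 h2 h3 h4; move: (n.+1%:R^-1) => e *.
  by apply/andP; split; lra.
- move=> n; rewrite lebesgue_grid_itv lebesgue_measure_ball; last exact: ltW.
  rewrite -EFinM lee_fin -mulr_natr.
  by have := r0 n; move: (n.+1%:R^-1) => e; lra.
Qed.

End grid.

Section absolute_continuity.
Context {R : realType}.
Local Notation leb := (@lebesgue_measure R).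

(* The only trace of "v is absolutely continuous on J with derivative g" that
   is needed: the modulus of continuity given by Cauchy-Schwarz, off a null
   set. *)
Definition half_holder (J : set R) (v g : R -> R) :=
  exists2 E : set R, leb.-negligible E & forall p q s t : R,
    `[p, q] `<=` J -> p < s < q -> p < t < q -> ~ E s -> ~ E t ->
    (((v s - v t) ^+ 2)%:E <= (q - p)%:E * \int[leb]_(x in `]p, q[) (g x ^+ 2)%:E)%E.

(** At Lebesgue points the means over grid intervals shrinking to s and to t converge to v(s) and
    v(t), so the comparison of means becomes |v(s) - v(t)| <= int |g|; Cauchy-Schwarz does the
    rest. *)
Lemma half_holder_of_means (J : set R) (v g : R -> R) :
  measurable_fun setT g ->
  (forall m z w n z1 z2, let a := grid m z in let b := grid m w in
    let p1 := grid n z1 in let q1 := grid n (z1 + 3) in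
    let p2 := grid n z2 in let q2 := grid n (z2 + 3) in
    `[a, b] `<=` J -> a <= p1 -> a <= p2 -> q1 <= b -> q2 <= b ->
    [/\ leb.-integrable `[a, b] (EFin \o v),
        leb.-integrable `[a, b] (EFin \o g) &
     `|(q2 - p2) * (\int[leb]_(t in `]p1, q1[) v t)%R -
       (q1 - p1) * (\int[leb]_(t in `]p2, q2[) v t)%R| <=
     (q1 - p1) * (q2 - p2) * (\int[leb]_(t in `[a, b]) `|g t|)%R]) ->
  half_holder J v g.
Proof.
move=> mg H.
(* Truncation to a grid interval where v is integrable makes it locally integrable on the whole
   line, as Lebesgue's differentiation theorem asks. These intervals are countably many, so the bad
   points form one null set. *)
pose V m z w := v \_ `[grid m z, grid m w].
exists [set s | exists m z w, leb.-integrable `[grid m z, grid m w] (EFin \o v) /\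
   ~ lebesgue_pt (V m z w) s].
  pose A (k : nat) : set R := match unpickle k with
    | Some (m, z, w) => [set s | leb.-integrable `[grid m z, grid m w] (EFin \o v) /\
        ~ lebesgue_pt (V m z w) s]
    | None => set0 end.
  suff : leb.-negligible (\bigcup_k A k).
    apply: negligibleS; move=> s /= [m [z [w P]]]; exists (pickle (m, z, w)) => //.
    by rewrite /A pickleK.
  apply: negligible_bigcup => k; rewrite /A.
  case: unpickle => [[[m z] w]|]; last exact: negligible_set0.
  have [iv|niv] := pselect (leb.-integrable `[grid m z, grid m w] (EFin \o v)); last first.
    rewrite (_ : [set s | _] = set0); first exact: negligible_set0.
    by apply/seteqP; split => // s [].
  have lV : locally_integrable setT (V m z w).
    apply: open_integrable_locally; first exact: openT.
    by rewrite -restrict_EFin; apply/(integrable_mkcond _ _).1.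
  have := lebesgue_differentiation lV.
  by apply: negligibleS => s [].
move=> p q s t pqJ psq ptq Es Et.
have /andP[ps sq] := psq; have /andP[pt tq] := ptq.
have room (x y : R) : x < y -> \forall n \near \oo, x + 2 * n.+1%:R^-1 < y.
  move=> xy; have yx0 : 0 < (y - x) / 2 by rewrite divr_gt0 ?subr_gt0.
  have := @near_infty_natSinv_lt _ (PosNum yx0).
  by apply: filterS => n /=; move: (n.+1%:R^-1) => e; lra.
(* The mesh is fine enough for grid points a and b to fit between p and both points, and between
   both points and q. *)
have [m Hm] : exists m, [/\ p + 2 * m.+1%:R^-1 < s, p + 2 * m.+1%:R^-1 < t,
     s + 2 * m.+1%:R^-1 < q & t + 2 * m.+1%:R^-1 < q].
  near \oo => m; exists m; split; near: m; exact: room.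
pose mn := Num.min s t; pose mx := Num.max s t.
pose z := (Num.floor (mn * m.+1%:R) - 1)%R.
pose w := (Num.floor (mx * m.+1%:R) + 2)%R.
pose a : R := grid m z; pose b : R := grid m w.
have pa : p < a.
  have [h _] := grid_itv_bounds mn m; rewrite /a /z (lt_le_trans _ h)// ltrBrDr.
  by case: Hm => h1 h2 _ _; rewrite lt_min h1.
have bq : b < q.
  have [_ h] := grid_itv_bounds mx m; rewrite /b /w (le_lt_trans h)//.
  by rewrite -ltrBrDr gt_max !ltrBrDr; case: Hm => _ _ -> ->.
have /andP[amn _] := grid_itv_mem mn m; have /andP[_ mxb] := grid_itv_mem mx m.
have as_ : a < s by rewrite (lt_le_trans amn)// ge_min lexx.
have at_ : a < t by rewrite (lt_le_trans amn)// ge_min lexx orbT.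
have sb : s < b by rewrite (le_lt_trans _ mxb)// le_max lexx.
have tb : t < b by rewrite (le_lt_trans _ mxb)// le_max lexx orbT.
have abJ : `[a, b] `<=` J.
  by apply: subset_trans pqJ; apply: subset_itv; rewrite bnd_simp ltW.
have near_in (x : R) : a < x -> x < b -> \forall n \near \oo,
    a <= grid n (Num.floor (x * n.+1%:R) - 1) /\
    grid n (Num.floor (x * n.+1%:R) + 2) <= b.
  move=> ax xb; have := room _ _ ax; have := room _ _ xb.
  apply: filterS2 => n h1 h2; have [h3 h4] := grid_itv_bounds x n.
  by move: h1 h2 h3 h4; move: (n.+1%:R^-1) => e *; split; lra.
have key := near_in s as_ sb; have key' := near_in t at_ tb.
pose I := (\int[leb]_(x in `[a, b]) `|g x|)%R.
have z3 (y : int) : y + 2 = (y - 1) + 3 by rewrite -addrA.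
have [iv ig] : leb.-integrable `[a, b] (EFin \o v) /\
    leb.-integrable `[a, b] (EFin \o g).
  near \oo => n; have [h1 h2] : a <= grid n (Num.floor (s * n.+1%:R) - 1) /\
    grid n (Num.floor (s * n.+1%:R) + 2) <= b by near: n.
  rewrite z3 in h2.
  by have [] := H m z w n _ _ abJ h1 h1 h2 h2.
have lV : locally_integrable setT (V m z w).
  apply: open_integrable_locally; first exact: openT.
  by rewrite -restrict_EFin; apply/(integrable_mkcond _ _).1.
pose A x n : R := (3 * n.+1%:R^-1)^-1 * (\int[leb]_(y in grid_itv x n) v y)%R.
have cA x : a < x -> x < b -> lebesgue_pt (V m z w) x -> A x n @[n --> \oo] --> v x.
  move=> ax xb px.
  have vx : V m z w x = v x.
    by rewrite /V patchE mem_set//= in_itv/= -/a -/b !ltW.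
  have := nice_lebesgue_differentiation grid_itv_nicely_shrinking lV px.
  rewrite vx => /fine_cvg; apply: cvg_trans; apply: near_eq_cvg.
  have := near_in x ax xb; apply: filterS => n [h1 h2].
  have sub : grid_itv x n `<=` `[a, b].
    by apply: subset_itv; rewrite bnd_simp.
  have fE : (\int[leb]_(y in grid_itv x n) (V m z w y)%:E =
             \int[leb]_(y in grid_itv x n) (v y)%:E)%E.
    apply: eq_integral => y; rewrite inE => /sub yab.
    by rewrite /V patchE mem_set.
  have fin : (\int[leb]_(y in grid_itv x n) (v y)%:E)%E \is a fin_num.
    apply: integrable_fin_num; first exact: measurable_itv.
    by apply: integrableS iv => //; exact: measurable_itv.
  have l0 : 3 * n.+1%:R^-1 != 0 :> R.
    by rewrite mulf_neq0// invr_neq0// pnatr_eq0.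
  rewrite /A /= fE lebesgue_grid_itv inver (negPf l0) fineM//.
have pts x : ~ [set s | exists m z w,
    leb.-integrable `[grid m z, grid m w] (EFin \o v) /\
    ~ lebesgue_pt (V m z w) s] x -> lebesgue_pt (V m z w) x.
  by move=> nx; apply: contrapT => px; apply: nx; exists m, z, w.
have cs := cA s as_ sb (pts s Es); have ct := cA t at_ tb (pts t Et).
have L : `|v s - v t| <= I.
  have c : `|A s n - A t n| @[n --> \oo] --> `|v s - v t|.
    by apply: cvg_norm; exact: cvgB.
  rewrite -(cvg_lim _ c)//; apply: limr_le; first by apply/cvg_ex; eexists; exact: c.
  near=> n.
  have [h1 h2] : a <= grid n (Num.floor (s * n.+1%:R) - 1) /\
    grid n (Num.floor (s * n.+1%:R) + 2) <= b by near: n.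
  have [h3 h4] : a <= grid n (Num.floor (t * n.+1%:R) - 1) /\
    grid n (Num.floor (t * n.+1%:R) + 2) <= b by near: n.
  have ls := grid_itv_length s n; have lt := grid_itv_length t n.
  rewrite z3 in h2; rewrite z3 in h4.
  have [_ _] := H m z w n _ _ abJ h1 h3 h2 h4.
  rewrite -!z3 ls lt -/(grid_itv s n) -/(grid_itv t n) -/I /A.
  have l0 : 0 < 3 * n.+1%:R^-1 :> R by rewrite mulr_gt0// invr_gt0 ltr0n.
  move: l0; move: (3 * n.+1%:R^-1) => l l0.
  rewrite -!mulrBr !normrM (gtr0_norm l0) normfV (gtr0_norm l0).
  by rewrite -[l * l * I]mulrA (ler_pM2l l0) ler_pdivrMl.
apply: (@le_trans _ _ (I ^+ 2)%:E).
  have I0 : 0 <= I := le_trans (normr_ge0 _) L.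
  by rewrite lee_fin -(@real_normK _ (v s - v t)) ?num_real// ler_pXn2r ?nnegrE.
(* Cauchy-Schwarz with weight 1 bounds I^2 by (b - a) times the integral of g^2 over [a, b], and
   [a, b] lies in ]p, q[. *)
have := @sqr_fine_integral_le _ _ _ leb `[a, b]%classic (Num.norm \o g) (cst 1)
  (measurable_itv _) (measurableT_comp (@normr_measurable R setT) mg)
  (measurable_cst _) (fun=> ler01).
rewrite (_ : fine _ = I); last first.
  by rewrite /I /Rintegral; congr fine; apply: eq_integral => x _; rewrite mulr1.
move=> /le_trans; apply.
rewrite [X in (X * _)%E](_ : _ = leb `[a, b]%classic); last first.
  by rewrite -[RHS]mul1e -integral_cst.
rewrite [X in (X * _)%E](lebesgue_measure_itv `[a, b])/= lte_fin (lt_trans as_ sb).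
apply: lee_pmul => //.
- by rewrite -EFinB lee_fin subr_ge0 ltW// (lt_trans as_ sb).
- by apply: integral_ge0 => x _; rewrite lee_fin mulr1 sqr_ge0.
- by rewrite -EFinB lee_fin lerB// ltW.
under eq_integral do rewrite /= mulr1 real_normK ?num_real//.
apply: ge0_subset_integral => //.
- by apply/measurable_EFinP; apply: measurable_funTS; exact: measurable_funX.
- by move=> x _; rewrite lee_fin sqr_ge0.
- by apply: subset_itv; rewrite bnd_simp.
Unshelve. all: by end_near.
Qed.

End absolute_continuity.

Section half_holder_sections.
Context {R : realType} (N : nat) (i : 'I_N.+1).
Let leb : {sigma_finite_measure set (measurableTypeR R) -> \bar R} :=
  @lebesgue_measure R.
Variables u g : 'rV[R]_N.+1 -> R.
Hypotheses (mu : measurable_fun setT u) (mg : measurable_fun setT g).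
Hypothesis iu : forall P Q : 'I_N.+1 -> R, 0 < P ord_max ->
  (lebesgue_rV N.+1).-integrable (cbox P Q) (EFin \o u).
Hypothesis ig : forall P Q : 'I_N.+1 -> R, 0 < P ord_max ->
  (lebesgue_rV N.+1).-integrable (cbox P Q) (EFin \o g).
Hypothesis weak : forall phi, test_function phi ->
  (\int[lebesgue_rV N.+1]_(z in half_space N) (u z * partial i phi z) =
  - \int[lebesgue_rV N.+1]_(z in half_space N) (g z * phi z))%R.

Lemma ae_section_means (a b p1 q1 p2 q2 : R) :
  p1 <= q1 -> p2 <= q2 -> a <= p1 -> a <= p2 -> q1 <= b -> q2 <= b ->
  {ae lebesgue_rV N, forall x : 'rV[R]_N, half_space N (ins i (x, a)) ->
  [/\ leb.-integrable `[a, b] (fun t => (u (ins i (x, t)))%:E),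
     leb.-integrable `[a, b] (fun t => (g (ins i (x, t)))%:E) &
  `|(q2 - p2) * (\int[leb]_(t in `]p1, q1[) u (ins i (x, t)))%R -
    (q1 - p1) * (\int[leb]_(t in `]p2, q2[) u (ins i (x, t)))%R| <=
  (q1 - p1) * (q2 - p2) * (\int[leb]_(t in `[a, b]) `|g (ins i (x, t))|)%R]}.
Proof.
move=> pq1 pq2 ap1 ap2 qb1 qb2.
(* In the normal direction a <= 0 contradicts the condition on x. In all other cases boxes with side
   [a, b] along i can be kept inside the half-space. *)
have [amax|amax] := boolP ((i == ord_max) && (a <= 0)).
  apply: nearW => x; rewrite /half_space/= => h.
  by case/andP: amax h => /eqP <-; rewrite insE_at leNgt => /negP.
(* As n grows the other sides exhaust the line, or the open half-line in the normal direction. *)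
pose P (n : nat) j : R := if j == i then a else
  if j == ord_max then n.+1%:R^-1 else - n.+1%:R.
pose Q (n : nat) j : R := if j == i then b else n.+1%:R.
have PQ n j : P n j <= Q n j.
  rewrite /P /Q; case: (j == i); first exact: le_trans ap1 (le_trans pq1 qb1).
  case: (j == ord_max); last by rewrite (@le_trans _ _ 0)// oppr_le0.
  by rewrite (@le_trans _ _ 1)// ?invf_le1 ?ler1n// ltr0n.
have P0 n : 0 < P n ord_max.
  rewrite /P eqxx; case: (ord_max =P i) => [im|_]; last by rewrite invr_gt0 ltr0n.
  by move: amax; rewrite -im eqxx/= -ltNge.
have Pi n : P n i = a by rewrite /P eqxx.
have Qi n : Q n i = b by rewrite /Q eqxx.
have H n : {ae lebesgue_rV N, forall x : 'rV[R]_N,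
    (forall j, P n (lift i j) < x ord0 j < Q n (lift i j)) ->
  [/\ leb.-integrable `[a, b] (fun t => (u (ins i (x, t)))%:E),
     leb.-integrable `[a, b] (fun t => (g (ins i (x, t)))%:E) &
  `|(q2 - p2) * (\int[leb]_(t in `]p1, q1[) u (ins i (x, t)))%R -
    (q1 - p1) * (\int[leb]_(t in `]p2, q2[) u (ins i (x, t)))%R| <=
  (q1 - p1) * (q2 - p2) * (\int[leb]_(t in `[a, b]) `|g (ins i (x, t))|)%R]}.
  have := @ae_pair_mean_ineq R N i u g mu mg iu ig weak (P n) (Q n) p1 q1 p2 q2
    pq1 pq2 (PQ n) (P0 n).
  by rewrite Pi Qi; apply.
move/ae_foralln : H; apply: filterS => x Hx xa.
pose M := \sum_j `|x ord0 j|.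
have lxM j : `|x ord0 j| <= M by rewrite /M (bigD1 j)//= lerDl sumr_ge0.
(* The inverse of the normal coordinate of x when i is tangential: n + 1 above it puts that
   coordinate above 1 / (n + 1). *)
pose s := if unlift i ord_max is Some k then (x ord0 k)^-1 else 0.
pose n := Num.truncn (Num.max M s).
have [Mn sn] : M < n.+1%:R /\ s < n.+1%:R.
  by split; apply: le_lt_trans (truncnS_gt _); rewrite le_max lexx ?orbT.
apply: (Hx n) => j; rewrite /P /Q eq_sym (negPf (neq_lift _ _)).
have /andP[h1 h2] : - n.+1%:R < x ord0 j < n.+1%:R.
  by rewrite -ltr_norml (le_lt_trans (lxM j)).
rewrite h2 andbT; case: eqP => [jm|//].
move: sn; rewrite /s -jm liftK => sn.
have x0 : 0 < x ord0 j by move: xa; rewrite /half_space/= -jm insE_lift.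
by rewrite -ltf_pV2 ?posrE ?invr_gt0 ?ltr0n// invrK.
Qed.

Lemma ae_half_holder : {ae lebesgue_rV N, forall x : 'rV[R]_N,
  half_holder [set t | half_space N (ins i (x, t))]
    (fun t => u (ins i (x, t))) (fun t => g (ins i (x, t)))}.
Proof.
(* All grid data are coded by one integer k, so that a single null set of lines serves every grid
   interval. *)
pose A (k : nat) (x : 'rV[R]_N) : Prop :=
  if unpickle k is Some (m, z, w, n, z1, z2) then
    let a := @grid R m z in let b := @grid R m w in
    let p1 := @grid R n z1 in let q1 := @grid R n (z1 + 3) in
    let p2 := @grid R n z2 in let q2 := @grid R n (z2 + 3) in
    a <= p1 -> a <= p2 -> q1 <= b -> q2 <= b -> half_space N (ins i (x, a)) ->
  [/\ leb.-integrable `[a, b] (fun t => (u (ins i (x, t)))%:E),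
     leb.-integrable `[a, b] (fun t => (g (ins i (x, t)))%:E) &
  `|(q2 - p2) * (\int[leb]_(t in `]p1, q1[) u (ins i (x, t)))%R -
    (q1 - p1) * (\int[leb]_(t in `]p2, q2[) u (ins i (x, t)))%R| <=
  (q1 - p1) * (q2 - p2) * (\int[leb]_(t in `[a, b]) `|g (ins i (x, t))|)%R]
  else True.
have g3 n z : grid n z <= grid n (z + 3) :> R.
  by rewrite /grid ler_pM2r ?invr_gt0 ?ltr0n// ler_int lerDl.
have AE k : {ae lebesgue_rV N, forall x, A k x}.
  rewrite /A; case: unpickle => [[[[[[m z] w] n] z1] z2]|]; last exact: nearW.
  pose a := @grid R m z; pose b := @grid R m w.
  pose p1 := @grid R n z1; pose q1 := @grid R n (z1 + 3).
  pose p2 := @grid R n z2; pose q2 := @grid R n (z2 + 3).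
  have [/and4P[h1 h2 h3 h4]|] :=
      boolP [&& a <= p1, a <= p2, q1 <= b & q2 <= b].
    have := @ae_section_means a b p1 q1 p2 q2 (g3 _ _) (g3 _ _) h1 h2 h3 h4.
    by apply: filterS => x Hx _ _ _ _; exact: Hx.
  by move=> ne; apply: nearW => x h1 h2 h3 h4; case/negP: ne; apply/and4P.
move/ae_foralln : AE; apply: filterS => x Ax.
apply: half_holder_of_means.
  apply: measurableT_comp => //; apply: measurable_fun_rV => j.
  under eq_fun do rewrite mxE.
  by case: (unlift i j) => [k|] /=; [exact: measurable_cst|exact: measurable_id].
move=> m z w n z1 z2 a b p1 q1 p2 q2 abJ h1 h2 h3 h4.
have := Ax (pickle (m, z, w, n, z1, z2)); rewrite /A pickleK; apply => //.
apply: abJ; rewrite /= in_itv/= lexx/=.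
exact: le_trans h1 (le_trans (g3 _ _) h3).
Qed.

End half_holder_sections.

(** * Weighted estimates on a line *)

Section block_comparison.
Context {R : realType}.
Local Notation leb := (@lebesgue_measure R).
Variables (J : set R) (v g w : R -> R).
Hypotheses (mv : measurable_fun setT v) (mg : measurable_fun setT g)
  (mw : measurable_fun setT w) (w0 : forall t, 0 <= w t).
Hypothesis hh : half_holder J v g.

Local Open Scope ereal_scope.

Let mv2 (D : set R) : measurable_fun D (fun t => (v t ^+ 2 * w t)%:E).
Proof.
apply: measurable_funTS; apply/measurable_EFinP.
by apply: measurable_funM => //; exact: measurable_funX.
Qed.

Let mg2 (D : set R) : measurable_fun D (fun t => (g t ^+ 2 * w t)%:E).
Proof.
apply: measurable_funTS; apply/measurable_EFinP.
by apply: measurable_funM => //; exact: measurable_funX.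
Qed.

Let vw0 t : 0 <= (v t ^+ 2 * w t)%:E.
Proof. by rewrite lee_fin mulr_ge0 ?sqr_ge0. Qed.

Let gw0 t : 0 <= (g t ^+ 2 * w t)%:E.
Proof. by rewrite lee_fin mulr_ge0 ?sqr_ge0. Qed.

Lemma lebesgue_itvoo (l r : R) : (l < r)%R -> leb `]l, r[%classic = (r - l)%:E.
Proof. by move=> lr; rewrite [LHS](lebesgue_measure_itv `]l, r[)/= lte_fin lr. Qed.

Lemma ae_le_integral_itv (l r : R) (f : R -> \bar R) (C : \bar R) (E : set R) :
  (l < r)%R -> leb.-negligible E -> measurable_fun `]l, r[ f ->
  (forall t, 0 <= f t) -> 0 <= C ->
  (forall t, (l < t < r)%R -> ~ E t -> C <= f t) ->
  (r - l)%:E * C <= \int[leb]_(t in `]l, r[) f t.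
Proof.
move=> lr NE mf f0 C0 Cf.
rewrite -(lebesgue_itvoo lr) muleC -(integral_cst leb) //.
apply: ae_ge0_le_integral => //.
apply: negligibleS NE => t /= /not_implyP[].
rewrite in_itv/= => tlr nC; apply: contrapT => Et; apply: nC; exact: Cf.
Qed.

Lemma integral_itv_ae_le (l r : R) (f : R -> \bar R) (C : \bar R) (E : set R) :
  (l < r)%R -> leb.-negligible E -> measurable_fun `]l, r[ f ->
  (forall t, 0 <= f t) -> 0 <= C ->
  (forall t, (l < t < r)%R -> ~ E t -> f t <= C) ->
  \int[leb]_(t in `]l, r[) f t <= (r - l)%:E * C.
Proof.
move=> lr NE mf f0 C0 Cf.
rewrite -(lebesgue_itvoo lr) muleC -(integral_cst leb) //.
apply: ae_ge0_le_integral => //.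
apply: negligibleS NE => t /= /not_implyP[].
rewrite in_itv/= => tlr nC; apply: contrapT => Et; apply: nC; exact: Cf.
Qed.

(** For s and t in the two blocks, v(s)^2 <= 2 v(t)^2 + 2 (v(s) - v(t))^2 is multiplied by (r - l)
    w(s). Then [theta], a bound on the ratio of masses, moves the weight of the first term to t, and
    [kappa] absorbs the length of the hull while moving the weight under the integral of g^2.
    Averaging over t and then over s gives the claim. *)
Lemma block_le (l r l' r' p q theta kappa : R) :
  (l < r)%R -> (l' < r')%R -> (p <= l)%R -> (p <= l')%R -> (r <= q)%R -> (r' <= q)%R ->
  (0 <= theta)%R -> (0 <= kappa)%R ->
  `[p, q] `<=` J ->
  (forall s t, l < s < r -> l' < t < r' -> (r - l) * w s <= theta * (r' - l') * w t)%R ->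
  (forall s t, l < s < r -> p < t < q -> (q - p) * ((r - l) * w s) <= kappa * w t)%R ->
  \int[leb]_(t in `]l, r[) (v t ^+ 2 * w t)%:E <=
  (2 * theta)%:E * \int[leb]_(t in `]l', r'[) (v t ^+ 2 * w t)%:E +
  (2 * kappa)%:E * \int[leb]_(t in `]p, q[) (g t ^+ 2 * w t)%:E.
Proof.
move=> lr lr' pl pl' rq rq' th0 ka0 pqJ Hth Hka; have [E NE HE] := hh.
set X := \int[leb]_(t in `]l', r'[) _; set Y := \int[leb]_(t in `]p, q[) _.
have X0 : 0 <= X.
  by apply: integral_ge0 => t _; rewrite lee_fin mulr_ge0 ?sqr_ge0.
have Y0 : 0 <= Y.
  by apply: integral_ge0 => t _; rewrite lee_fin mulr_ge0 ?sqr_ge0.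
have rl0 : (0 < r - l)%R by rewrite subr_gt0.
have rl0' : (0 < r' - l')%R by rewrite subr_gt0.
have pq : (p < q)%R := le_lt_trans pl (lt_le_trans lr rq).
have qp0 : (0 <= q - p)%R by rewrite subr_ge0 ltW.
have key s t : (l < s < r)%R -> (l' < t < r')%R -> ~ E s -> ~ E t ->
    ((r - l) * w s * v s ^+ 2)%:E <=
    (2 * theta * (r' - l') * (v t ^+ 2 * w t))%:E + (2 * kappa)%:E * Y.
  move=> sI tI Es Et; pose c : R := ((r - l) * w s)%R.
  have c0 : (0 <= c)%R by rewrite mulr_ge0// ltW.
  have psq : (p < s < q)%R.
    by case/andP: sI => h1 h2; rewrite (le_lt_trans pl h1) (lt_le_trans h2 rq).
  have ptq : (p < t < q)%R.
    by case/andP: tI => h1 h2; rewrite (le_lt_trans pl' h1) (lt_le_trans h2 rq').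
  have h := HE p q s t pqJ psq ptq Es Et.
  have cY : c%:E * ((q - p)%:E * \int[leb]_(x in `]p, q[) (g x ^+ 2)%:E) <= kappa%:E * Y.
    rewrite muleA -EFinM -ge0_integralZl//; last 3 first.
    - by apply/measurable_EFinP; apply: measurable_funTS; exact: measurable_funX.
    - by move=> x _; rewrite lee_fin sqr_ge0.
    - by rewrite lee_fin mulr_ge0.
    rewrite /Y -ge0_integralZl//; last exact: mg2.
    apply: ge0_le_integral => //.
    - by move=> x _; rewrite -EFinM lee_fin mulr_ge0 ?sqr_ge0// mulr_ge0.
    - apply: emeasurable_funM => //; apply/measurable_EFinP; apply: measurable_funTS.
      exact: measurable_funX.
    - by apply: emeasurable_funM => //; exact: mg2.
    - move=> x; rewrite /= in_itv/= => xpq; rewrite -!EFinM lee_fin.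
      have := Hka s x sI xpq; rewrite -/c => hx.
      by rewrite [leRHS]mulrCA [X in (X <= _)%R]mulrC ler_wpM2l ?sqr_ge0// mulrC.
  have ct : (c * v t ^+ 2 <= theta * (r' - l') * (v t ^+ 2 * w t))%R.
    have := Hth s t sI tI; rewrite -/c => hx.
    by rewrite [leRHS]mulrCA [leLHS]mulrC ler_wpM2l ?sqr_ge0.
  (* The gap in v(s)^2 <= 2 v(t)^2 + 2 (v(s) - v(t))^2 is the square (v(s) - 2 v(t))^2. *)
  apply: (@le_trans _ _ ((2 * (c * v t ^+ 2))%:E + 2%:E * (c%:E * ((v s - v t) ^+ 2)%:E))).
    rewrite -!EFinM -EFinD lee_fin -/c.
    have : (0 <= c * (v s - v t - v t) ^+ 2)%R by rewrite mulr_ge0 ?sqr_ge0.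
    nra.
  apply: leeD; first by rewrite lee_fin; move: ct; clearbody c; lra.
  rewrite [(2 * kappa)%:E]EFinM -muleA; apply: lee_wpmul2l; first by rewrite lee_fin.
  apply: le_trans cY; apply: lee_wpmul2l => //; by rewrite lee_fin.
(* Average over t in ]l', r'[ ; the common factor r' - l' cancels. *)
have key2 s : (l < s < r)%R -> ~ E s ->
    ((r - l) * w s * v s ^+ 2)%:E <= (2 * theta)%:E * X + (2 * kappa)%:E * Y.
  move=> sI Es.
  have th2 : (0 <= 2 * theta * (r' - l'))%R by rewrite !mulr_ge0// ltW.
  have ka2 : 0 <= (2 * kappa)%:E * Y by rewrite mule_ge0// lee_fin mulr_ge0.
  have mF : measurable_fun `]l', r'[
     (fun t => (2 * theta * (r' - l'))%:E * (v t ^+ 2 * w t)%:E).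
    by apply: emeasurable_funM => //; exact: mv2.
  have vF0 t : 0 <= (2 * theta * (r' - l'))%:E * (v t ^+ 2 * w t)%:E.
    by apply: mule_ge0; [rewrite lee_fin|exact: vw0].
  have : (r' - l')%:E * ((r - l) * w s * v s ^+ 2)%:E <=
      \int[leb]_(t in `]l', r'[)
        ((2 * theta * (r' - l'))%:E * (v t ^+ 2 * w t)%:E + (2 * kappa)%:E * Y).
    apply: (ae_le_integral_itv lr' NE).
    - by apply: emeasurable_funD; [exact: mF|exact: measurable_cst].
    - by move=> t; exact: adde_ge0.
    - by rewrite lee_fin mulr_ge0 ?sqr_ge0// mulr_ge0// ltW.
    - by move=> t tI Et; rewrite -EFinM; exact: key.
  rewrite ge0_integralD//.
  rewrite ge0_integralZl//; last exact: mv2.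
  rewrite -/X integral_cst//= [X in _ + _ * X](lebesgue_itvoo lr').
  rewrite [(2 * theta * _)%:E]EFinM [(2 * theta)%:E * _]muleC -muleA.
  rewrite [X in _ <= _ + X]muleC -ge0_muleDr//; last first.
    by rewrite mule_ge0// lee_fin mulr_ge0.
  by rewrite lee_pmul2l.
have XY0 : 0 <= (2 * theta)%:E * X + (2 * kappa)%:E * Y.
  by rewrite adde_ge0// mule_ge0// lee_fin mulr_ge0.
have : \int[leb]_(t in `]l, r[) ((r - l)%:E * (v t ^+ 2 * w t)%:E) <=
    (r - l)%:E * ((2 * theta)%:E * X + (2 * kappa)%:E * Y).
  apply: (integral_itv_ae_le lr NE) => //.
  - by apply: emeasurable_funM => //; exact: mv2.
  - by move=> t; rewrite mule_ge0// lee_fin ltW.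
  - move=> t tI Et; apply: le_trans (key2 t tI Et).
    by rewrite -EFinM lee_fin [in leLHS]mulrA mulrAC.
rewrite ge0_integralZl//; last 2 first.
- exact: mv2.
- by rewrite lee_fin ltW.
by rewrite lee_pmul2l.
Qed.

(* The blocks I_n exhaust the tail S, I'_n are the disjoint blocks they are
   compared with, and the hulls ]p_n, q_n[ overlap at most K + 1 times. *)
Lemma tail_le (l r l' r' p q : nat -> R) (theta kappa : R) (K : nat) (S : set R) :
  (forall n, [/\ l n < r n, l' n < r' n, p n <= l n & p n <= l' n])%R ->
  (forall n, r n <= q n /\ r' n <= q n)%R ->
  (0 <= theta)%R -> (0 <= kappa)%R ->
  (forall n, `[p n, q n] `<=` J) ->
  (forall n s t, l n < s < r n -> l' n < t < r' n ->
    (r n - l n) * w s <= theta * (r' n - l' n) * w t)%R ->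
  (forall n s t, l n < s < r n -> p n < t < q n ->
    (q n - p n) * ((r n - l n) * w s) <= kappa * w t)%R ->
  (forall n k, (n < k)%N -> `]l' n, r' n[%classic `&` `]l' k, r' k[%classic = set0) ->
  (forall n k, (n + K < k)%N -> `]p n, q n[%classic `&` `]p k, q k[%classic = set0) ->
  measurable S -> S `<=` \bigcup_n `[l n, r n]%classic ->
  \int[leb]_(t in S) (v t ^+ 2 * w t)%:E <=
  (2 * theta)%:E * \int[leb]_t (v t ^+ 2 * w t)%:E +
  (2 * kappa * K.+1%:R)%:E * \int[leb]_t (g t ^+ 2 * w t)%:E.
Proof.
move=> Hlr Hq th0 ka0 HJ Hth Hka D1 DK mS SI.
apply: (@le_trans _ _ (\sum_(n <oo) \int[leb]_(t in `]l n, r n[) (v t ^+ 2 * w t)%:E)).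
  (* The closed blocks cover S, the open ones may miss endpoints; the integrals agree. *)
  have E n : \int[leb]_(t in `]l n, r n[) (v t ^+ 2 * w t)%:E =
      \int[leb]_(t in `[l n, r n]) (v t ^+ 2 * w t)%:E.
    by apply/esym; apply: (integral_itv_bndoo true false); exact: mv2.
  under eq_eseriesr do rewrite E integral_mkcond.
  have m n : measurable_fun setT ((fun t => (v t ^+ 2 * w t)%:E) \_ `[l n, r n]).
    by apply/(measurable_restrictT _ _).1 => //; exact: mv2.
  have n0 n t : 0 <= ((fun t => (v t ^+ 2 * w t)%:E) \_ `[l n, r n]) t.
    by rewrite patchE; case: ifP.
  rewrite -(integral_nneseries leb measurableT m (fun n t _ => n0 n t)).
  rewrite [leLHS]integral_mkcond.
  apply: ge0_le_integral => //.
  - by move=> t _; rewrite patchE; case: ifP.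
  - by apply/(measurable_restrictT _ _).1 => //; exact: mv2.
  - by apply: ge0_emeasurable_sum => [n t _ _|n _]; [exact: n0|exact: m].
  move=> t _; rewrite patchE; case: ifPn => [|_]; last exact: nneseries_ge0.
  rewrite inE => /SI [n _ tn].
  apply: le_trans (nneseries_lim_ge n.+1 (fun k _ _ => n0 k t)).
  rewrite big_mkord big_ord_recr/= [X in _ + X]patchE mem_set//.
  by rewrite leeDr// sume_ge0.
apply: (@le_trans _ _ (\sum_(n <oo) ((2 * theta)%:E * \int[leb]_(t in `]l' n, r' n[) (v t ^+ 2 * w t)%:E +
  (2 * kappa)%:E * \int[leb]_(t in `]p n, q n[) (g t ^+ 2 * w t)%:E))).
  have i0 : forall n, 0 <= \int[leb]_(t in `]l n, r n[) (v t ^+ 2 * w t)%:E.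
    by move=> n; apply: integral_ge0.
  apply: lee_nneseries => [//|n _].
  have [h1 h2 h3 h4] := Hlr n; have [h5 h6] := Hq n.
  by apply: block_le => // s t; [exact: Hth|exact: Hka].
have i1 n : 0 <= \int[leb]_(t in `]l' n, r' n[) (v t ^+ 2 * w t)%:E.
  by apply: integral_ge0.
have i2 n : 0 <= \int[leb]_(t in `]p n, q n[) (g t ^+ 2 * w t)%:E.
  by apply: integral_ge0.
rewrite nneseriesD => [|n _ _|n _ _]; last 2 first.
- by rewrite mule_ge0// lee_fin mulr_ge0.
- by rewrite mule_ge0// lee_fin mulr_ge0.
rewrite !nneseriesZl//.
apply: leeD.
  apply: lee_wpmul2l; first by rewrite lee_fin mulr_ge0.
  rewrite -[leRHS]mul1e; apply: (@nneseries_integral_overlap _ _ _ leb 0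
    (fun n => `]l' n, r' n[%classic)) => //; last exact: mv2.
  by move=> n k; rewrite addn0; exact: D1.
rewrite [(2 * kappa * _)%:E]EFinM -muleA.
apply: lee_wpmul2l; first by rewrite lee_fin mulr_ge0.
apply: (@nneseries_integral_overlap _ _ _ leb K (fun n => `]p n, q n[%classic)) => //.
exact: mg2.
Qed.

End block_comparison.

(** * The mass near infinity and near zero *)

Section tails.
Context {R : realType}.
Local Notation leb := (@lebesgue_measure R).

(* On positive reals this is t^c e^(-a t^2). *)
Definition pgauss (c a t : R) : R := expR (c * ln t - a * t ^+ 2).

(** Reflecting when [b] is false lets one chain of blocks serve both ends of the line; [signed_left]
    and [signed_right] are the ends of the possibly reflected interval ]x, y[. *)
Definition signed (b : bool) (t : R) : R := if b then t else - t.

Definition signed_left (b : bool) (x y : R) : R := if b then x else - y.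
Definition signed_right (b : bool) (x y : R) : R := if b then y else - x.

Lemma signed_itv b x y t :
  (signed_left b x y < t < signed_right b x y) = (x < signed b t < y).
Proof. by case: b => //=; rewrite ltrNl ltrNr andbC. Qed.

Lemma signed_itvc b x y t :
  (signed_left b x y <= t <= signed_right b x y) = (x <= signed b t <= y).
Proof. by case: b => //=; rewrite lerNl lerNr andbC. Qed.

Lemma signed_length b x y : signed_right b x y - signed_left b x y = y - x.
Proof. by case: b => //=; rewrite opprK addrC. Qed.

Lemma signed_left_lt_right b x y :
  (signed_left b x y < signed_right b x y) = (x < y).
Proof. by case: b => //=; rewrite ltrN2. Qed.

Lemma signed_left_le b x y x' y' : x <= x' -> y' <= y ->
  signed_left b x y <= signed_left b x' y'.
Proof. by case: b => //= _ h; rewrite lerN2. Qed.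

Lemma signed_right_le b x y x' y' : x <= x' -> y' <= y ->
  signed_right b x' y' <= signed_right b x y.
Proof. by case: b => //= h _; rewrite lerN2. Qed.

Lemma itv_signed_disjoint b x y x' y' : y <= x' ->
  `]signed_left b x y, signed_right b x y[%classic `&`
  `]signed_left b x' y', signed_right b x' y'[%classic = set0.
Proof.
move=> yx'; apply/seteqP; split => // t; rewrite /= !in_itv/= !signed_itv.
move=> [/andP[_ h1] /andP[h2 _]].
by have := lt_le_trans h1 (le_trans yx' (ltW h2)); rewrite ltxx.
Qed.

Lemma expRN_small (a C eps : R) : 0 < a -> 0 < eps -> 0 <= C ->
  exists k : nat, C * expR (- (a * k%:R)) <= eps.
Proof.
move=> a0 e0 C0; exists (Num.truncn (C / (eps * a))).+1; set k := _.+1.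
rewrite expRN ler_pdivrMr ?expR_gt0//.
have h : C / (eps * a) < k%:R := truncnS_gt _.
rewrite ltr_pdivrMr ?mulr_gt0// in h.
have := expR_ge1Dx (a * k%:R).
by move: (expR _) h => E h hE; nra.
Qed.

Lemma pgauss_ratio (c a s t d : R) :
  c * (ln s - ln t) - a * (s ^+ 2 - t ^+ 2) <= d ->
  pgauss c a s <= expR d * pgauss c a t.
Proof. by move=> h; rewrite /pgauss -expRD ler_expR; lra. Qed.

(** This is ln r <= r - 1 for r = s / t and r = t / s. *)
Lemma ln_diff_le (s t A : R) : 0 < s -> 0 < t -> s <= A * t -> t <= A * s ->
  `|ln s - ln t| <= A - 1.
Proof.
move=> s0 t0 sA tA.
have h (x y : R) : 0 < x -> 0 < y -> x <= A * y -> ln x - ln y <= A - 1.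
  move=> x0 y0 xA; rewrite -ln_div ?posrE//.
  have xy0 : 0 < x / y by rewrite divr_gt0.
  have : x / y <= A by rewrite ler_pdivrMr.
  have := expR_ge1Dx (ln (x / y)); rewrite lnK ?posrE//; lra.
by rewrite ler_norml; apply/andP; split; have := h _ _ s0 t0 sA;
  have := h _ _ t0 s0 tA; lra.
Qed.

Lemma mul_le_norm (c d A : R) : `|d| <= A -> c * d <= `|c| * A.
Proof.
move=> dA; rewrite (le_trans (ler_norm _))// normrM ler_wpM2l//.
Qed.

(* The blocks ]x_n, x_(n+1)[ with x_n = sqrt (n0 + n) have decreasing lengths, so
   that shifting the index by k divides their masses by about e^(a k), while the
   squared length of the hull of k + 1 blocks is at most (k + 1)^2 / n0. *)
Section sqrt_chain.
Variables (c a : R) (a0 : 0 < a) (n0 k : nat).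
Hypothesis n0k : (k < n0)%N.
Let x (n : nat) : R := Num.sqrt (n0 + n)%:R.

Let x_ge0 n : 0 <= x n. Proof. exact: sqrtr_ge0. Qed.
Let x2 n : x n ^+ 2 = (n0 + n)%:R. Proof. by rewrite sqr_sqrtr. Qed.
Let x_gt0 n : 0 < x n.
Proof. by rewrite sqrtr_gt0 ltr0n addn_gt0 (leq_ltn_trans _ n0k). Qed.
Let x_le n m : (n <= m)%N -> x n <= x m.
Proof. by move=> nm; rewrite ler_sqrt// ler_nat leq_add2l. Qed.
Let x_lt n m : (n < m)%N -> x n < x m.
Proof. by move=> nm; rewrite ltr_sqrt ?ltr0n ?addn_gt0 ?(leq_ltn_trans _ nm) ?orbT// ltr_nat ltn_add2l. Qed.
Let x_ge1 n : 1 <= x n.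
Proof. by rewrite -[leLHS]sqrtr1 ler_sqrt// ler1n addn_gt0 (leq_ltn_trans _ n0k). Qed.

Let sq_lt n s : 0 < s -> (x n < s) = ((n0 + n)%:R < s ^+ 2).
Proof. by move=> s0; rewrite -x2 ltr_pXn2r ?nnegrE// ltW. Qed.

Let sq_gt n s : 0 < s -> (s < x n) = (s ^+ 2 < (n0 + n)%:R).
Proof. by move=> s0; rewrite -x2 ltr_pXn2r ?nnegrE// ltW. Qed.

Let hull_ln n s t : x n < s < x (n + k).+1 -> x n < t < x (n + k).+1 ->
  `|ln s - ln t| <= 1.
Proof.
(* Since k < n0, the last endpoint of the hull is at most twice the first: n0 + n + k + 1 <= 4 (n0 +
   n). *)
have half s' t' : x n < s' < x (n + k).+1 -> x n < t' < x (n + k).+1 -> s' <= 2 * t'.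
  move=> /andP[s1 s2] /andP[t1 t2].
  have s'0 : 0 < s' := lt_trans (x_gt0 n) s1.
  have t'0 : 0 < t' := lt_trans (x_gt0 n) t1.
  suff : s' ^+ 2 <= (2 * t') ^+ 2.
    by rewrite ler_pXn2r ?nnegrE// ?mulr_ge0// ltW.
  rewrite sq_gt// in s2; rewrite sq_lt// in t1.
  apply: le_trans (ltW s2) _; rewrite exprMn.
  apply: (@le_trans _ _ (2 ^+ 2 * (n0 + n)%:R)); last by rewrite ler_pM2l// ltW.
  by rewrite -natrX -natrM ler_nat; lia.
move=> Hs Ht.
have s0 : 0 < s by case/andP: Hs => /(lt_trans (x_gt0 n)).
have t0 : 0 < t by case/andP: Ht => /(lt_trans (x_gt0 n)).
by have := ln_diff_le s0 t0 (half _ _ Hs Ht) (half _ _ Ht Hs); lra.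
Qed.

Lemma sqrt_chain_step n s t : x (n + k) < s < x (n + k).+1 -> x n < t < x n.+1 ->
  (x (n + k).+1 - x (n + k)) * pgauss c a s <=
  (expR `|c| * expR (a - a * k%:R)) * (x n.+1 - x n) * pgauss c a t.
Proof.
move=> /andP[s1 s2] /andP[t1 t2].
have s0 : 0 < s := lt_trans (x_gt0 _) s1.
have t0 : 0 < t := lt_trans (x_gt0 _) t1.
(* The length x_(m+1) - x_m = 1 / (x_(m+1) + x_m) decreases with m. *)
have L : x (n + k).+1 - x (n + k) <= x n.+1 - x n.
  have d m : x m.+1 - x m = (x m.+1 + x m)^-1.
    apply: (mulIf (x := x m.+1 + x m)); first by rewrite gt_eqF ?addr_gt0.
    rewrite mulVf ?gt_eqF ?addr_gt0// -subr_sqr !x2 addnS -natr1; lra.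
  rewrite !d lef_pV2 ?posrE ?addr_gt0// lerD// x_le// ?ltnS leq_addr//.
rewrite mulrAC [leRHS]mulrC; apply: ler_pM => //.
- by rewrite subr_ge0 x_le.
- by rewrite expR_ge0.
rewrite -expRD; apply: pgauss_ratio.
have h1 : `|ln s - ln t| <= 1.
  apply: (@hull_ln n); rewrite ?s2 ?t1 ?andbT ?andTb.
    by rewrite (le_lt_trans _ s1)// x_le// leq_addr.
  by rewrite (lt_le_trans t2)// x_le// ltnS leq_addr.
have := mul_le_norm c h1; rewrite mulr1.
rewrite sq_lt// in s1; rewrite sq_gt// in t2.
move: s1 t2; rewrite !natrD -natr1 => s1 t2.
(* The squares lie between integers: s^2 > n0 + n + k and t^2 < n0 + n + 1. This is the origin of
   the exponent a - a k. *)
have : a * (k%:R - 1) <= a * (s ^+ 2 - t ^+ 2) by rewrite ler_pM2l//; lra.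
lra.
Qed.

Lemma sqrt_chain_hull n s t : x (n + k) < s < x (n + k).+1 -> x n < t < x (n + k).+1 ->
  (x (n + k).+1 - x n) * ((x (n + k).+1 - x (n + k)) * pgauss c a s) <=
  (k.+1%:R ^+ 2 / n0%:R * expR (`|c| + a)) * pgauss c a t.
Proof.
move=> /andP[s1 s2] /andP[t1 t2].
have s0 : 0 < s := lt_trans (x_gt0 _) s1.
have t0 : 0 < t := lt_trans (x_gt0 _) t1.
have n00 : 0 < n0%:R :> R by rewrite ltr0n (leq_ltn_trans _ n0k).
have d : (x (n + k).+1 - x n) ^+ 2 <= k.+1%:R ^+ 2 / n0%:R.
  rewrite ler_pdivlMr//.
  (* The difference of the squares of the two ends of the hull is k + 1, and their sum is at least
     sqrt(n0): the hull has length at most (k + 1) / sqrt(n0). *)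
  have h1 : (x (n + k).+1 - x n) * (x (n + k).+1 + x n) = k.+1%:R.
    by rewrite -subr_sqr !x2 !natrD -!natr1 !natrD; lra.
  have h2 : n0%:R <= x n ^+ 2 by rewrite x2 ler_nat leq_addr.
  have h3 : x n <= x (n + k).+1 by rewrite x_le// leqW// leq_addr.
  rewrite -h1 exprMn; apply: ler_wpM2l; first exact: sqr_ge0.
  apply: le_trans h2 _; rewrite ler_pXn2r ?nnegrE ?addr_ge0//; lra.
have H0 : 0 <= x (n + k).+1 - x n by rewrite subr_ge0 x_le// leqW// leq_addr.
have I0 : 0 <= x (n + k).+1 - x (n + k) by rewrite subr_ge0 x_le.
rewrite mulrA -[leRHS]mulrA; apply: ler_pM.
- exact: mulr_ge0.
- exact: expR_ge0.
- by apply: le_trans d; rewrite expr2 ler_wpM2l// lerD2l lerN2 x_le// leq_addr.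
apply: pgauss_ratio.
have h1 : `|ln s - ln t| <= 1.
  apply: (@hull_ln n); rewrite ?s2 ?t1 ?t2 ?andbT ?andTb//.
  by rewrite (le_lt_trans _ s1)// x_le// leq_addr.
have := mul_le_norm c h1; rewrite mulr1.
rewrite sq_lt// in s1; rewrite sq_gt// in t2.
move: s1 t2; rewrite !natrD -!natr1 !natrD => s1 t2.
(* s is in the last block of the hull, so t^2 exceeds s^2 by less than 1. *)
have : a * (- 1) <= a * (s ^+ 2 - t ^+ 2) by rewrite ler_pM2l//; lra.
lra.
Qed.

End sqrt_chain.

Section infinity.
Variables (c a eps : R) (a0 : 0 < a) (e0 : 0 < eps).

(** T depends on c, a and eps alone, which makes the smallness uniform in v. The weight is
    prescribed only where [signed b t] is at least 1, so that normal and tangential weights are both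
    covered. *)
Lemma tail_infty : exists2 T : R, 1 <= T &
  forall (b : bool) (J : set R) (v g w : R -> R),
  measurable_fun setT v -> measurable_fun setT g -> measurable_fun setT w ->
  (forall t, 0 <= w t) -> half_holder J v g ->
  (forall t, 1 <= signed b t -> J t) ->
  (forall t, 1 <= signed b t -> w t = pgauss c a (signed b t)) ->
  (\int[leb]_(t in [set t | (T <= signed b t)%R]) (v t ^+ 2 * w t)%:E <=
   eps%:E * (\int[leb]_t (v t ^+ 2 * w t)%:E + \int[leb]_t (g t ^+ 2 * w t)%:E))%E.
Proof.
(* k comes first and makes 2 [theta] at most eps. Then n0, with C / n0 equal to 2 [kappa] (k + 1),
   makes this at most eps too, and exceeds k as the chain requires. *)
have [k Hk] : exists k : nat, (2 * expR `|c| * expR a) * expR (- (a * k%:R)) <= eps.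
  by apply: expRN_small => //; rewrite !mulr_ge0 ?expR_ge0.
pose C := 2 * (k.+1%:R ^+ 2 * expR (`|c| + a)) * k.+1%:R.
have C0 : 0 <= C by rewrite !mulr_ge0 ?expR_ge0 ?exprn_ge0.
pose n0 := (Num.truncn (C / eps) + k).+1.
have kn0 : (k < n0)%N by rewrite /n0 ltnS leq_addl.
have Hn0 : C / n0%:R <= eps.
  rewrite ler_pdivrMr ?ltr0n// mulrC -ler_pdivrMr//.
  apply: le_trans (ltW (truncnS_gt _)) _; rewrite ler_nat /n0 ltnS leq_addr//.
pose x (n : nat) : R := Num.sqrt (n0 + n)%:R.
have x_le n m : (n <= m)%N -> x n <= x m.
  by move=> nm; rewrite ler_sqrt// ler_nat leq_add2l.
have x_lt n m : (n < m)%N -> x n < x m.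
  by move=> nm; rewrite ltr_sqrt ?ltr0n// ltr_nat ltn_add2l.
have x_ge1 n : 1 <= x n by rewrite -[leLHS]sqrtr1 ler_sqrt// ler1n.
exists (x k) => // b J v g w mv mg mw w0 hh HJ Hw.
have hw n t : x n < signed b t -> w t = pgauss c a (signed b t).
  by move=> xt; apply: Hw; rewrite (le_trans (x_ge1 n))// ltW.
set theta := expR `|c| * expR (a - a * k%:R).
set kappa := k.+1%:R ^+ 2 / n0%:R * expR (`|c| + a).
have th0 : 0 <= theta by rewrite mulr_ge0 ?expR_ge0.
have ka0 : 0 <= kappa by rewrite !mulr_ge0 ?expR_ge0// invr_ge0.
have th_eps : 2 * theta <= eps.
  by rewrite (le_trans _ Hk)// /theta expRD !mulrA.
have ka_eps : 2 * kappa * k.+1%:R <= eps.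
  apply: le_trans Hn0; rewrite /kappa /C; lra.
have vw0 : (0 <= \int[leb]_t (v t ^+ 2 * w t)%:E)%E.
  by apply: integral_ge0 => t _; rewrite lee_fin mulr_ge0 ?sqr_ge0.
have gw0 : (0 <= \int[leb]_t (g t ^+ 2 * w t)%:E)%E.
  by apply: integral_ge0 => t _; rewrite lee_fin mulr_ge0 ?sqr_ge0.
apply: (@le_trans _ _ ((2 * theta)%:E * \int[leb]_t (v t ^+ 2 * w t)%:E +
  (2 * kappa * k.+1%:R)%:E * \int[leb]_t (g t ^+ 2 * w t)%:E)%E); last first.
  move: (\int[leb]_t (v t ^+ 2 * w t)%:E)%E (\int[leb]_t (g t ^+ 2 * w t)%:E)%E vw0 gw0.
  move=> V G V0 G0; rewrite ge0_muleDr//.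
  by apply: leeD; apply: lee_wpmul2r => //; rewrite lee_fin.
apply: (@tail_le R J v g w mv mg mw w0 hh
  (fun n => signed_left b (x (n + k)%N) (x (n + k).+1)) (fun n => signed_right b (x (n + k)%N) (x (n + k).+1))
  (fun n => signed_left b (x n) (x n.+1)) (fun n => signed_right b (x n) (x n.+1))
  (fun n => signed_left b (x n) (x (n + k).+1)) (fun n => signed_right b (x n) (x (n + k).+1))) => //.
- move=> n; split; rewrite ?signed_left_lt_right ?x_lt//.
  + by apply: signed_left_le; rewrite ?x_le// leq_addr.
  + by apply: signed_left_le; rewrite ?x_le// ltnS leq_addr.
- move=> n; split; apply: signed_right_le; rewrite ?x_le ?leq_addr// ltnS leq_addr//.
- move=> n t; rewrite /= in_itv/= signed_itvc => /andP[xt _]; apply: HJ.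
  exact: le_trans (x_ge1 n) xt.
- move=> n s t; rewrite !signed_itv !signed_length => Hs Ht.
  case/andP: (Hs) => s1 _; case/andP: (Ht) => t1 _.
  by rewrite (hw _ _ s1) (hw _ _ t1); exact: sqrt_chain_step.
- move=> n s t; rewrite !signed_itv !signed_length => Hs Ht.
  case/andP: (Hs) => s1 _; case/andP: (Ht) => t1 _.
  by rewrite (hw _ _ s1) (hw _ _ t1); exact: sqrt_chain_hull.
- by move=> n m nm; apply: itv_signed_disjoint; exact: x_le.
- by move=> n m nm; apply: itv_signed_disjoint; exact: x_le.
- case: b {HJ Hw hw} => /=.
    by rewrite (_ : [set t | x k <= t] = `[x k, +oo[%classic) //;
      apply/seteqP; split => t; rewrite /= in_itv/= andbT.
  rewrite (_ : [set t | x k <= - t] = `]-oo, - x k]%classic) //.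
  by apply/seteqP; split => t; rewrite /= in_itv/= lerNr.
- move=> t /= xt; set X := signed b t in xt.
  have X0 : 0 <= X := le_trans (le_trans ler01 (x_ge1 k)) xt.
  have X20 : 0 <= X ^+ 2 by exact: sqr_ge0.
  have kX : (n0 + k)%:R <= X ^+ 2.
    by rewrite -[leLHS]sqr_sqrtr// ler_pXn2r ?nnegrE.
  have kX' : (n0 + k <= Num.truncn (X ^+ 2))%N by rewrite truncn_ge_nat.
  (* The endpoints are square roots of consecutive integers, so the integer part of X^2 names the
     block. *)
  exists (Num.truncn (X ^+ 2) - n0 - k)%N => //.
  rewrite /= in_itv/= signed_itvc -/X.
  have E : (n0 + (Num.truncn (X ^+ 2) - n0 - k + k) = Num.truncn (X ^+ 2))%N.
    by rewrite subnK ?leq_subRL ?subnKC// (leq_trans _ kX')// leq_addr.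
  rewrite /x addnS E; have /andP[h1 h2] := truncn_itv X20.
  rewrite -[X in _ <= X <= _]ger0_norm// -sqrtr_sqr !ler_sqrt// h1/=.
  exact: ltW.
Qed.

End infinity.

End tails.

Section tail_at_zero.
Context {R : realType}.
Local Notation leb := (@lebesgue_measure R).
Variables (c a eps : R) (hc : 0 < c + 1) (a0 : 0 < a) (e0 : 0 < eps).

(* With blocks ]e^(-m-1), e^(-m)[, a shift of the index by k multiplies the mass
   of t^c by about e^(-k (c + 1)). *)
Lemma tail_zero : exists2 d : R, 0 < d <= 1 &
  forall (J : set R) (v g w : R -> R),
  measurable_fun setT v -> measurable_fun setT g -> measurable_fun setT w ->
  (forall t, 0 <= w t) -> half_holder J v g ->
  (forall t, 0 < t -> J t) ->
  (forall t, 0 < t -> w t = pgauss c a t) ->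
  (\int[leb]_(t in `]0%R, d]) (v t ^+ 2 * w t)%:E <=
   eps%:E * (\int[leb]_t (v t ^+ 2 * w t)%:E + \int[leb]_t (g t ^+ 2 * w t)%:E))%E.
Proof.
(* c + 1 > 0 lets k make the mass ratio small. Then n0, chosen after k, starts the chain so close to
   0 that all hulls have length at most e^(-n0). *)
have [k Hk] : exists k : nat, (2 * expR (a + `|c|)) * expR (- ((c + 1) * k%:R)) <= eps.
  by apply: expRN_small => //; rewrite mulr_ge0 ?expR_ge0.
have [n0 Hn0] : exists n0 : nat,
    (2 * expR (`|c| * k.+1%:R + a) * k.+1%:R) * expR (- (1 * n0%:R)) <= eps.
  by apply: expRN_small => //; rewrite !mulr_ge0 ?expR_ge0.
rewrite mul1r in Hn0.
pose x (n : nat) : R := expR (- (n0 + n)%:R).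
have x_gt0 n : 0 < x n by exact: expR_gt0.
have x_le n m : (n <= m)%N -> x m <= x n.
  by move=> nm; rewrite ler_expR lerN2 ler_nat leq_add2l.
have x_lt n m : (n < m)%N -> x m < x n.
  by move=> nm; rewrite ltr_expR ltrN2 ltr_nat ltn_add2l.
have x_le1 n : x n <= 1 by rewrite -expR0 ler_expR oppr_le0.
have x_add n m : x (n + m)%N = expR (- m%:R) * x n.
  by rewrite /x -expRD addnA [in LHS]natrD opprD addrC.
have elnK (t : R) (t0 : 0 < t) : expR (ln t) = t by rewrite lnK ?posrE.
have xln n (t : R) : 0 < t -> (x n < t) = (- (n0 + n)%:R < ln t).
  by move=> t0; rewrite -{1}(elnK t t0) ltr_expR.
have lnx n (t : R) : 0 < t -> (t < x n) = (ln t < - (n0 + n)%:R).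
  by move=> t0; rewrite -{1}(elnK t t0) ltr_expR.
exists (x k); first by rewrite x_gt0 x_le1.
move=> J v g w mv mg mw w0 hh HJ Hw.
set theta := expR (a + `|c|) * expR (- ((c + 1) * k%:R)).
set kappa := expR (- n0%:R) * expR (`|c| * k.+1%:R + a).
have th0 : 0 <= theta by rewrite mulr_ge0 ?expR_ge0.
have ka0 : 0 <= kappa by rewrite !mulr_ge0 ?expR_ge0.
have th_eps : 2 * theta <= eps by rewrite (le_trans _ Hk)// /theta !mulrA.
have ka_eps : 2 * kappa * k.+1%:R <= eps by apply: le_trans Hn0; rewrite /kappa; lra.
have vw0 : (0 <= \int[leb]_t (v t ^+ 2 * w t)%:E)%E.
  by apply: integral_ge0 => t _; rewrite lee_fin mulr_ge0 ?sqr_ge0.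
have gw0 : (0 <= \int[leb]_t (g t ^+ 2 * w t)%:E)%E.
  by apply: integral_ge0 => t _; rewrite lee_fin mulr_ge0 ?sqr_ge0.
apply: (@le_trans _ _ ((2 * theta)%:E * \int[leb]_t (v t ^+ 2 * w t)%:E +
  (2 * kappa * k.+1%:R)%:E * \int[leb]_t (g t ^+ 2 * w t)%:E)%E); last first.
  move: (\int[leb]_t (v t ^+ 2 * w t)%:E)%E (\int[leb]_t (g t ^+ 2 * w t)%:E)%E vw0 gw0.
  move=> V G V0 G0; rewrite ge0_muleDr//.
  by apply: leeD; apply: lee_wpmul2r => //; rewrite lee_fin.
apply: (@tail_le R J v g w mv mg mw w0 hh
  (fun n => x (n + k).+1) (fun n => x (n + k)%N)
  (fun n => x n.+1) (fun n => x n)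
  (fun n => x (n + k).+1) (fun n => x n)) => //.
- move=> n; split; rewrite ?x_lt// x_le// ltnS leq_addr//.
- move=> n; split; rewrite ?x_le ?leq_addr//.
- move=> n t; rewrite /= in_itv/= => /andP[xt _]; apply: HJ.
  exact: lt_le_trans xt.
- move=> n s t /andP[s1 s2] /andP[t1 t2].
  have s0 : 0 < s := lt_trans (x_gt0 _) s1.
  have t0 : 0 < t := lt_trans (x_gt0 _) t1.
  rewrite !Hw//.
  (* The length is divided by e^k and t^c changes by about e^(-c k): together these give the
     exponent (c + 1) k of [theta]. *)
  have -> : x (n + k)%N - x (n + k).+1 = expR (- k%:R) * (x n - x n.+1).
    by rewrite -addSn !x_add mulrBr.
  rewrite -[leRHS]mulrA [leRHS]mulrCA -[leLHS]mulrA [leLHS]mulrCA.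
  apply: ler_wpM2l; first by rewrite subr_ge0 x_le.
  rewrite -ler_pdivlMl ?expR_gt0// -expRN opprK mulrA.
  have -> : expR k%:R * theta = expR (a + `|c| - c * k%:R) by rewrite /theta -!expRD; congr expR; lra.
  apply: pgauss_ratio.
  have t1' : t <= 1 := le_trans (ltW t2) (x_le1 _).
  have h1 : `|ln s - ln t + k%:R| <= 1.
    rewrite xln// in s1; rewrite xln// in t1; rewrite lnx// in s2; rewrite lnx// in t2.
    move: s1 s2 t1 t2; rewrite ?addnS -?natr1 !natrD -?natr1 => s1 s2 t1 t2.
    by rewrite ler_norml; apply/andP; split; lra.
  have := mul_le_norm c h1; rewrite mulr1.
  have : a * (- 1) <= a * (s ^+ 2 - t ^+ 2) by rewrite ler_pM2l//; nra.
  lra.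
- move=> n s t /andP[s1 s2] /andP[t1 t2].
  have s0 : 0 < s := lt_trans (x_gt0 _) s1.
  have t0 : 0 < t := lt_trans (x_gt0 _) t1.
  rewrite !Hw// mulrA -[leRHS]mulrA; apply: ler_pM.
  + by rewrite mulr_ge0// subr_ge0 x_le// leqW// leq_addr.
  + exact: expR_ge0.
  + have -> : expR (- n0%:R) = x 0%N by rewrite /x addn0.
    have h1 := x_le1 n; have h2 := x_le 0%N n (leq0n _); have h3 := x_le n (n + k)%N (leq_addr _ _).
    have h4 := x_gt0 (n + k).+1; have h5 := x_gt0 (n + k)%N; have h6 := x_gt0 n.
    have h7 : x (n + k).+1 <= x (n + k)%N by rewrite x_le.
    by nra.
  apply: pgauss_ratio.
  have t1' : t <= 1.
    by rewrite (le_trans (ltW t2)).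
  have h1 : `|ln s - ln t| <= k.+1%:R.
    rewrite xln// in s1; rewrite xln// in t1; rewrite lnx// in s2; rewrite lnx// in t2.
    have k0 : 0 <= k%:R :> R by [].
    move: s1 s2 t1 t2; rewrite ?addnS -?natr1 !natrD -?natr1 => s1 s2 t1 t2.
    by rewrite ler_norml; apply/andP; split; lra.
  have := mul_le_norm c h1.
  have : a * (- 1) <= a * (s ^+ 2 - t ^+ 2) by rewrite ler_pM2l//; nra.
  lra.
- move=> n m nm; apply/seteqP; split => // t; rewrite /= !in_itv/=.
  move=> [/andP[h1 _] /andP[_ h2]].
  by have := lt_le_trans (lt_trans h1 h2) (x_le _ _ nm); rewrite ltxx.
- move=> n m nm; apply/seteqP; split => // t; rewrite /= !in_itv/=.
  move=> [/andP[h1 _] /andP[_ h2]].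
  by have := lt_le_trans (lt_trans h1 h2) (x_le _ _ nm); rewrite ltxx.
- move=> t /=; rewrite in_itv/= => /andP[t0 tk].
  have X1 : (n0 + k)%:R <= - ln t.
    by rewrite lerNr -ler_expR lnK ?posrE.
  have X0 : 0 <= - ln t := le_trans (ler0n _ _) X1.
  have kX : (n0 + k <= Num.truncn (- ln t))%N by rewrite truncn_ge_nat.
  exists (Num.truncn (- ln t) - n0 - k)%N => //.
  have E : (n0 + (Num.truncn (- ln t) - n0 - k + k) = Num.truncn (- ln t))%N.
    by rewrite subnK ?leq_subRL ?subnKC// (leq_trans _ kX)// leq_addr.
  have /andP[h1 h2] := truncn_itv X0.
  rewrite /= in_itv/= /x addnS E -[t in _ <= t <= _](elnK t t0) !ler_expR.
  by rewrite lerNl (ltW h2)/= lerNr.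
Qed.

End tail_at_zero.

(** * Averages over cells of a line *)

Section cells.
Context {R : realType}.
Local Notation leb := (@lebesgue_measure R).

Definition cell (al h : R) (k : nat) : set R :=
  `]al + k%:R * h, al + k.+1%:R * h[%classic.

Definition cell_mean (w : R -> R) (I : set R) (v : R -> R) : R :=
  fine (\int[leb]_(t in I) (v t * w t)%:E) / fine (\int[leb]_(t in I) (w t)%:E).

Definition cell_proj (w : R -> R) (al h : R) (m : nat) (v : R -> R) (t : R) : R :=
  \sum_(k < m) \1_(cell al h k) t * cell_mean w (cell al h k) v.

Lemma measurable_cell al h k : measurable (cell al h k).
Proof. exact: measurable_itv. Qed.

Lemma cell_inj al h j k t : 0 < h -> cell al h j t -> cell al h k t -> j = k.
Proof.
move=> h0; rewrite /cell/= !in_itv/= => /andP[a1 a2] /andP[b1 b2].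
wlog jk : j k a1 a2 b1 b2 / (j <= k)%N => [H|].
  by case/orP: (leq_total j k) => jk; [|apply/esym]; apply: H.
apply/eqP; rewrite eqn_leq jk/= leqNgt; apply/negP => lt_jk.
have : (j.+1%:R : R) * h <= k%:R * h by rewrite ler_wpM2r ?(ltW h0)// ler_nat.
lra.
Qed.

Section weight.
Variables (w : R -> R) (mw : measurable_fun setT w) (w0 : forall t, 0 <= w t).
Local Open Scope ereal_scope.

Let mvw (D : set R) (v : R -> R) : measurable_fun setT v ->
  measurable_fun D (fun t => (v t ^+ 2 * w t)%:E).
Proof.
move=> mv; apply: measurable_funTS; apply/measurable_EFinP.
by apply: measurable_funM => //; exact: measurable_funX.
Qed.

(** Jensen's inequality for the square, with the probability w dt / w(I). *)
Lemma cell_mean_sq_le (I : set R) (v : R -> R) :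
  measurable I -> measurable_fun setT v ->
  0 < \int[leb]_(t in I) (w t)%:E < +oo ->
  ((cell_mean w I v) ^+ 2)%:E * \int[leb]_(t in I) (w t)%:E <=
  \int[leb]_(t in I) (v t ^+ 2 * w t)%:E.
Proof.
move=> mI mv /andP[W0 Woo].
have := sqr_fine_integral_le leb mI mv mw w0; rewrite /cell_mean.
move: (\int[leb]_(t in I) (v t ^+ 2 * w t)%:E) => V.
move: (fine _) => A.
have Wf : \int[leb]_(t in I) (w t)%:E \is a fin_num.
  by rewrite ge0_fin_numE// ltW.
move: Wf W0 {Woo}; move: (\int[leb]_(t in I) (w t)%:E) => [W| |]//= _.
rewrite lte_fin => W0 h.
have -> : (((A / W) ^+ 2)%:E * W%:E = (W^-1)%:E * (A ^+ 2)%:E)%E.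
  rewrite -!EFinM; congr EFin.
  by rewrite expr_div_n expr2; field; rewrite gt_eqF.
have -> : V = (W^-1 * W)%:E * V by rewrite mulVf ?gt_eqF// mul1e.
by rewrite [(W^-1 * W)%:E]EFinM -muleA lee_wpmul2l// lee_fin invr_ge0 ltW.
Qed.

Lemma cell_integrable (I : set R) (v : R -> R) :
  measurable I -> measurable_fun setT v ->
  \int[leb]_(t in I) (w t)%:E < +oo ->
  \int[leb]_(t in I) (v t ^+ 2 * w t)%:E < +oo ->
  leb.-integrable I (fun t => (v t * w t)%:E).
Proof.
move=> mI mv Woo Voo; apply/integrableP; split.
  by apply: measurable_funTS; apply/measurable_EFinP; exact: measurable_funM.
apply: (@le_lt_trans _ _ (\int[leb]_(t in I) ((w t)%:E + (v t ^+ 2 * w t)%:E))).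
  apply: ge0_le_integral => //.
  - apply: measurableT_comp => //; apply: measurable_funTS.
    by apply/measurable_EFinP; exact: measurable_funM.
  - by apply: emeasurable_funD; [apply: measurable_funTS; exact/measurable_EFinP|exact: mvw].
  - move=> t _; rewrite /= -EFinD lee_fin normrM (ger0_norm (w0 t)) -[X in (_ <= X + _)%R]mul1r.
    rewrite -mulrDl ler_wpM2r// -real_normK ?num_real//.
    by have := sqr_ge0 (`|v t| - 1)%R; have := normr_ge0 (v t); nra.
rewrite ge0_integralD//.
- by rewrite lte_add_pinfty.
- by move=> t _; rewrite lee_fin.
- by apply: measurable_funTS; exact/measurable_EFinP.
- by move=> t _; rewrite lee_fin mulr_ge0 ?sqr_ge0.
- exact: mvw.
Qed.

Lemma cell_mean_sub (I : set R) (v v' : R -> R) :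
  measurable I -> measurable_fun setT v -> measurable_fun setT v' ->
  \int[leb]_(t in I) (w t)%:E < +oo ->
  \int[leb]_(t in I) (v t ^+ 2 * w t)%:E < +oo ->
  \int[leb]_(t in I) (v' t ^+ 2 * w t)%:E < +oo ->
  (cell_mean w I v - cell_mean w I v' = cell_mean w I (v \- v'))%R.
Proof.
move=> mI mv mv' Woo Voo Voo'; rewrite /cell_mean -mulrBl; congr (_ / _)%R.
have i1 := cell_integrable mI mv Woo Voo.
have i2 := cell_integrable mI mv' Woo Voo'.
rewrite -fineB; [|exact: integrable_fin_num|exact: integrable_fin_num].
rewrite -(integralB _ i1 i2)//; congr fine; apply: eq_integral => t _.
by rewrite -EFinB -mulrBl.
Qed.

Section grid.
Variables (al h : R) (m : nat) (h0 : (0 < h)%R).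
Hypothesis hw : forall k, (k < m)%N -> 0 < \int[leb]_(t in cell al h k) (w t)%:E < +oo.
Local Notation cell := (cell al h).
Local Notation P := (cell_proj w al h m).

Lemma cell_projE (v : R -> R) (k : nat) t : (k < m)%N -> cell k t ->
  P v t = cell_mean w (cell k) v.
Proof.
move=> km kt; rewrite /cell_proj (bigD1 (Ordinal km))//= indicE mem_set// mul1r.
rewrite big1 ?addr0// => j jk; rewrite indicE memNset ?mul0r// => jt.
by move/eqP: jk; apply; apply/val_inj => /=; exact: cell_inj jt kt.
Qed.

Lemma cell_proj_out (v : R -> R) t : (forall k, (k < m)%N -> ~ cell k t) -> P v t = 0%R.
Proof.
by move=> H; rewrite /cell_proj big1// => j _; rewrite indicE memNset ?mul0r//; exact: H.
Qed.

Lemma measurable_cell_proj (v : R -> R) : measurable_fun setT (P v).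
Proof.
apply: measurable_sum => k; apply: measurable_funM => //.
exact: measurable_indic (measurable_cell _ _ _).
Qed.

Lemma sum_cells_le (f : R -> \bar R) : measurable_fun setT f -> (forall t, 0 <= f t) ->
  \sum_(k < m) \int[leb]_(t in cell k) f t <= \int[leb]_t f t.
Proof.
move=> mf f0.
under eq_bigr do rewrite integral_mkcond.
have mr (k : nat) : measurable_fun setT (f \_ (cell k)).
  by apply/(measurable_restrictT _ _).1; [exact: measurable_cell|]; exact: (measurable_funTS mf).
have r0 (k : nat) t : 0 <= (f \_ (cell k)) t by rewrite patchE; case: ifP.
rewrite -(ge0_integral_sum leb measurableT (f := fun k : 'I_m => f \_ (cell k))); last 2 first.
- by move=> k; exact: mr.
- by move=> k t _; exact: r0.
apply: ge0_le_integral => //.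
- by move=> t _; exact: sume_ge0.
- by apply: emeasurable_sum => k; exact: mr.
move=> t _.
case: (pselect (exists2 k, (k < m)%N & cell k t)) => [[k km kt]|H].
  rewrite (bigD1 (Ordinal km))//= patchE mem_set// big1 ?adde0// => j jk.
  rewrite patchE memNset// => jt; move/eqP: jk; apply; apply/val_inj => /=.
  exact: cell_inj jt kt.
rewrite big1// => k _; rewrite patchE memNset// => kt; apply: H.
by exists k.
Qed.

(** Jensen's inequality on each cell; the cells are disjoint and the projection is 0 elsewhere. *)
Lemma cell_proj_contract (v : R -> R) : measurable_fun setT v ->
  \int[leb]_t ((P v t) ^+ 2 * w t)%:E <= \int[leb]_t (v t ^+ 2 * w t)%:E.
Proof.
move=> mv; apply: le_trans (sum_cells_le _ _); last 2 first.
- exact: mvw.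
- by move=> t; rewrite lee_fin mulr_ge0 ?sqr_ge0.
apply: (@le_trans _ _ (\sum_(k < m) ((cell_mean w (cell k) v) ^+ 2)%:E *
   \int[leb]_(t in cell k) (w t)%:E)); last first.
  by apply: lee_sum => k _; apply: cell_mean_sq_le => //; [exact: measurable_cell|exact: hw].
have mr (k : nat) : measurable_fun setT ((EFin \o w) \_ (cell k)).
  apply/(measurable_restrictT _ _).1; [exact: measurable_cell|]; apply: measurable_funTS.
  exact/measurable_EFinP.
have r0 (k : nat) t : 0 <= ((EFin \o w) \_ (cell k)) t.
  by rewrite patchE; case: ifP => // _; rewrite lee_fin.
pose F (k : 'I_m) (t : R) : \bar R :=
  ((cell_mean w (cell k) v) ^+ 2)%:E * ((EFin \o w) \_ (cell k)) t.
have EF (k : 'I_m) : ((cell_mean w (cell k) v) ^+ 2)%:E * \int[leb]_(t in cell k) (w t)%:E =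
    \int[leb]_t F k t.
  rewrite ge0_integralZl//; [by rewrite [in LHS]integral_mkcond|exact: mr|].
  rewrite -[leLHS]/(0%:E) lee_fin; exact: sqr_ge0.
have F0 (k : 'I_m) t : 0 <= F k t.
  by apply: mule_ge0; [rewrite -[leLHS]/(0%:E) lee_fin; exact: sqr_ge0|exact: r0].
have mF (k : 'I_m) : measurable_fun setT (F k).
  by apply: emeasurable_funM; [exact: measurable_cst|exact: mr].
rewrite (eq_bigr _ (fun k _ => EF k)).
rewrite -(ge0_integral_sum leb measurableT (f := F)).
- apply: ge0_le_integral => //.
  + by move=> t _; rewrite lee_fin mulr_ge0 ?sqr_ge0.
  + by apply: mvw; exact: measurable_cell_proj.
  + by apply: emeasurable_sum => k; exact: mF.
  move=> t _.
  case: (pselect (exists2 k, (k < m)%N & cell k t)) => [[k km kt]|H].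
    rewrite (cell_projE v km kt) (bigD1 (Ordinal km))//= {1}/F patchE mem_set//= -EFinM leeDl//.
    by apply: sume_ge0 => j _; exact: F0.
  rewrite cell_proj_out ?expr0n/= ?mul0r; last by move=> k km kt; apply: H; exists k.
  by apply: sume_ge0 => j _; exact: F0.
- by move=> k; exact: mF.
- by move=> k t _; exact: F0.
Qed.

Let cell_oo (v : R -> R) k : measurable_fun setT v ->
  \int[leb]_t (v t ^+ 2 * w t)%:E < +oo ->
  \int[leb]_(t in cell k) (v t ^+ 2 * w t)%:E < +oo.
Proof.
move=> mv; apply: le_lt_trans; apply: ge0_subset_integral => //.
- exact: measurable_cell.
- exact: mvw.
- by move=> t _; rewrite lee_fin mulr_ge0 ?sqr_ge0.
Qed.

Lemma cell_proj_sub (v v' : R -> R) t :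
  measurable_fun setT v -> measurable_fun setT v' ->
  \int[leb]_t (v t ^+ 2 * w t)%:E < +oo ->
  \int[leb]_t (v' t ^+ 2 * w t)%:E < +oo ->
  (P v t - P v' t = P (v \- v') t)%R.
Proof.
move=> mv mv' Voo Voo'; rewrite /cell_proj -sumrB; apply: eq_bigr => k _.
rewrite -mulrBr cell_mean_sub//; [exact: measurable_cell|..].
- by have /andP[] := hw (ltn_ord k).
- exact: cell_oo.
- exact: cell_oo.
Qed.

End grid.
End weight.
End cells.

Section cell_estimates.
Context {R : realType}.
Local Notation leb := (@lebesgue_measure R).
Variables (J : set R) (w : R -> R).
Hypotheses (mw : measurable_fun setT w) (w0 : forall t, 0 <= w t).
Local Open Scope ereal_scope.

Let mvw (D : set R) (v : R -> R) : measurable_fun setT v ->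
  measurable_fun D (fun t => (v t ^+ 2 * w t)%:E).
Proof.
move=> mv; apply: measurable_funTS; apply/measurable_EFinP.
by apply: measurable_funM => //; exact: measurable_funX.
Qed.

Let vw0 (v : R -> R) t : 0 <= (v t ^+ 2 * w t)%:E.
Proof. by rewrite lee_fin mulr_ge0 ?sqr_ge0. Qed.

Let rZ (f : R -> R) (D : set R) (K : R) : measurable D -> measurable_fun setT f ->
  (forall t, 0 <= f t)%R -> (0 <= K)%R ->
  \int[leb]_(t in D) (K%:E * (f t)%:E) = K%:E * \int[leb]_(t in D) (f t)%:E.
Proof.
move=> mD mf f0 K0; apply: ge0_integralZl => //.
- by apply: measurable_funTS; exact/measurable_EFinP.
- by move=> t _; rewrite lee_fin.
Qed.

Lemma cell_mean_cst (I : set R) (c : R) :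
  measurable I -> 0 < \int[leb]_(t in I) (w t)%:E < +oo ->
  cell_mean w I (fun=> c) = c.
Proof.
move=> mI /andP[W0 Woo]; rewrite /cell_mean.
have mwI : measurable_fun I (EFin \o w) by apply: measurable_funTS; exact/measurable_EFinP.
have iw : leb.-integrable I (EFin \o w).
  apply/integrableP; split => //.
  by under eq_integral => t _ do rewrite /= ger0_norm//.
under eq_integral => t _ do rewrite EFinM.
rewrite integralZl// fineM//; last by exact: integrable_fin_num.
by rewrite mulfK// gt_eqF// fine_gt0// W0 Woo.
Qed.

(** Poincare's inequality: v(s) minus the mean is the mean over t of v(s) - v(t), whose square
    [half_holder] bounds by (r - l) times the integral of g^2. The bound C on the ratios of w then
    moves w(s) under that integral, and integration in s gives the second factor r - l. *)
Lemma cell_block_le (l r C : R) (v g : R -> R) :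
  measurable_fun setT v -> measurable_fun setT g -> half_holder J v g ->
  (l < r)%R -> (0 <= C)%R -> `[l, r] `<=` J ->
  (forall s t, l < s < r -> l < t < r -> w s <= C * w t)%R ->
  0 < \int[leb]_(t in `]l, r[) (w t)%:E < +oo ->
  \int[leb]_(t in `]l, r[) (v t ^+ 2 * w t)%:E < +oo ->
  \int[leb]_(t in `]l, r[) ((v t - cell_mean w `]l, r[ v) ^+ 2 * w t)%:E <=
  ((r - l) ^+ 2 * C)%:E * \int[leb]_(t in `]l, r[) (g t ^+ 2 * w t)%:E.
Proof.
move=> mv mg [E NE HE] lr C0 lrJ Cw hW Voo.
set A := cell_mean _ _ _; set Gam := \int[leb]_(t in `]l, r[) (g t ^+ 2 * w t)%:E.
have rl0 : (0 < r - l)%R by rewrite subr_gt0.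
pose G := \int[leb]_(t in `]l, r[) (g t ^+ 2)%:E.
have mg2 D : measurable_fun D (fun t => (g t ^+ 2)%:E).
  by apply: measurable_funTS; apply/measurable_EFinP; exact: measurable_funX.
have G0 : 0 <= G by apply: integral_ge0 => t _; rewrite lee_fin sqr_ge0.
have Gam0 : 0 <= Gam by apply: integral_ge0.
have mI : measurable (`]l, r[%classic : set R) by exact: measurable_itv.
have osc s : (l < s < r)%R -> ~ E s -> ((v s - A) ^+ 2)%:E <= (r - l)%:E * G.
  move=> sI Es.
  have Hs t : (l < t < r)%R -> ~ E t -> ((v s - v t) ^+ 2)%:E <= (r - l)%:E * G.
    by move=> tI Et; exact: HE.
  (* An infinite integral of g^2 makes the bound trivial. *)
  move: G0 Hs; move: {HE}G => [G| |]// G0 Hs; last by rewrite gt0_muley ?leey// lte_fin.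
  have WA : (v s - A = cell_mean w `]l, r[ (cst (v s) \- v))%R.
    rewrite -{1}(cell_mean_cst (v s) mI hW) cell_mean_sub//.
    - by case/andP: hW.
    - under eq_integral => t _ do rewrite EFinM.
      rewrite (rZ (f := w)) ?sqr_ge0//.
      by rewrite lte_mul_pinfty// ?lee_fin ?sqr_ge0//; case/andP: hW.
  have mcv : measurable_fun setT (cst (v s) \- v)%R by exact: measurable_funB.
  have := cell_mean_sq_le mw w0 mI mcv hW; rewrite -WA.
  have : \int[leb]_(t in `]l, r[) (((cst (v s) \- v)%R t) ^+ 2 * w t)%:E <=
      \int[leb]_(t in `]l, r[) (((r - l) * G)%:E * (w t)%:E).
    apply: ae_ge0_le_integral => //.
    - exact: mvw.
    - move=> t _; rewrite -EFinM lee_fin mulr_ge0// mulr_ge0//; exact: ltW.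
    - by apply: emeasurable_funM => //; apply: measurable_funTS; exact/measurable_EFinP.
    - apply: negligibleS NE => t /= /not_implyP[].
      rewrite in_itv/= => tI nC; apply: contrapT => Et; apply: nC.
      by rewrite -EFinM lee_fin ler_wpM2r//; have := Hs _ tI Et; rewrite -EFinM lee_fin.
  rewrite (rZ (f := w))//; last by rewrite mulr_ge0//; exact: ltW.
  move=> h2 h1; have := le_trans h1 h2.
  case/andP: hW => W1 W2; rewrite lee_pmul2r//.
  by apply/fin_numPlt; rewrite W2 (lt_trans _ W1).
have key s : (l < s < r)%R -> ~ E s ->
    ((v s - A) ^+ 2 * w s)%:E <= (r - l)%:E * (C%:E * Gam).
  move=> sI Es; rewrite mulrC EFinM.
  apply: (@le_trans _ _ ((w s)%:E * ((r - l)%:E * G))).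
    by apply: lee_wpmul2l; [rewrite lee_fin|exact: osc].
  rewrite muleCA; apply: lee_wpmul2l; first by rewrite lee_fin ltW.
  rewrite -(rZ (f := fun t => g t ^+ 2)%R)//; [|exact: measurable_funX|by move=> t; exact: sqr_ge0].
  rewrite /Gam -(rZ (f := fun t => g t ^+ 2 * w t)%R)//; last 2 first.
  - by apply: measurable_funM => //; exact: measurable_funX.
  - by move=> t; rewrite mulr_ge0 ?sqr_ge0.
  apply: ge0_le_integral => //.
  - by move=> x _; rewrite -EFinM lee_fin mulr_ge0 ?sqr_ge0.
  - by apply: emeasurable_funM => //; exact: mg2.
  - by apply: emeasurable_funM => //; exact: mvw.
  - move=> t; rewrite /= in_itv/= => tI; rewrite -!EFinM lee_fin.
    by rewrite [leRHS]mulrCA [leLHS]mulrC ler_wpM2l ?sqr_ge0//; exact: Cw.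
rewrite expr2 -mulrA EFinM -muleA EFinM -muleA.
apply: (integral_itv_ae_le lr NE) => //.
- apply: measurable_funTS; apply/measurable_EFinP; apply: measurable_funM => //.
  by apply: measurable_funX; exact: measurable_funB.
- by move=> t; rewrite lee_fin mulr_ge0 ?sqr_ge0.
- by rewrite !mule_ge0// lee_fin ltW.
Qed.

(** Off the grid the projection is 0 and the error is the tail; on the cells Poincare's inequality
    has constant h^2 C. Each of the two costs eps. *)
Lemma cells_estimate (al h C eps : R) (m : nat) (v g : R -> R) :
  measurable_fun setT v -> measurable_fun setT g -> half_holder J v g ->
  (0 < h)%R -> (0 <= C)%R -> `[al, (al + m%:R * h)%R] `<=` J ->
  (forall s t, al <= s <= al + m%:R * h -> al <= t <= al + m%:R * h ->
     w s <= C * w t)%R ->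
  (forall k, (k < m)%N -> 0 < \int[leb]_(t in cell al h k) (w t)%:E < +oo) ->
  (h ^+ 2 * C <= eps)%R ->
  \int[leb]_t (v t ^+ 2 * w t)%:E < +oo ->
  \int[leb]_(t in ~` `]al, (al + m%:R * h)%R[) (v t ^+ 2 * w t)%:E <= eps%:E *
    (\int[leb]_t (v t ^+ 2 * w t)%:E + \int[leb]_t (g t ^+ 2 * w t)%:E) ->
  \int[leb]_t ((v t - cell_proj w al h m v t) ^+ 2 * w t)%:E <= (2 * eps)%:E *
    (\int[leb]_t (v t ^+ 2 * w t)%:E + \int[leb]_t (g t ^+ 2 * w t)%:E).
Proof.
move=> mv mg hh h0 C0 HJ HC hw hCe Voo tailV.
set X := \int[leb]_t (v t ^+ 2 * w t)%:E + \int[leb]_t (g t ^+ 2 * w t)%:E.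
set S := ~` _ in tailV.
have X0 : 0 <= X by rewrite adde_ge0//; apply: integral_ge0.
have e0 : (0 <= eps)%R by rewrite (le_trans _ hCe)// mulr_ge0// sqr_ge0.
have mS : measurable S by apply: measurableC; exact: measurable_itv.
pose A (k : nat) := cell_mean w (cell al h k) v.
have mA k : measurable_fun setT (fun t => ((v t - A k) ^+ 2 * w t)%:E).
  apply/measurable_EFinP; apply: measurable_funM => //.
  by apply: measurable_funX; exact: measurable_funB.
have A0 k t : 0 <= ((v t - A k) ^+ 2 * w t)%:E by rewrite lee_fin mulr_ge0 ?sqr_ge0.
pose F0 := (fun t => (v t ^+ 2 * w t)%:E) \_ S.
pose F k := (fun t => ((v t - A k) ^+ 2 * w t)%:E) \_ (cell al h k).
have mF0 : measurable_fun setT F0.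
  by apply/(measurable_restrictT _ _).1 => //; exact: mvw.
have mF (k : 'I_m) : measurable_fun setT (F k).
  apply/(measurable_restrictT _ _).1; first exact: measurable_cell.
  exact: measurable_funTS.
have F00 t : 0 <= F0 t by rewrite /F0 patchE; case: ifP.
have FF0 k t : 0 <= F k t by rewrite /F patchE; case: ifP.
apply: (@le_trans _ _ (\int[leb]_t (F0 t + \sum_(k < m) F k t))).
  apply: ae_ge0_le_integral => //.
  - by move=> t _; rewrite lee_fin mulr_ge0 ?sqr_ge0.
  - apply/measurable_EFinP; apply: measurable_funM => //; apply: measurable_funX.
    by apply: measurable_funB => //; exact: measurable_cell_proj.
  - by move=> t _; rewrite adde_ge0// sume_ge0.
  - by apply: emeasurable_funD => //; apply: emeasurable_sum => k; exact: mF.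
  (* The endpoints of the cells belong to no cell, but they are countably many. *)
  pose Z : set R := [set (al + k%:R * h)%R | k in [set: nat]].
  have cZ : countable Z by apply: sub_countable (card_image_le _ _) _.
  have NZ : leb.-negligible Z.
    exists Z; split => //; last exact: countable_lebesgue_measure0.
    by apply: countable_measurable => // t; exact: measurable_set1.
  apply: negligibleS NZ => t /= /not_implyP[_ nC]; apply: contrapT => nZ; apply: nC.
  case: (pselect (S t)) => [St|nSt].
    rewrite cell_proj_out; last first.
      move=> k km; rewrite /cell/= in_itv/= => /andP[t1 t2]; apply: St.
      rewrite /= in_itv/=; apply/andP; split.
        by rewrite (le_lt_trans _ t1)// lerDl mulr_ge0// ltW.
      rewrite (lt_le_trans t2)// lerD2l ler_wpM2r ?(ltW h0)// ler_nat//.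
    by rewrite subr0 /F0 patchE mem_set// leeDl// sume_ge0.
  move: nSt; rewrite /S => /contrapT; rewrite /= in_itv/= => /andP[t1 t2].
  pose k := Num.truncn ((t - al) / h)%R.
  have th0 : (0 <= (t - al) / h)%R by rewrite divr_ge0// ?subr_ge0 ltW.
  have /andP[k1 k2] := truncn_itv th0; rewrite -/k in k1 k2.
  rewrite ler_pdivlMr// in k1; rewrite ltr_pdivrMr// in k2.
  have kne : (al + k%:R * h != t)%R.
    by apply/eqP => kt; apply: nZ; exists k.
  have kt : cell al h k t.
    rewrite /cell/= in_itv/= lt_neqAle kne/=; lra.
  have km : (k < m)%N.
    have : (k%:R * h < m%:R * h)%R by lra.
    by rewrite ltr_pM2r// ltr_nat.
  rewrite (cell_projE w h0 v km kt) (bigD1 (Ordinal km))//=.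
  have -> : F k t = ((v t - A k) ^+ 2 * w t)%:E by rewrite /F patchE mem_set.
  by rewrite addeCA leeDl// adde_ge0// sume_ge0.
rewrite ge0_integralD//; last 2 first.
- by move=> t _; exact: sume_ge0.
- by apply: emeasurable_sum => k; exact: mF.
rewrite (_ : (2 * eps)%:E * X = eps%:E * X + eps%:E * X); last first.
  by rewrite mulr2n mulrDl mul1r EFinD ge0_muleDl.
apply: leeD; first by rewrite /F0 -integral_mkcond.
rewrite ge0_integral_sum//.
apply: (@le_trans _ _ (\sum_(k < m) (eps%:E * \int[leb]_(t in cell al h k) (g t ^+ 2 * w t)%:E))).
  apply: lee_sum => k _; rewrite /F -integral_mkcond.
  have km := ltn_ord k.
  have kl : (al <= al + k%:R * h)%R by rewrite lerDl mulr_ge0// ltW.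
  have kr : (al + k.+1%:R * h <= al + m%:R * h)%R.
    by rewrite lerD2l ler_wpM2r ?(ltW h0)// ler_nat.
  have inI t : (al + k%:R * h < t < al + k.+1%:R * h)%R -> (al <= t <= al + m%:R * h)%R.
    by case/andP => h1 h2; rewrite (le_trans kl (ltW h1)) (le_trans (ltW h2) kr).
  have kk : (al + k.+1%:R * h - (al + k%:R * h) = h)%R by rewrite -natr1; ring.
  apply: le_trans (cell_block_le (C := C) mv mg hh _ C0 _ _ _ _) _ => //.
  - by rewrite -subr_gt0 kk.
  - move=> t; rewrite /= in_itv/= => /andP[h1 h2]; apply: HJ; rewrite /= in_itv/=.
    by rewrite (le_trans kl h1) (le_trans h2 kr).
  - by move=> s t sI tI; apply: HC; exact: inI.
  - exact: hw.
  - apply: le_lt_trans Voo; apply: ge0_subset_integral => //.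
    exact: mvw.
  by rewrite kk; apply: lee_wpmul2r => //; exact: integral_ge0.
rewrite -ge0_sume_distrr; last by move=> k _; exact: integral_ge0.
apply: lee_wpmul2l; first by rewrite lee_fin.
apply: (@le_trans _ _ (\int[leb]_t (g t ^+ 2 * w t)%:E)).
  by apply: sum_cells_le => //; exact: mvw.
by rewrite /X leeDr// integral_ge0.
Qed.

End cell_estimates.

Section directions.
Context {R : realType}.
Local Notation leb := (@lebesgue_measure R).

(* The one-dimensional factors of the weight: t^c e^(-a t^2) on t > 0 in the
   normal direction (b = true), e^(-a t^2) on the line in the others. *)
Definition axis_dom (b : bool) : set R := [set t | b ==> (0 < t)].

Definition axis_weight (b : bool) (c a t : R) : R :=
  if b then (if 0 < t then pgauss c a t else 0) else pgauss 0 a t.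

Lemma axis_weight_ge0 b c a t : 0 <= axis_weight b c a t.
Proof. by rewrite /axis_weight; case: b => //; [case: ifP => //|]; rewrite ?expR_ge0. Qed.

Lemma measurable_pgauss (D : set R) c a : measurable_fun D (@pgauss R c a).
Proof.
apply: measurable_funTS; apply: measurableT_comp => //.
apply: measurable_funB; apply: measurable_funM => //.
Qed.

Lemma measurable_axis_weight b c a : measurable_fun setT (axis_weight b c a).
Proof.
case: b; last exact: measurable_pgauss.
apply: measurable_fun_ifT => //.
  exact: measurable_fun_ltr.
exact: measurable_pgauss.
Qed.

Lemma integral_le_two_sets (S A B : set R) (f : R -> \bar R) :
  measurable S -> measurable A -> measurable B ->
  measurable_fun setT f -> (forall t, 0 <= f t)%E ->
  (forall t, S t -> [\/ f t = 0%E, A t | B t]) ->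
  (\int[leb]_(t in S) f t <= \int[leb]_(t in A) f t + \int[leb]_(t in B) f t)%E.
Proof.
move=> mS mA mB mf f0 SAB.
rewrite integral_mkcond [in leRHS]integral_mkcond.
rewrite [X in (_ <= _ + X)%E]integral_mkcond.
have m (D : set R) : measurable D -> measurable_fun setT (f \_ D).
  move=> mD; apply/(measurable_restrictT _ _).1 => //.
  exact: measurable_funTS.
have r0 (D : set R) t : (0 <= (f \_ D) t)%E by rewrite patchE; case: ifP.
rewrite -ge0_integralD//; [|exact: m|exact: m].
apply: ge0_le_integral => //.
- exact: m.
- by apply: emeasurable_funD; exact: m.
move=> t _; rewrite {1}patchE; case: ifPn => [|_]; last by rewrite adde_ge0.
rewrite inE => /SAB[->|At|Bt]; first by rewrite adde_ge0.
  by rewrite [X in (_ <= X + _)%E]patchE mem_set// leeDl.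
by rewrite [X in (_ <= _ + X)%E]patchE mem_set// leeDr.
Qed.

Lemma axis_cells_of_tail (b : bool) (c a al be C eps : R) :
  0 < eps -> 0 < C -> al < be ->
  (forall t, al <= t <= be -> axis_dom b t) ->
  (forall t, al <= t <= be -> 0 < axis_weight b c a t) ->
  (forall s t, al <= s <= be -> al <= t <= be ->
    axis_weight b c a s <= C * axis_weight b c a t) ->
  (forall v g : R -> R, measurable_fun setT v -> measurable_fun setT g ->
    half_holder (axis_dom b) v g ->
    (\int[leb]_(t in ~` `]al, be[) (v t ^+ 2 * axis_weight b c a t)%:E <= eps%:E *
     (\int[leb]_t (v t ^+ 2 * axis_weight b c a t)%:E +
      \int[leb]_t (g t ^+ 2 * axis_weight b c a t)%:E))%E) ->
  exists h m, [/\ 0 < h,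
    forall k, (k < m)%N ->
      (0 < \int[leb]_(t in cell al h k) (axis_weight b c a t)%:E < +oo)%E &
    forall v g : R -> R, measurable_fun setT v -> measurable_fun setT g ->
      half_holder (axis_dom b) v g ->
      (\int[leb]_t (v t ^+ 2 * axis_weight b c a t)%:E < +oo)%E ->
      (\int[leb]_t ((v t - cell_proj (axis_weight b c a) al h m v t) ^+ 2 *
         axis_weight b c a t)%:E <= (2 * eps)%:E *
       (\int[leb]_t (v t ^+ 2 * axis_weight b c a t)%:E +
        \int[leb]_t (g t ^+ 2 * axis_weight b c a t)%:E))%E].
Proof.
move=> e0 C0 albe HJ wpos wC tailV; set w := axis_weight b c a.
have mw : measurable_fun setT w by exact: measurable_axis_weight.
have w0 t : 0 <= w t by exact: axis_weight_ge0.
pose L := be - al; have L0 : 0 < L by rewrite subr_gt0.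
(* With h = L / m one has h^2 C = L^2 C / m^2 <= L^2 C / m <= eps. *)
pose m := (Num.truncn (L ^+ 2 * C / eps)).+1.
have m0 : 0 < m%:R :> R by rewrite ltr0n.
have m1 : 1 <= m%:R :> R by rewrite ler1n.
pose h := L / m%:R; have h0 : 0 < h by rewrite divr_gt0.
have mh : m%:R * h = L by rewrite /h mulrC divfK// gt_eqF.
have hC : h ^+ 2 * C <= eps.
  have : L ^+ 2 * C / eps < m%:R := truncnS_gt _.
  rewrite ltr_pdivrMr// => H.
  rewrite /h expr_div_n [leLHS]mulrAC ler_pdivrMr ?exprn_gt0//.
  apply: le_trans (ltW H) _; rewrite mulrC ler_pM2l// expr2 ler_peMl// ltW//.
have be_eq : al + m%:R * h = be by rewrite mh /L; lra.
have hw k : (k < m)%N -> (0 < \int[leb]_(t in cell al h k) (w t)%:E < +oo)%E.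
  move=> km.
  have kl : al <= al + k%:R * h by rewrite lerDl mulr_ge0// ltW.
  have kr : al + k.+1%:R * h <= be.
    by rewrite -be_eq lerD2l ler_wpM2r ?(ltW h0)// ler_nat.
  have klr : al + k%:R * h < al + k.+1%:R * h.
    by rewrite ltrD2l ltr_pM2r// ltr_nat.
  have inI t : al + k%:R * h < t < al + k.+1%:R * h -> al <= t <= be.
    by case/andP => h1 h2; rewrite (le_trans kl (ltW h1)) (le_trans (ltW h2) kr).
  have alI : al <= al <= be by rewrite lexx ltW.
  have n0 : leb.-negligible set0 by exact: negligible_set0.
  have mwk : measurable_fun (cell al h k) (EFin \o w).
    by apply: measurable_funTS; exact/measurable_EFinP.
  (* C compares w on the cell with its positive value at [al], which bounds the mass from below and
     from above. *)
  apply/andP; split.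
    apply: lt_le_trans (ae_le_integral_itv (C := (C^-1 * w al)%:E) klr n0 mwk _ _ _).
    - rewrite -EFinM lte_fin mulr_gt0 ?subr_gt0// mulr_gt0 ?invr_gt0//; exact: wpos.
    - by move=> t; rewrite lee_fin.
    - by rewrite lee_fin mulr_ge0// invr_ge0 ltW.
    - move=> t tI _; rewrite lee_fin ler_pdivrMl//; apply: wC => //; exact: inI.
  apply: le_lt_trans (integral_itv_ae_le (C := (C * w al)%:E) klr n0 mwk _ _ _) _.
  - by move=> t; rewrite lee_fin.
  - by rewrite lee_fin mulr_ge0// ltW.
  - move=> t tI _; rewrite lee_fin; apply: wC => //; exact: inI.
  - by rewrite -EFinM ltry.
exists h, m; split=> // v g mv mg hh Voo.
apply: (@cells_estimate R (axis_dom b) w mw w0 al h C eps m v g) => //.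
- exact: ltW.
- by move=> t; rewrite be_eq /= in_itv/=; exact: HJ.
- by rewrite be_eq; exact: wC.
- by rewrite be_eq; exact: tailV.
Qed.

Lemma axis_cells (b : bool) (c a eps : R) : 0 < c + 1 -> 0 < a -> 0 < eps ->
  exists al h m, [/\ 0 < h,
    forall k, (k < m)%N ->
      (0 < \int[leb]_(t in cell al h k) (axis_weight b c a t)%:E < +oo)%E &
    forall v g : R -> R, measurable_fun setT v -> measurable_fun setT g ->
      half_holder (axis_dom b) v g ->
      (\int[leb]_t (v t ^+ 2 * axis_weight b c a t)%:E < +oo)%E ->
      (\int[leb]_t ((v t - cell_proj (axis_weight b c a) al h m v t) ^+ 2 *
         axis_weight b c a t)%:E <= eps%:E *
       (\int[leb]_t (v t ^+ 2 * axis_weight b c a t)%:E +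
        \int[leb]_t (g t ^+ 2 * axis_weight b c a t)%:E))%E].
Proof.
move=> hc a0 e0; set w := axis_weight b c a.
have mw : measurable_fun setT w by exact: measurable_axis_weight.
have w0 t : 0 <= w t by exact: axis_weight_ge0.
have mvw (v : R -> R) : measurable_fun setT v ->
    measurable_fun setT (fun t => (v t ^+ 2 * w t)%:E).
  move=> mv; apply/measurable_EFinP.
  by apply: measurable_funM => //; exact: measurable_funX.
have vw0 (v : R -> R) t : (0 <= (v t ^+ 2 * w t)%:E)%E by rewrite lee_fin mulr_ge0 ?sqr_ge0.
(* Each of the two tails costs e, and [axis_cells_of_tail] doubles their sum. *)
pose e := eps / 4; have e40 : 0 < e by rewrite divr_gt0.
have -> : eps = 2 * (2 * e) by rewrite /e; lra.
have mge (T : R) : measurable [set t | T <= t].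
  by rewrite (_ : [set t | _] = `[T, +oo[%classic)//;
    apply/seteqP; split => t; rewrite /= in_itv/= andbT.
have mle (T : R) : measurable [set t | T <= - t].
  by rewrite (_ : [set t | _] = `]-oo, - T]%classic)//;
    apply/seteqP; split => t; rewrite /= in_itv/= lerNr.
have X0 (v : R -> R) : (0 <= \int[leb]_t (v t ^+ 2 * w t)%:E)%E by exact: integral_ge0.
have two (x y z : \bar R) : (0 <= z -> x <= e%:E * z -> y <= e%:E * z -> x + y <= (2 * e)%:E * z)%E.
  move=> z0 h1 h2; apply: le_trans (leeD h1 h2) _.
  have e0' : (0 <= e%:E)%E by rewrite lee_fin ltW.
  by rewrite mulr_natl mulr2n EFinD ge0_muleDl.
case: b @w mw w0 mvw vw0 X0 => w mw w0 mvw vw0 X0.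
  have [T T1 HT] := tail_infty c a0 e40; have [d /andP[d0 d1] Hd] := tail_zero hc a0 e40.
  have wpg t : 0 < t -> axis_weight true c a t = pgauss c a t by rewrite /axis_weight => ->.
  (* Adding 1 keeps d < be even if d = T = 1. Below, e^M bounds the ratio of two values of the
     weight on [d, be]. *)
  pose be := T + 1.
  have bd : d < be by rewrite /be; lra.
  pose M := `|c| * (`|ln d| + `|ln be| + 1) + a * be ^+ 2.
  exists d; apply: (@axis_cells_of_tail true c a d be (expR M) (2 * e)) => //.
  - by rewrite mulr_gt0.
  - exact: expR_gt0.
  - by move=> t /andP[h1 _]; rewrite /axis_dom/=; exact: lt_le_trans h1.
  - by move=> t /andP[h1 _]; rewrite wpg ?expR_gt0//; exact: lt_le_trans h1.
  - move=> s t /andP[s1 s2] /andP[t1 t2].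
    have s0 : 0 < s := lt_le_trans d0 s1; have t0 : 0 < t := lt_le_trans d0 t1.
    rewrite !wpg//; apply: pgauss_ratio.
    have h1 : `|ln s - ln t| <= `|ln d| + `|ln be| + 1.
      have b0 : 0 < be := lt_trans d0 bd.
      have q1 : ln d <= ln s by rewrite ler_ln ?posrE.
      have q2 : ln s <= ln be by rewrite ler_ln ?posrE.
      have q3 : ln d <= ln t by rewrite ler_ln ?posrE.
      have q4 : ln t <= ln be by rewrite ler_ln ?posrE.
      have q5 : ln d <= `|ln d| by exact: ler_norm.
      have q6 : - ln d <= `|ln d| by rewrite -normrN ler_norm.
      have q7 : ln be <= `|ln be| by exact: ler_norm.
      have q8 : - ln be <= `|ln be| by rewrite -normrN ler_norm.
      by rewrite ler_norml; apply/andP; split; lra.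
    have := mul_le_norm c h1; rewrite -/M => h2.
    have h3 : t ^+ 2 <= be ^+ 2 by rewrite ler_pXn2r ?nnegrE ?(ltW t0)// (le_trans (ltW t0)).
    have h4 : a * (s ^+ 2 - t ^+ 2) >= a * (- be ^+ 2).
      by rewrite ler_pM2l//; have := sqr_ge0 s; lra.
    by rewrite /M; lra.
  move=> v g mv mg hh.
  apply: le_trans (integral_le_two_sets (A := `]0, d]) (B := [set t | T <= t]) _ _ _ _ _ _) _ => //.
  - by apply: measurableC; exact: measurable_itv.
  - exact: mvw.
  - move=> t; rewrite /= in_itv/= => ht.
    case: (ltP 0 t) => t0; last by constructor 1; rewrite /axis_weight/= ?ltNge ?t0 mulr0.
    case: (leP t d) => td; first by constructor 2; rewrite /= in_itv/= t0.
    constructor 3; rewrite /= leNgt; apply/negP => tT; apply: ht.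
    by rewrite td/= /be; lra.
  apply: two; first by rewrite adde_ge0//; exact: X0.
    by apply: (Hd (axis_dom true)).
  apply: (HT true (axis_dom true)) => //.
    by move=> t t1; rewrite /axis_dom/=; rewrite /signed in t1; lra.
  by move=> t t1; rewrite /signed in t1 *; apply: wpg; lra.
(* In a tangential direction the weight is a pure Gaussian, that is, exponent 0, and both tails are
   at infinity. *)
have [T T1 HT] := tail_infty 0 a0 e40.
exists (- T); apply: (@axis_cells_of_tail false c a (- T) T (expR (a * T ^+ 2)) (2 * e)) => //.
- by rewrite mulr_gt0.
- exact: expR_gt0.
- lra.
- by move=> t _; exact: expR_gt0.
- move=> s t /andP[s1 s2] /andP[t1 t2]; apply: pgauss_ratio.
  have h4 : a * (s ^+ 2 - t ^+ 2) >= a * (- T ^+ 2).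
    by rewrite ler_pM2l//; nra.
  by rewrite mul0r; lra.
move=> v g mv mg hh.
apply: le_trans (integral_le_two_sets (A := [set t | T <= - t]) (B := [set t | T <= t]) _ _ _ _ _ _) _ => //.
- by apply: measurableC; exact: measurable_itv.
- exact: mvw.
- move=> t; rewrite /= in_itv/= => ht.
  case: (leP T t) => tT; first by constructor 3.
  by constructor 2; rewrite /= leNgt; apply/negP => tT'; apply: ht; lra.
apply: two; first by rewrite adde_ge0//; exact: X0.
  apply: (HT false (axis_dom false)) => // t _.
  by rewrite /signed /= /w /axis_weight /pgauss !mul0r sqrrN.
exact: (HT true (axis_dom false)).
Qed.

End directions.

(** * Averaging in every direction *)

Section factored_weight.
Context {R : realType} (N : nat) (c a : R).
Local Notation leb := (@lebesgue_measure R).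
Local Notation lebN n := (@lebesgue_rV R n).
Implicit Types (f : 'rV[R]_N.+1 -> R) (x : 'rV[R]_N) (i : 'I_N.+1).

Definition coord_weight i (t : R) : R := axis_weight (i == ord_max) c a t.

Definition rV_weight (z : 'rV[R]_N.+1) : R := \prod_i coord_weight i (z ord0 i).

Definition cross_weight i (x : 'rV[R]_N) : R :=
  \prod_(j < N) coord_weight (lift i j) (x ord0 j).

Lemma coord_weight_ge0 i t : 0 <= coord_weight i t.
Proof. exact: axis_weight_ge0. Qed.

Lemma measurable_coord_weight i : measurable_fun setT (coord_weight i).
Proof. exact: measurable_axis_weight. Qed.

Lemma rV_weight_ge0 z : 0 <= rV_weight z.
Proof. by apply: prodr_ge0 => i _; exact: coord_weight_ge0. Qed.

Lemma cross_weight_ge0 i x : 0 <= cross_weight i x.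
Proof. by apply: prodr_ge0 => j _; exact: coord_weight_ge0. Qed.

Lemma measurable_rV_weight : measurable_fun setT rV_weight.
Proof.
apply: measurable_prod => i _.
exact: measurableT_comp (measurable_coord_weight i) (measurable_coord_rV i).
Qed.

Lemma measurable_cross_weight i : measurable_fun setT (cross_weight i).
Proof.
apply: measurable_prod => j _.
exact: measurableT_comp (measurable_coord_weight _) (measurable_coord_rV j).
Qed.

Lemma rV_weight_ins i x t :
  rV_weight (ins i (x, t)) = cross_weight i x * coord_weight i t.
Proof.
rewrite /rV_weight (bigD1_ord i)//= insE_at mulrC; congr (_ * _).
by apply: eq_bigr => j _; rewrite insE_lift.
Qed.

(** The normal factor is 0 for y <= 0, which absorbs the restriction to the half-space, and the
    exponential of the sum of squares splits over the coordinates. *)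
Lemma weight_patch : weight c a \_ (half_space N) = rV_weight.
Proof.
apply/funext => z; rewrite patchE /rV_weight; case: ifPn => [|zH]; last first.
  rewrite (bigD1 ord_max)//= /coord_weight eqxx/= ifF ?mul0r//.
  by apply/negbTE; apply: contra zH => z0; rewrite inE.
rewrite inE /half_space/= => z0.
rewrite /weight /powR gt_eqF// mulr_sumr -sumrN expR_sum.
rewrite (bigD1 ord_max)//= [RHS](bigD1 ord_max)//= mulrA; congr (_ * _).
  by rewrite /coord_weight eqxx/= z0 /pgauss expRD.
apply: eq_bigr => i ine; rewrite /coord_weight (negbTE ine)/= /pgauss mul0r add0r//.
Qed.

Lemma integral_weighted_measure (f : 'rV[R]_N.+1 -> \bar R) :
  measurable_fun setT f -> (forall z, 0 <= f z)%E ->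
  (\int[weighted_measure c a]_z f z = \int[lebN N.+1]_z (f z * (rV_weight z)%:E))%E.
Proof.
move=> mf f0; apply: ge0_integral_density => //.
- exact: measurable_rV_weight.
- exact: rV_weight_ge0.
move=> A mA; rewrite -weight_patch.
rewrite [LHS]integral_mkcondr; apply: eq_integral => z _.
by rewrite !patchE; case: ifP.
Qed.

Lemma measurable_line (f : 'rV[R]_N.+1 -> R) i x : measurable_fun setT f ->
  measurable_fun setT (fun t : R => f (ins i (x, t))).
Proof.
move=> mf; apply: measurableT_comp => //; apply: measurable_fun_rV => j.
under eq_fun do rewrite mxE.
by case: (unlift i j) => [k|] /=; [exact: measurable_cst|exact: measurable_id].
Qed.

Section lines.
Variable i : 'I_N.+1.
Local Open Scope ereal_scope.

Lemma integral_lines (f : 'rV[R]_N.+1 -> R) : measurable_fun setT f ->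
  (forall z, 0 <= f z)%R ->
  \int[lebN N.+1]_z (f z * rV_weight z)%:E =
  \int[lebN N]_x ((cross_weight i x)%:E *
     \int[leb]_t (f (ins i (x, t)) * coord_weight i t)%:E).
Proof.
move=> mf f0; rewrite (ge0_integral_lebesgue_rV i); last 2 first.
- by apply/measurable_EFinP; apply: measurable_funM => //; exact: measurable_rV_weight.
- by move=> z; rewrite lee_fin mulr_ge0// rV_weight_ge0.
apply: eq_integral => x _; rewrite -ge0_integralZl//.
- by apply: eq_integral => t _; rewrite rV_weight_ins -EFinM mulrCA.
- apply/measurable_EFinP; apply: measurable_funM; first exact: measurable_line.
  exact: measurable_coord_weight.
- by move=> t _; rewrite lee_fin mulr_ge0// coord_weight_ge0.
- by rewrite lee_fin cross_weight_ge0.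
Qed.

Lemma measurable_integral_lines (f : 'rV[R]_N.+1 -> R) : measurable_fun setT f ->
  (forall z, 0 <= f z)%R ->
  measurable_fun setT (fun x : 'rV[R]_N => ((cross_weight i x)%:E *
     \int[leb]_t (f (ins i (x, t)) * coord_weight i t)%:E)).
Proof.
move=> mf f0; apply: emeasurable_funM.
  by apply/measurable_EFinP; exact: measurable_cross_weight.
apply: (measurable_fun_fubini_tonelli_F (m2 := leb)
  (fun p => (f (ins i p) * coord_weight i p.2)%:E)).
  apply/measurable_EFinP; apply: measurable_funM.
    exact: measurableT_comp mf (measurable_ins i).
  exact: measurableT_comp (measurable_coord_weight i) measurable_snd.
by move=> p; rewrite lee_fin mulr_ge0// coord_weight_ge0.
Qed.

Lemma lines_ge0 (f : 'rV[R]_N.+1 -> R) x : (forall z, 0 <= f z)%R ->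
  0 <= (cross_weight i x)%:E * \int[leb]_t (f (ins i (x, t)) * coord_weight i t)%:E.
Proof.
move=> f0; rewrite mule_ge0 ?lee_fin ?cross_weight_ge0//.
by apply: integral_ge0 => t _; rewrite lee_fin mulr_ge0// coord_weight_ge0.
Qed.

(** A bound on lines is integrated over the lines. Those of zero [cross_weight] contribute nothing,
    so the bound is asked only of lines that meet the half-space. *)
Lemma le_integral_lines (f f1 : 'rV[R]_N.+1 -> R) (K : R) :
  measurable_fun setT f -> (forall z, 0 <= f z)%R ->
  measurable_fun setT f1 -> (forall z, 0 <= f1 z)%R -> (0 <= K)%R ->
  {ae lebN N, forall x : 'rV[R]_N, (0 < cross_weight i x)%R ->
    \int[leb]_t (f (ins i (x, t)) * coord_weight i t)%:E <=
    K%:E * \int[leb]_t (f1 (ins i (x, t)) * coord_weight i t)%:E} ->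
  \int[lebN N.+1]_z (f z * rV_weight z)%:E <=
  K%:E * \int[lebN N.+1]_z (f1 z * rV_weight z)%:E.
Proof.
move=> mf f0 mf1 f10 K0 H; rewrite !integral_lines// -ge0_integralZl//; last 2 first.
- exact: (measurable_integral_lines mf1 f10).
- by move=> x _; exact: lines_ge0.
apply: ae_ge0_le_integral => //.
- by move=> x _; exact: lines_ge0.
- exact: (measurable_integral_lines mf f0).
- by move=> x _; rewrite mule_ge0 ?lines_ge0// lee_fin.
- by apply: emeasurable_funM => //; exact: (measurable_integral_lines mf1 f10).
apply: filterS H => x Hx _; have := cross_weight_ge0 i x.
rewrite le_eqVlt => /orP[/eqP<-|W0]; first by rewrite !mul0e mule0.
by rewrite muleCA lee_pmul2l// Hx.
Qed.

Lemma ae_line_lty (f : 'rV[R]_N.+1 -> R) : measurable_fun setT f ->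
  (forall z, 0 <= f z)%R ->
  \int[lebN N.+1]_z (f z * rV_weight z)%:E < +oo ->
  {ae lebN N, forall x : 'rV[R]_N, (0 < cross_weight i x)%R ->
    \int[leb]_t (f (ins i (x, t)) * coord_weight i t)%:E < +oo}.
Proof.
move=> mf f0; rewrite integral_lines// => foo.
have int : (lebN N).-integrable setT (fun x : 'rV[R]_N => ((cross_weight i x)%:E *
     \int[leb]_t (f (ins i (x, t)) * coord_weight i t)%:E)).
  apply/integrableP; split; first exact: (measurable_integral_lines mf f0).
  by under eq_integral => x _ do rewrite gee0_abs ?lines_ge0//.
apply: filterS (integrable_ae measurableT int) => x /(_ I) + W0.
move=> /fin_numPlt/andP[_].
have : 0 <= \int[leb]_t (f (ins i (x, t)) * coord_weight i t)%:E.
  by apply: integral_ge0 => t _; rewrite lee_fin mulr_ge0// coord_weight_ge0.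
move: (\int[leb]_t _) => [r _ _| _|]; [by rewrite ltry| |by []].
by rewrite gt0_muley ?lte_fin.
Qed.

End lines.
End factored_weight.

Section axis_projection.
Context {R : realType} (N : nat) (c a : R).
Local Notation leb := (@lebesgue_measure R).
Local Notation lebN n := (@lebesgue_rV R n).
Local Notation om := (rV_weight c a).
Local Notation cw := (coord_weight c a).

Definition del (i : 'I_N.+1) (z : 'rV[R]_N.+1) : 'rV[R]_N :=
  \row_j z ord0 (lift i j).

Lemma del_ins i x t : del i (ins i (x, t)) = x.
Proof. by apply/rowP => j; rewrite mxE insE_lift. Qed.

Lemma measurable_del i : measurable_fun setT (del i).
Proof.
apply: measurable_fun_rV => j; under eq_fun do rewrite mxE.
exact: measurable_coord_rV.
Qed.

(* The average over the cells along coordinate i; q = (left end, mesh, number of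
   cells). *)
Definition axis_proj (q : R * R * nat) i (f : 'rV[R]_N.+1 -> R) (z : 'rV[R]_N.+1) : R :=
  cell_proj (cw i) q.1.1 q.1.2 q.2 (fun t => f (ins i (del i z, t))) (z ord0 i).

Lemma axis_proj_ins q i f x t : axis_proj q i f (ins i (x, t)) =
  cell_proj (cw i) q.1.1 q.1.2 q.2 (fun s => f (ins i (x, s))) t.
Proof. by rewrite /axis_proj del_ins insE_at. Qed.

Lemma measurable_axis_proj q i f : measurable_fun setT f ->
  measurable_fun setT (axis_proj q i f).
Proof.
move=> mf; apply: measurable_sum => k.
pose I := cell q.1.1 q.1.2 k.
have mI : measurable I by exact: measurable_cell.
apply: measurable_funM.
  exact: measurableT_comp (measurable_indic mI) (measurable_coord_rV i).
apply: (measurableT_comp (f := fun x => cell_mean (cw i) I (fun t => f (ins i (x, t)))));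
  last exact: measurable_del.
apply: measurable_funM => //.
pose K (p : 'rV[R]_N * measurableTypeR R) : \bar R :=
  (f (ins i p) * cw i p.2 * \1_I p.2)%:E.
have mK : measurable_fun setT K.
  apply/measurable_EFinP; apply: measurable_funM.
    apply: measurable_funM; first exact: measurableT_comp mf (measurable_ins i).
    exact: measurableT_comp (measurable_coord_weight c a i) measurable_snd.
  exact: measurableT_comp (measurable_indic mI) measurable_snd.
(* Measurability in x of a section integral comes from Tonelli for nonnegative functions, hence the
   split into positive and negative parts. *)
have KE x : (\int[leb]_(t in I) (f (ins i (x, t)) * cw i t)%:E =
    \int[leb]_t K^\+ (x, t) - \int[leb]_t K^\- (x, t))%E.
  have E : (fun t => (f (ins i (x, t)) * cw i t)%:E) \_ I = (fun t => K (x, t)).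
    by apply/funext => t; rewrite /K/= patchE indicE; case: ifP; rewrite ?mulr1 ?mulr0.
  rewrite integral_mkcond E integralE.
  by congr (_ - _)%E; apply: eq_integral => t _; rewrite ?funeposE ?funenegE.
under eq_fun do rewrite KE.
apply: measurableT_comp => //.
apply: emeasurable_funB.
  apply: (measurable_fun_fubini_tonelli_F (m2 := leb) (fun p => K^\+ p)%E) => [|p].
    exact: measurable_funepos.
  by rewrite funeposE le_max lexx orbT.
apply: (measurable_fun_fubini_tonelli_F (m2 := leb) (fun p => K^\- p)%E) => [|p].
  exact: measurable_funeneg.
by rewrite funenegE le_max lexx orbT.
Qed.

(** The squared L^2_mu norm of a plain function, infinite values allowed; the half-space enters
    through [rV_weight]. *)
Definition energy (f : 'rV[R]_N.+1 -> R) : \bar R :=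
  (\int[lebN N.+1]_z (f z ^+ 2 * om z)%:E)%E.

Lemma energy_ge0 f : (0 <= energy f)%E.
Proof. by apply: integral_ge0 => z _; rewrite lee_fin mulr_ge0 ?sqr_ge0 ?rV_weight_ge0. Qed.

Section fixed_axis.
Variables (q : R * R * nat) (i : 'I_N.+1).
Hypothesis h0 : 0 < q.1.2.
Hypothesis hw : forall k, (k < q.2)%N ->
  (0 < \int[leb]_(t in cell q.1.1 q.1.2 k) (cw i t)%:E < +oo)%E.
Local Notation P := (axis_proj q i).

Let mX2 (f : 'rV[R]_N.+1 -> R) : measurable_fun setT f ->
  measurable_fun setT (fun z => f z ^+ 2).
Proof. exact: measurable_funX. Qed.

(** Contraction for differences is a separate statement because the subtraction rule for [axis_proj]
    is available on lines where both functions have finite energy, hence on almost every line of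
    positive cross weight. *)
Lemma energy_axis_proj_sub f f1 : measurable_fun setT f -> measurable_fun setT f1 ->
  (energy f < +oo -> energy f1 < +oo -> energy (P f \- P f1)%R <= energy (f \- f1)%R)%E.
Proof.
move=> mf mf1 foo f1oo; rewrite -[leRHS]mul1e.
apply: (le_integral_lines (i := i) (f := fun z => (P f \- P f1) z ^+ 2)
  (f1 := fun z => (f \- f1) z ^+ 2)) => //.
- by apply: mX2; apply: measurable_funB; exact: measurable_axis_proj.
- by move=> z; exact: sqr_ge0.
- by apply: mX2; exact: measurable_funB.
- by move=> z; exact: sqr_ge0.
have H1 := ae_line_lty i (mX2 mf) (fun z => sqr_ge0 (f z)) foo.
have H2 := ae_line_lty i (mX2 mf1) (fun z => sqr_ge0 (f1 z)) f1oo.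
apply: filterS2 H1 H2 => x H1 H2 W0; rewrite mul1e.
have mv := measurable_line i x mf; have mv1 := measurable_line i x mf1.
apply: le_trans (cell_proj_contract (measurable_coord_weight c a i)
  (coord_weight_ge0 c a i) h0 hw (measurable_funB mv mv1)).
rewrite le_eqVlt; apply/orP; left; apply/eqP; apply: eq_integral => t _.
rewrite /= !axis_proj_ins (cell_proj_sub (measurable_coord_weight c a i)
  (coord_weight_ge0 c a i) hw t mv mv1)//; [exact: H1|exact: H2].
Qed.

Lemma energy_axis_proj f : measurable_fun setT f -> (energy (P f) <= energy f)%E.
Proof.
move=> mf; rewrite -[leRHS]mul1e.
apply: (le_integral_lines (i := i) (f := fun z => P f z ^+ 2)
  (f1 := fun z => f z ^+ 2)) => //.
- by apply: mX2; exact: measurable_axis_proj.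
- by move=> z; exact: sqr_ge0.
- exact: mX2.
- by move=> z; exact: sqr_ge0.
apply: nearW => x _; rewrite mul1e.
have mv := measurable_line i x mf.
apply: le_trans (cell_proj_contract (measurable_coord_weight c a i)
  (coord_weight_ge0 c a i) h0 hw mv).
rewrite le_eqVlt; apply/orP; left; apply/eqP; apply: eq_integral => t _.
by rewrite /= axis_proj_ins.
Qed.

Lemma energy_axis_proj_error eps f g : 0 <= eps ->
  measurable_fun setT f -> measurable_fun setT g ->
  (forall v g : R -> R, measurable_fun setT v -> measurable_fun setT g ->
      half_holder (axis_dom (i == ord_max)) v g ->
      (\int[leb]_t (v t ^+ 2 * cw i t)%:E < +oo)%E ->
      (\int[leb]_t ((v t - cell_proj (cw i) q.1.1 q.1.2 q.2 v t) ^+ 2 * cw i t)%:E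
       <= eps%:E * (\int[leb]_t (v t ^+ 2 * cw i t)%:E +
        \int[leb]_t (g t ^+ 2 * cw i t)%:E))%E) ->
  {ae lebN N, forall x : 'rV[R]_N, half_holder [set t | half_space N (ins i (x, t))]
    (fun t => f (ins i (x, t))) (fun t => g (ins i (x, t)))} ->
  (energy f < +oo -> energy (f \- P f)%R <= eps%:E * (energy f + energy g))%E.
Proof.
move=> e0 mf mg est hh foo.
have X0 (u : 'rV[R]_N.+1 -> R) z : (0 <= (u z ^+ 2 * om z)%:E)%E.
  by rewrite lee_fin mulr_ge0 ?sqr_ge0 ?rV_weight_ge0.
have mX (u : 'rV[R]_N.+1 -> R) : measurable_fun setT u ->
    measurable_fun setT (fun z => (u z ^+ 2 * om z)%:E).
  move=> mu; apply/measurable_EFinP; apply: measurable_funM; first exact: mX2.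
  exact: measurable_rV_weight.
have -> : (energy f + energy g = \int[lebN N.+1]_z ((f z ^+ 2 + g z ^+ 2) * om z)%:E)%E.
  rewrite /energy -ge0_integralD//; [|exact: mX|exact: mX].
  by apply: eq_integral => z _; rewrite -EFinD -mulrDl.
apply: (le_integral_lines (i := i) (f := fun z => (f \- P f) z ^+ 2)
  (f1 := fun z => f z ^+ 2 + g z ^+ 2)) => //.
- by apply: mX2; apply: measurable_funB => //; exact: measurable_axis_proj.
- by move=> z; exact: sqr_ge0.
- by apply: measurable_funD; exact: mX2.
- by move=> z; rewrite addr_ge0 ?sqr_ge0.
have H1 := ae_line_lty i (mX2 mf) (fun z => sqr_ge0 (f z)) foo.
apply: filterS2 H1 hh => x H1 [E NE HE] W0.
have mv := measurable_line i x mf; have mg' := measurable_line i x mg.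
(* On a line of positive cross weight the half-space is everything in a tangential direction and t >
   0 in the normal one, which is [axis_dom]. *)
have hx : half_holder (axis_dom (i == ord_max)) (fun t => f (ins i (x, t)))
    (fun t => g (ins i (x, t))).
  exists E => // p q' s t pqJ; apply: HE => r /pqJ; rewrite /axis_dom /half_space/=.
  case: (unliftP i ord_max) => [k ik _|<-]; last by rewrite eqxx insE_at.
  rewrite ik insE_lift; move: W0; rewrite /cross_weight (bigD1 k)//= -ik /coord_weight eqxx.
  rewrite /axis_weight; case: ifP => // _; rewrite mul0r ltxx//.
have PE t : (f \- P f) (ins i (x, t)) = f (ins i (x, t)) -
    cell_proj (cw i) q.1.1 q.1.2 q.2 (fun s => f (ins i (x, s))) t.
  by rewrite /= axis_proj_ins.
under eq_integral => t _ do rewrite PE.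
under [X in (_ <= _ * X)%E]eq_integral => t _ do rewrite mulrDl EFinD.
rewrite ge0_integralD//; first exact: (est _ _ mv mg' hx (H1 W0)).
- by move=> t _; rewrite lee_fin mulr_ge0 ?sqr_ge0 ?coord_weight_ge0.
- apply/measurable_EFinP; apply: measurable_funM; first exact: measurable_funX.
  exact: measurable_coord_weight.
- by move=> t _; rewrite lee_fin mulr_ge0 ?sqr_ge0 ?coord_weight_ge0.
- apply/measurable_EFinP; apply: measurable_funM; first exact: measurable_funX.
  exact: measurable_coord_weight.
Qed.

End fixed_axis.
End axis_projection.

(** Each coordinate, shifted by B to be nonnegative, is rounded down to a multiple of d; this leaves
    finitely many values. *)
Lemma finite_class_of_bounded {R : realType} (K : finType) (X : Type)
    (beta : X -> K -> R) (B d : R) : 0 < d ->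
  (forall x k, `|beta x k| <= B) ->
  exists (T : finType) (cl : X -> T), forall x y, cl x = cl y ->
    forall k, `|beta x k - beta y k| <= d.
Proof.
move=> d0 hB; pose M := Num.truncn (2 * B / d).
pose cl x : {ffun K -> 'I_M.+1} := [ffun k => inord (Num.truncn ((beta x k + B) / d))].
exists {ffun K -> 'I_M.+1}, cl => x y exy k.
have bd z : 0 <= (beta z k + B) / d /\ (Num.truncn ((beta z k + B) / d) < M.+1)%N.
  have := hB z k; rewrite ler_norml => /andP[h1 h2].
  have p : 0 <= (beta z k + B) / d by apply: divr_ge0; [lra|exact: ltW].
  split => //; rewrite ltnS; apply: le_truncn; rewrite ler_pM2r ?invr_gt0//; lra.
have [px tx] := bd x; have [py ty] := bd y.
have : Num.truncn ((beta x k + B) / d) = Num.truncn ((beta y k + B) / d).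
  by move/ffunP : exy => /(_ k); rewrite !ffunE => /(congr1 val); rewrite /= !inordK.
have /andP[] := truncn_itv px; have /andP[] := truncn_itv py.
move: (Num.truncn _) (Num.truncn _) => n1 n2 a1 a2 b1 b2 e; subst n2.
rewrite ler_pdivlMr// in a1; rewrite ltr_pdivrMr// in a2.
rewrite ler_pdivlMr// in b1; rewrite ltr_pdivrMr// in b2.
move: a2 b2; rewrite -natr1 => a2 b2.
by rewrite ler_norml; apply/andP; split; lra.
Qed.

Section box_projection.
Context {R : realType} (N : nat) (c a : R).
Local Notation leb := (@lebesgue_measure R).
Local Notation lebN n := (@lebesgue_rV R n).
Local Notation om := (rV_weight c a).
Local Notation cw := (coord_weight c a).
Local Notation E := (@energy R N c a).
Implicit Types f g h u : 'rV[R]_N.+1 -> R.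

Let mE f : measurable_fun setT f -> measurable_fun setT (fun z => (f z ^+ 2 * om z)%:E).
Proof.
move=> mf; apply/measurable_EFinP; apply: measurable_funM; first exact: measurable_funX.
exact: measurable_rV_weight.
Qed.

Lemma energy_triangle f g h :
  measurable_fun setT f -> measurable_fun setT g -> measurable_fun setT h ->
  (E (f \- h)%R <= 2%:E * E (f \- g)%R + 2%:E * E (g \- h)%R)%E.
Proof.
move=> mf mg mh.
have p0 u z : (0 <= (u z ^+ 2 * om z)%:E)%E by rewrite lee_fin mulr_ge0 ?sqr_ge0 ?rV_weight_ge0.
have mfg := mE (measurable_funB mf mg); have mgh := mE (measurable_funB mg mh).
rewrite /energy -!ge0_integralZl// -ge0_integralD//; last 4 first.
- by move=> z _; rewrite mule_ge0.
- by apply: emeasurable_funM.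
- by move=> z _; rewrite mule_ge0.
- by apply: emeasurable_funM.
apply: ge0_le_integral => //.
- by apply: mE; exact: measurable_funB.
- by apply: emeasurable_funD; exact: emeasurable_funM.
move=> z _; rewrite -!EFinM -EFinD lee_fin /= !mulrA -mulrDl ler_wpM2r ?rV_weight_ge0//.
have := sqr_ge0 ((f z - g z) - (g z - h z)); nra.
Qed.

Lemma energy_sym f g : E (f \- g) = E (g \- f).
Proof. by apply: eq_integral => z _ /=; rewrite -sqrrN opprB. Qed.

Variable q : 'I_N.+1 -> R * R * nat.
Hypothesis h0 : forall i, 0 < (q i).1.2.
Hypothesis hw : forall i k, (k < (q i).2)%N ->
  (0 < \int[leb]_(t in cell (q i).1.1 (q i).1.2 k) (cw i t)%:E < +oo)%E.
Local Notation P i := (axis_proj c a (q i) i).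

Definition box_proj (s : seq 'I_N.+1) f := foldr (fun i g => P i g) f s.

Lemma measurable_box_proj s f : measurable_fun setT f -> measurable_fun setT (box_proj s f).
Proof. by move=> mf; elim: s => //= i s IH; exact: measurable_axis_proj. Qed.

Lemma energy_box_proj s f : measurable_fun setT f -> (E (box_proj s f) <= E f)%E.
Proof.
move=> mf; elim: s => //= i s IH; apply: le_trans IH.
by apply: energy_axis_proj => //; [exact: hw|exact: measurable_box_proj].
Qed.

(* The constant solves a_(n+1) = 2 + 2 a_n, a_0 = 0. *)
Lemma energy_box_proj_error s u (e : R) : 0 <= e -> measurable_fun setT u ->
  (E u < +oo)%E -> (forall i, (E (u \- P i u)%R <= e%:E)%E) ->
  (E (u \- box_proj s u)%R <= ((2 ^+ (size s).+1 - 2) * e)%:E)%E.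
Proof.
move=> e0 mu uoo He; elim: s => [|i s IH].
  rewrite expr1 subrr mul0r /energy/= integral0_eq// => z _.
  by rewrite /= subrr expr0n mul0r.
have mS := measurable_box_proj s mu.
have Soo : (E (box_proj s u) < +oo)%E := le_lt_trans (energy_box_proj s mu) uoo.
(* The middle point P_i u leaves u - P_i u, small by assumption, and P_i applied to u minus its
   average over s, where contraction and induction apply. *)
apply: le_trans (energy_triangle (g := P i u) mu _ _) _.
- exact: measurable_axis_proj.
- exact: measurable_axis_proj.
have h := le_trans (energy_axis_proj_sub (h0 i) (@hw i) mu mS uoo Soo) IH.
have -> : (2 ^+ (size (i :: s)).+1 - 2) * e = 2 * e + 2 * ((2 ^+ (size s).+1 - 2) * e).
  by rewrite /= exprS; ring.
rewrite [leRHS]EFinD [X in (_ <= X + _)%E](EFinM 2) [X in (_ <= _ + X)%E](EFinM 2).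
by apply: leeD; apply: lee_wpmul2l.
Qed.

Let insE i (z : 'rV[R]_N.+1) (t : R) j :
  ins i (del i z, t) ord0 j = if j == i then t else z ord0 j.
Proof.
by rewrite mxE; case: unliftP => [k ->|->]/=; rewrite ?eqxx ?mxE// eq_sym (negPf (neq_lift _ _)).
Qed.

Let cl i k (t : R) : bool := t \in cell (q i).1.1 (q i).1.2 k.

(** The outermost average replaces coordinate i by the integration variable, so that this coordinate
    enters only through the cell indicators; the others are left to the induction hypothesis. *)
Lemma box_proj_cells (s : seq 'I_N.+1) u (z z' : 'rV[R]_N.+1) :
  (forall i k, i \in s -> (k < (q i).2)%N -> cl i k (z ord0 i) = cl i k (z' ord0 i)) ->
  (forall i, i \notin s -> z ord0 i = z' ord0 i) ->
  box_proj s u z = box_proj s u z'.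
Proof.
elim: s z z' => [|i s IH] z z' H1 H2 /=.
  by congr u; apply/rowP => j; exact: H2.
rewrite /axis_proj /cell_proj; apply: eq_bigr => k _.
have := H1 i k (mem_head _ _) (ltn_ord k); rewrite /cl !indicE => ->.
congr (_ * cell_mean _ _ _); apply/funext => t; apply: IH => j.
  move=> l js lj; rewrite !insE; case: eqP => // _.
  by apply: H1 => //; rewrite inE js orbT.
by move=> js; rewrite !insE; case: eqP => // /eqP ji; apply: H2; rewrite inE negb_or ji.
Qed.

(** A common bound on the numbers of cells gives one finite index type for all directions. *)
Let M := \max_i (q i).2.

(* Which cells contain z: the averages in all directions factor through this. *)
Definition pattern (z : 'rV[R]_N.+1) : {ffun 'I_N.+1 * 'I_M -> bool} :=
  [ffun p : 'I_N.+1 * 'I_M => cl p.1 p.2 (z ord0 p.1)].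

Let S u := box_proj (enum 'I_N.+1) u.

(** The value of the average on a pattern, read at any point that has it; the default point 0 serves
    the patterns that no point has. *)
Let coef u (k : {ffun 'I_N.+1 * 'I_M -> bool}) : R :=
  S u (xget (0 : 'rV[R]_N.+1) [set z | pattern z = k]).

Let S_coef u z : S u z = coef u (pattern z).
Proof.
rewrite /coef; case: xgetP => [z' _ /= pz|/(_ z)]; last by move=> /(_ erefl).
apply: box_proj_cells => [i k _ ki|i]; last by rewrite mem_enum.
have kM : (k < M)%N by apply: (leq_trans ki); exact: leq_bigmax.
by move/ffunP : pz => /(_ (i, Ordinal kM)); rewrite !ffunE.
Qed.

Let mpat k : measurable [set z | pattern z = k].
Proof.
rewrite (_ : [set z | _] = \bigcap_(p in [set: 'I_N.+1 * 'I_M])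
    ((fun z : 'rV[R]_N.+1 => z ord0 p.1) @^-1`
      (if k p then cell (q p.1).1.1 (q p.1).1.2 p.2
       else ~` cell (q p.1).1.1 (q p.1).1.2 p.2))).
  apply: fin_bigcap_measurable => // p _.
  rewrite -[X in measurable X]setTI; apply: measurable_coord_rV => //.
  by case: (k p); [exact: measurable_cell|apply: measurableC; exact: measurable_cell].
apply/seteqP; split => z /=.
  move=> <- p _ /=; rewrite ffunE /cl /=.
  by case: ifPn; [rewrite inE|rewrite notin_setE].
move=> H; apply/ffunP => p; rewrite ffunE /cl; have /= := H p I.
by case: (k p) => Hz; [rewrite mem_set|rewrite memNset].
Qed.

Let mass k : \bar R := (\int[lebN N.+1]_z (\1_[set z | pattern z = k] z * om z)%:E)%E.

Let mass_ge0 k : (0 <= mass k)%E.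
Proof. by apply: integral_ge0 => z _; rewrite lee_fin mulr_ge0 ?rV_weight_ge0. Qed.

Let energy_pattern (b : {ffun 'I_N.+1 * 'I_M -> bool} -> R) :
  E (b \o pattern) = (\sum_k ((b k) ^+ 2)%:E * mass k)%E.
Proof.
have mI k : measurable_fun setT (fun z => (\1_[set z | pattern z = k] z * om z)%:E).
  apply/measurable_EFinP; apply: measurable_funM; last exact: measurable_rV_weight.
  exact: measurable_indic (mpat k).
have I0 k z : (0 <= (\1_[set z | pattern z = k] z * om z)%:E)%E.
  by rewrite lee_fin mulr_ge0 ?rV_weight_ge0.
transitivity (\int[lebN N.+1]_z (\sum_k ((b k) ^+ 2)%:E * (\1_[set z | pattern z = k] z * om z)%:E))%E.
  apply: eq_integral => z _; rewrite (bigD1 (pattern z))//= indicE mem_set// mul1r -EFinM.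
  rewrite big1 ?adde0// => k kz; rewrite indicE memNset ?mul0r ?mule0//= => pz.
  by rewrite pz eqxx in kz.
rewrite ge0_integral_sum//.
- by apply: eq_bigr => k _; rewrite ge0_integralZl// lee_fin sqr_ge0.
- by move=> k; apply: emeasurable_funM.
- by move=> k z _; rewrite mule_ge0// lee_fin sqr_ge0.
Qed.

(** The energy of an average is the sum over patterns of the squares of the numbers [beta], all
    bounded by sqrt(B); rounding them gives finitely many classes. *)
Lemma box_proj_finite_classes (X : Type) (u : X -> 'rV[R]_N.+1 -> R) (B d : R) :
  0 < d -> (forall x, measurable_fun setT (u x)) -> (forall x, (E (u x) <= B%:E)%E) ->
  exists (T : finType) (cls : X -> T), forall x y, cls x = cls y ->
    (E (box_proj (enum 'I_N.+1) (u x) \- box_proj (enum 'I_N.+1) (u y))%R <= d%:E)%E.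
Proof.
move=> d0 mu uB.
have SB x : (\sum_k ((coef (u x) k) ^+ 2)%:E * mass k <= B%:E)%E.
  rewrite -energy_pattern; apply: le_trans (uB x).
  rewrite (_ : _ \o _ = S (u x)); first exact: energy_box_proj.
  by apply/funext => z /=; rewrite S_coef.
have kB x k : (((coef (u x) k) ^+ 2)%:E * mass k <= B%:E)%E.
  apply: le_trans (SB x); rewrite (bigD1 k)//= leeDl// sume_ge0// => j _.
  by rewrite mule_ge0// lee_fin sqr_ge0.
(* If a pattern has infinite mass, finite energy forces the coefficient to be 0, so that [fine]
   giving 0 there is harmless. *)
pose beta x k := coef (u x) k * Num.sqrt (fine (mass k)).
have beta2 x y k : (((coef (u x) k - coef (u y) k) ^+ 2)%:E * mass k =
    ((beta x k - beta y k) ^+ 2)%:E)%E.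
  rewrite /beta; have := kB x k; have := kB y k; have := mass_ge0 k.
  move: (mass k) => [m| |]//=.
    by rewrite lee_fin => m0 _ _; rewrite -mulrBl exprMn sqr_sqrtr// EFinM.
  have co z : (((coef (u z) k) ^+ 2)%:E * +oo <= B%:E)%E -> coef (u z) k = 0.
    move=> h; apply/eqP; rewrite -sqrf_eq0; apply/eqP; apply: le_anti; rewrite sqr_ge0 andbT.
    rewrite leNgt; apply/negP => c0; move: h; by rewrite gt0_muley ?lte_fin.
  by move=> _ /co -> /co ->; rewrite !mul0r subrr expr0n/= mul0e.
have bB x k : `|beta x k| <= Num.sqrt B.
  rewrite -sqrtr_sqr; apply: ler_wsqrtr; rewrite -lee_fin; apply: le_trans (kB x k).
  rewrite /beta; have := kB x k; have := mass_ge0 k.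
  move: (mass k) => [m| |]//=.
    by rewrite lee_fin => m0 _; rewrite exprMn sqr_sqrtr// EFinM.
  by move=> _ _; rewrite sqrtr0 mulr0 expr0n mule_ge0// lee_fin sqr_ge0.
(* There are n patterns and each may contribute d / (n + 1). *)
pose n : R := #|{ffun 'I_N.+1 * 'I_M -> bool}|%:R.
have n1 : 0 < n + 1 by rewrite ltr_wpDl.
have dn : 0 < d / (n + 1) by rewrite divr_gt0.
have sd0 : 0 < Num.sqrt (d / (n + 1)) by rewrite sqrtr_gt0.
have [T [cls Hcls]] := finite_class_of_bounded sd0 bB.
exists T, cls => x y /Hcls H.
rewrite (_ : (_ \- _)%R = (fun k => coef (u x) k - coef (u y) k) \o pattern); last first.
  by apply/funext => z /=; rewrite -!S_coef.
rewrite energy_pattern; under eq_bigr do rewrite beta2.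
rewrite sumEFin lee_fin.
apply: (@le_trans _ _ (\sum_(k : {ffun 'I_N.+1 * 'I_M -> bool}) (d / (n + 1)))).
  apply: ler_sum => k _; rewrite -[leRHS]sqr_sqrtr ?(ltW dn)//.
  by rewrite -[leLHS]real_normK ?num_real// ler_pXn2r ?nnegrE// ltW.
rewrite sumr_const -mulr_natl -/n mulrA mulrAC ler_piMl ?(ltW d0)//.
by rewrite ler_pdivrMr// mul1r lerDl.
Qed.

End box_projection.

Section finite_classes.
Context {R : realType} (N : nat) (c a : R) (hc : 0 < c + 1) (a0 : 0 < a).
Local Notation leb := (@lebesgue_measure R).
Local Notation lebN n := (@lebesgue_rV R n).
Local Notation E := (@energy R N c a).

Lemma energy_finite_classes (X : Type) (u : X -> 'rV[R]_N.+1 -> R)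
    (g : X -> 'I_N.+1 -> 'rV[R]_N.+1 -> R) (B eps : R) :
  0 < B -> 0 < eps ->
  (forall x, measurable_fun setT (u x)) ->
  (forall x i, measurable_fun setT (g x i)) ->
  (forall x, E (u x) <= B%:E)%E -> (forall x i, E (g x i) <= B%:E)%E ->
  (forall x i, {ae lebN N, forall y : 'rV[R]_N,
    half_holder [set t | half_space N (ins i (y, t))]
      (fun t => u x (ins i (y, t))) (fun t => g x i (ins i (y, t)))}) ->
  exists (T : finType) (cls : X -> T), forall x y, cls x = cls y ->
    (E (u x \- u y)%R <= eps%:E)%E.
Proof.
move=> B0 eps0 mu mg uB gB hh.
(* K exceeds the factor 2^(N+2) - 2 of [energy_box_proj_error] for N + 1 directions, so errors e1 in
   each direction give at most eps / 12 in all. A direction costs e2 (B + B) = e1. With eps / 8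
   between averages of one class, two triangle inequalities give 2 eps/12 + 2 (2 eps/8 + 2 eps/12) =
   eps. *)
pose K : R := 2 ^+ N.+2.
have K0 : 0 < K by rewrite exprn_gt0.
pose e1 := eps / (12 * K); have e10 : 0 < e1 by rewrite divr_gt0// mulr_gt0.
pose e2 := e1 / (2 * B); have e20 : 0 < e2 by rewrite divr_gt0// mulr_gt0.
have cells : forall i : 'I_N.+1, exists q : R * R * nat, [/\ 0 < q.1.2,
    forall k, (k < q.2)%N ->
      (0 < \int[leb]_(t in cell q.1.1 q.1.2 k) (coord_weight c a i t)%:E < +oo)%E &
    forall v w : R -> R, measurable_fun setT v -> measurable_fun setT w ->
      half_holder (axis_dom (i == ord_max)) v w ->
      (\int[leb]_t (v t ^+ 2 * coord_weight c a i t)%:E < +oo)%E ->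
      (\int[leb]_t ((v t - cell_proj (coord_weight c a i) q.1.1 q.1.2 q.2 v t) ^+ 2 *
         coord_weight c a i t)%:E
       <= e2%:E * (\int[leb]_t (v t ^+ 2 * coord_weight c a i t)%:E +
        \int[leb]_t (w t ^+ 2 * coord_weight c a i t)%:E))%E].
  move=> i; have [al [h [m H]]] := @axis_cells R (i == ord_max) c a e2 hc a0 e20.
  by exists (al, h, m).
have [q Hq] := choice cells.
have h0 i : 0 < (q i).1.2 by case: (Hq i).
have hw i : forall k, (k < (q i).2)%N ->
   (0 < \int[leb]_(t in cell (q i).1.1 (q i).1.2 k) (coord_weight c a i t)%:E < +oo)%E.
  by case: (Hq i).
have uoo x : (E (u x) < +oo)%E := le_lt_trans (uB x) (ltry _).
have err1 x i : (E (u x \- axis_proj c a (q i) i (u x))%R <= e1%:E)%E.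
  have [_ _ est] := Hq i.
  apply: le_trans (energy_axis_proj_error (ltW e20) (mu x) (mg x i) est (hh x i) (uoo x)) _.
  have -> : e1 = e2 * (B + B).
    by rewrite /e2; field; rewrite gt_eqF.
  by rewrite [leRHS]EFinM lee_wpmul2l ?lee_fin ?(ltW e20)// EFinD leeD.
have [T [cls Hcls]] := box_proj_finite_classes h0 hw (d := eps / 8)
  ltac:(by rewrite divr_gt0) mu uB.
exists T, cls => x y /Hcls H.
set S := box_proj _ _ _ _ in H.
have mS z : measurable_fun setT (S (u z)) by exact: measurable_box_proj.
have err z : (E (u z \- S (u z))%R <= (eps / 12)%:E)%E.
  apply: le_trans (energy_box_proj_error h0 hw (enum 'I_N.+1) (ltW e10) (mu z) (uoo z) (err1 z)) _.
  rewrite size_enum_ord lee_fin -/K /e1.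
  have -> : eps / 12 = K * (eps / (12 * K)) by field; rewrite gt_eqF.
  by rewrite ler_wpM2r ?ltW//; lra.
apply: le_trans (energy_triangle _ _ (mu x) (mS x) (mu y)) _.
apply: (@le_trans _ _ (2%:E * (eps / 12)%:E +
  2%:E * (2%:E * (eps / 8)%:E + 2%:E * (eps / 12)%:E))%E).
  apply: leeD; apply: lee_wpmul2l => //.
  apply: le_trans (energy_triangle _ _ (mS x) (mS y) (mu y)) _.
  apply: leeD; apply: lee_wpmul2l => //.
  by rewrite energy_sym.
rewrite -!(EFinM, EFinD) lee_fin; lra.
Qed.

Lemma axis_weight_lower_bound (b : bool) (P Q : R) : (b -> 0 < P) ->
  exists2 k : R, 0 < k & forall t, P <= t <= Q -> k <= axis_weight b c a t.
Proof.
case: b => [/(_ isT) P0|_].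
  exists (expR (- (`|c| * (`|ln P| + `|ln Q|) + a * (P ^+ 2 + Q ^+ 2)))); first exact: expR_gt0.
  move=> t /andP[t1 t2]; have t0 : 0 < t := lt_le_trans P0 t1.
  rewrite /axis_weight t0 ler_expR.
  have h1 : `|ln t| <= `|ln P| + `|ln Q|.
    have q1 : ln P <= ln t by rewrite ler_ln ?posrE.
    have q2 : ln t <= ln Q by rewrite ler_ln ?posrE// (lt_le_trans P0)// (le_trans t1).
    have q3 := ler_norm (ln Q); have q4 := normr_ge0 (ln P); have q5 := normr_ge0 (ln Q).
    have q6 : - ln P <= `|ln P| by rewrite -normrN ler_norm.
    by rewrite ler_norml; apply/andP; split; lra.
  have h2 := mul_le_norm (- c) h1; rewrite normrN in h2.
  have h3 : a * t ^+ 2 <= a * (P ^+ 2 + Q ^+ 2) by rewrite ler_pM2l//; nra.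
  by lra.
exists (expR (- (a * (P ^+ 2 + Q ^+ 2)))); first exact: expR_gt0.
move=> t /andP[t1 t2]; rewrite /axis_weight /pgauss mul0r add0r ler_expR lerN2.
rewrite ler_pM2l//; case: (leP 0 t) => t0; nra.
Qed.

Lemma rV_weight_lower_bound (P Q : 'I_N.+1 -> R) : 0 < P ord_max ->
  exists2 k : R, 0 < k & forall z, cbox P Q z -> k <= rV_weight c a z.
Proof.
move=> P0.
have bounds : forall i : 'I_N.+1, exists k : R, 0 < k /\
    forall t, P i <= t <= Q i -> k <= coord_weight c a i t.
  move=> i; have [|k k0 Hk] := @axis_weight_lower_bound (i == ord_max) (P i) (Q i); last by exists k.
  by move/eqP->.
have [k Hk] := choice bounds.
exists (\prod_i k i); first by apply: prodr_gt0 => i _; case: (Hk i).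
move=> z zI; apply: ler_prod => i _; have [k0 H] := Hk i.
rewrite ltW//=; apply: H.
by have := zI i; rewrite /= in_itv.
Qed.

(** On a closed box inside the half-space the weight is at least some k > 0, so |u| <= 1 + u^2 <= 1
    + u^2 w / k, and the box has finite measure. *)
Lemma integrable_cbox (u : 'rV[R]_N.+1 -> R) (P Q : 'I_N.+1 -> R) :
  0 < P ord_max -> measurable_fun setT u -> (E u < +oo)%E ->
  (lebN N.+1).-integrable (cbox P Q) (EFin \o u).
Proof.
move=> P0 mu uoo; have [k k0 Hk] := @rV_weight_lower_bound P Q P0.
have mB : measurable (cbox P Q).
  by apply: measurable_rV_box => i; exact: measurable_itv.
have p0 z : 0 <= k^-1 * (u z ^+ 2 * rV_weight c a z).
  by rewrite mulr_ge0 ?invr_ge0 ?(ltW k0)// mulr_ge0 ?sqr_ge0 ?rV_weight_ge0.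
have m1 : measurable_fun setT (fun z => (k^-1 * (u z ^+ 2 * rV_weight c a z))%:E).
  apply/measurable_EFinP; apply: measurable_funM => //; apply: measurable_funM.
    exact: measurable_funX.
  exact: measurable_rV_weight.
apply/integrableP; split; first by apply: measurable_funTS; exact/measurable_EFinP.
apply: (@le_lt_trans _ _ (\int[lebN N.+1]_(z in cbox P Q)
  (1 + (k^-1 * (u z ^+ 2 * rV_weight c a z))%:E))%E).
  apply: ge0_le_integral => //.
  - by apply: measurableT_comp => //; apply: measurable_funTS; exact/measurable_EFinP.
  - by apply: emeasurable_funD => //; exact: measurable_funTS m1.
  move=> z zB; rewrite /= -EFinD lee_fin mulrCA.
  have h1 : 1 <= k^-1 * rV_weight c a z by rewrite ler_pdivlMl// mulr1 Hk.
  apply: (@le_trans _ _ (1 + u z ^+ 2)).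
    have := sqr_ge0 (`|u z| - 1); rewrite -(real_normK (num_real (u z))).
    by have := normr_ge0 (u z); nra.
  by rewrite lerD2l ler_peMr ?sqr_ge0.
rewrite ge0_integralD//; last 2 first.
- by move=> z _; rewrite lee_fin.
- exact: (measurable_funTS m1).
apply: lte_add_pinfty.
  rewrite integral_cst// mul1e.
  rewrite [X in (X < _)%E](_ : _ = \prod_(i < N.+1) leb `[P i, Q i]%classic)%E; last first.
    by apply: lebesgue_rV_box => i; exact: measurable_itv.
  rewrite (eq_bigr (fun i => (fine (leb `[P i, Q i]%classic))%:E)); last first.
    move=> i _; rewrite fineK// ge0_fin_numE ?measure_ge0//.
    by rewrite [X in (X < _)%E](lebesgue_measure_itv `[P i, Q i])/=; case: ifP => _; rewrite ?ltry.
  by rewrite prodEFin ltry.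
apply: (@le_lt_trans _ _ (k^-1%:E * E u)%E); last by rewrite lte_mul_pinfty// lee_fin invr_ge0 ltW.
rewrite /energy -ge0_integralZl//; last 3 first.
- apply/measurable_EFinP; apply: measurable_funM; first exact: measurable_funX.
  exact: measurable_rV_weight.
- by move=> z _; rewrite lee_fin mulr_ge0 ?sqr_ge0 ?rV_weight_ge0.
- by rewrite lee_fin invr_ge0 ltW.
apply: ge0_subset_integral => //.
by move=> z _; rewrite lee_fin.
Qed.

End finite_classes.

(** * Completeness and precompactness *)

Section square_integrable_classes.
Context d (T : measurableType d) (R : realType) (mu : {measure set T -> \bar R}).
Local Notation L2 := (LspaceType2 mu).
Local Open Scope ereal_scope.

Lemma measurable_L2 (u : L2) : measurable_fun [set: T] (u : T -> R).
Proof. exact: (@measurable_funPT _ _ T (measurableTypeR R) (repr (LebesgueSpace.sort u))). Qed.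

Lemma Lnorm2_sqr (f : T -> R) :
  'N[mu]_2[EFin \o f] `^ 2 = \int[mu]_z (f z ^+ 2)%:E.
Proof.
rewrite poweR_Lnorm//; apply: eq_integral => z _.
by rewrite /= powR_mulrn ?normr_ge0// -normrX ger0_norm ?sqr_ge0.
Qed.

Lemma L2_sqr_lty (u : L2) : \int[mu]_z (u z ^+ 2)%:E < +oo.
Proof. by rewrite -Lnorm2_sqr; apply: poweR_lty; exact: Lebesgue_finite. Qed.

Let finite_norm2 (f : T -> R) : \int[mu]_z (f z ^+ 2)%:E < +oo ->
  'N[mu]_2[EFin \o f] < +oo.
Proof. by rewrite -Lnorm2_sqr => /(lty_poweRy _) -> //. Qed.

Lemma integral_sqr_sub_lty (f g : T -> R) :
  measurable_fun setT f -> measurable_fun setT g ->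
  \int[mu]_z (f z ^+ 2)%:E < +oo -> \int[mu]_z (g z ^+ 2)%:E < +oo ->
  \int[mu]_z ((f z - g z) ^+ 2)%:E < +oo.
Proof.
move=> mf mg foo goo.
have m2 (h : T -> R) : measurable_fun setT h -> measurable_fun setT (fun z => (h z ^+ 2)%:E).
  by move=> mh; apply/measurable_EFinP; exact: measurable_funX.
have p2 (h : T -> R) z : 0 <= (h z ^+ 2)%:E by rewrite lee_fin sqr_ge0.
apply: (@le_lt_trans _ _ (\int[mu]_z (2%:E * (f z ^+ 2)%:E + 2%:E * (g z ^+ 2)%:E))).
  apply: ge0_le_integral => //.
  - by move=> z _; rewrite lee_fin sqr_ge0.
  - by apply/measurable_EFinP; apply: measurable_funX; exact: measurable_funB.
  - by apply: emeasurable_funD; apply: emeasurable_funM => //; exact: m2.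
  move=> z _; rewrite -!EFinM -EFinD lee_fin.
  by have := sqr_ge0 (f z + g z); nra.
rewrite ge0_integralD//; last 4 first.
- by move=> z _; rewrite mule_ge0.
- by apply: emeasurable_funM => //; exact: m2.
- by move=> z _; rewrite mule_ge0.
- by apply: emeasurable_funM => //; exact: m2.
rewrite !ge0_integralZl//; [|exact: m2|exact: m2].
by rewrite lte_add_pinfty// lte_mul_pinfty.
Qed.

Lemma Lspace_dist_sqr (u v : L2) :
  ((Lspace_dist u v) ^+ 2)%:E = \int[mu]_z ((u z - v z) ^+ 2)%:E.
Proof.
have uvoo := integral_sqr_sub_lty (measurable_L2 u) (measurable_L2 v)
  (L2_sqr_lty u) (L2_sqr_lty v).
rewrite -(Lnorm2_sqr (fun z => u z - v z)%R) /Lspace_dist.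
have := finite_norm2 uvoo; have := Lnorm_ge0 mu 2 (EFin \o (fun z => u z - v z)%R).
rewrite (_ : (u : T -> R) \- (v : T -> R) = fun z => u z - v z)%R//.
by move: ('N[mu]_2[_]) => [r| |]//; rewrite lee_fin => r0 _ /=; rewrite -powR_mulrn.
Qed.

(** The representative chosen in the class of f agrees with f only almost everywhere, so the class
    is described through integrals. *)
Lemma L2_of_fun (f : T -> R) : measurable_fun setT f ->
  \int[mu]_z (f z ^+ 2)%:E < +oo ->
  exists U : L2, forall g : T -> R, measurable_fun setT g ->
    \int[mu]_z ((g z - U z) ^+ 2)%:E = \int[mu]_z ((g z - f z) ^+ 2)%:E.
Proof.
move=> mf foo.
pose f' : {mfun T >-> measurableTypeR R} := HB.pack f (@isMeasurableFun.Build _ _ T (measurableTypeR R) f mf).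
pose V : {mfun_ mu, T >-> measurableTypeR R} := (\pi f')%qT.
have mV : measurable_fun setT (V : T -> R).
  exact: (@measurable_funPT _ _ T (measurableTypeR R) (repr V)).
have Vf : {ae mu, forall z, V z = f z}.
  have /eqmodP/asboolP : (repr V = f' %[mod {mfun_ mu, T >-> measurableTypeR R}])%qT.
    by rewrite reprK.
  by apply: filterS => z /(_ I).
have sqrE (g : T -> R) : measurable_fun setT g ->
    \int[mu]_z ((g z - V z) ^+ 2)%:E = \int[mu]_z ((g z - f z) ^+ 2)%:E.
  move=> mg; apply: ae_eq_integral => //.
  - by apply/measurable_EFinP; apply: measurable_funX; exact: measurable_funB.
  - by apply/measurable_EFinP; apply: measurable_funX; exact: measurable_funB.
  - by apply: filterS Vf => z Vz _ /=; rewrite Vz.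
have fin : finite_norm mu 2%:E V.
  apply: finite_norm2; have := sqrE (cst 0%R) (measurable_cst _).
  under eq_integral => z _ do rewrite /= sub0r sqrrN.
  under [RHS]eq_integral => z _ do rewrite /= sub0r sqrrN.
  by move=> ->.
pose U : L2 := HB.pack V (@isFinLebesgue.Build _ _ _ mu 2%:E (lee1n 2) V fin).
by exists U => g mg; rewrite -sqrE.
Qed.

End square_integrable_classes.

Section fast_cauchy.
Context {R : realType}.

(** With r_n = 2 A 2^(-n) the intervals [v_n - r_n, v_n + r_n] are nested, and the limit is the
    supremum of their left ends. *)
Lemma fast_cauchy_limit (v : nat -> R) (A : R) :
  (forall n, `|v n - v n.+1| <= A * 2^-1 ^+ n) ->
  exists L : R, forall n, `|v n - L| <= 2 * A * 2^-1 ^+ n.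
Proof.
move=> H; pose r n := 2 * A * 2^-1 ^+ n.
have rS n : A * 2^-1 ^+ n = r n - r n.+1 by rewrite /r exprS; field.
have A0 : 0 <= A by have := le_trans (normr_ge0 _) (H 0%N); rewrite expr0 mulr1.
have r0 n : 0 <= r n by rewrite !mulr_ge0 ?exprn_ge0 ?invr_ge0.
have Hr n : v n - r n <= v n.+1 - r n.+1 /\ v n.+1 + r n.+1 <= v n + r n.
  by have := H n; rewrite rS ler_norml => /andP[h1 h2]; split; lra.
have up n m : (n <= m)%N -> v n - r n <= v m - r m.
  by move=> /subnK <-; elim: (m - n)%N => // k IH; apply: le_trans IH _; case: (Hr (k + n)%N).
have dn n m : (n <= m)%N -> v m + r m <= v n + r n.
  by move=> /subnK <-; elim: (m - n)%N => // k IH; apply: le_trans IH; case: (Hr (k + n)%N).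
have ab n m : v n - r n <= v m + r m.
  case/orP: (leq_total n m) => nm.
    by apply: le_trans (up _ _ nm) _; have := r0 m; lra.
  by apply: le_trans (dn _ _ nm); have := r0 n; lra.
pose S : set R := [set v n - r n | n in [set: nat]].
have hS : has_sup S.
  split; first by exists (v 0%N - r 0%N); exists 0%N.
  by exists (v 0%N + r 0%N) => _ [n _ <-].
exists (sup S) => n; rewrite ler_distl -/(r n); apply/andP; split.
  rewrite lerBlDr; have : sup S <= v n + r n.
    by apply: ge_sup => [|_ [m _ <-]]; [case: hS|exact: ab].
  have : v n - r n <= sup S by apply: ub_le_sup; [case: hS|exists n].
  lra.
have : v n - r n <= sup S by apply: ub_le_sup; [case: hS|exists n].
lra.
Qed.

Local Open Scope ereal_scope.

(* The sum h of 4^n (w_n - w_(n+1))^2 is integrable; where it is finite,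
   |w_n - w_(n+1)| <= 2^-n sqrt h. *)
Lemma L2_fast_cauchy d (T : measurableType d) (mu : {measure set T -> \bar R})
    (w : nat -> LspaceType2 mu) :
  (forall n, Lspace_dist (w n) (w n.+1) <= 4^-1 ^+ n)%R ->
  exists U : LspaceType2 mu, forall n, (Lspace_dist (w n) U <= 3 * 2^-1 ^+ n)%R.
Proof.
move=> Hw; pose W n : T -> R := w n.
have mW n : measurable_fun setT (W n) by exact: measurable_L2.
pose f n z := (4 ^+ n * (W n z - W n.+1 z) ^+ 2)%:E.
have f0 n z : 0 <= f n z by rewrite lee_fin mulr_ge0 ?sqr_ge0 ?exprn_ge0.
have mf n : measurable_fun setT (f n).
  apply/measurable_EFinP; apply: measurable_funM => //.
  by apply: measurable_funX; exact: measurable_funB.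
pose h z := \sum_(n <oo) f n z.
have h0 z : 0 <= h z by exact: nneseries_ge0.
have mh : measurable_fun setT h.
  by apply: ge0_emeasurable_sum => [n z _ _|n _]; [exact: f0|exact: mf].
(* The n-th term is at most 4^n (4^(-n))^2 = 4^(-n), and the partial sums stay below 4/3. *)
have h2 : \int[mu]_z h z <= 2%:E.
  rewrite /h integral_nneseries//.
  apply: (@le_trans _ _ (\sum_(n <oo) (4^-1 ^+ n)%:E)).
    apply: lee_nneseries => [n _ _|n _]; first exact: integral_ge0.
    rewrite /f; under eq_integral => z _ do rewrite EFinM.
    have -> : \int[mu]_z ((4 ^+ n)%:E * ((W n z - W n.+1 z) ^+ 2)%:E) =
        (4 ^+ n)%:E * \int[mu]_z ((W n z - W n.+1 z) ^+ 2)%:E.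
      apply: ge0_integralZl => //.
      - by apply/measurable_EFinP; apply: measurable_funX; exact: measurable_funB.
      - by move=> z _; rewrite lee_fin sqr_ge0.
    rewrite -Lspace_dist_sqr -EFinM lee_fin.
    apply: (@le_trans _ _ (4 ^+ n * (4^-1 ^+ n) ^+ 2)%R).
      rewrite ler_wpM2l ?exprn_ge0// ler_pXn2r ?nnegrE ?exprn_ge0 ?invr_ge0//.
      by rewrite /Lspace_dist fine_ge0// Lnorm_ge0.
    by rewrite expr2 mulrA -exprMn divff// expr1n mul1r.
  apply: lime_le; first by apply: is_cvg_nneseries => n _ _; rewrite lee_fin exprn_ge0 ?invr_ge0.
  apply: nearW => n; rewrite sumEFin lee_fin.
  suff : (\sum_(0 <= k < n) 4^-1 ^+ k + 4 / 3 * 4^-1 ^+ n = 4 / 3 :> R)%R.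
    have : (0 <= 4^-1 ^+ n :> R)%R by rewrite exprn_ge0 ?invr_ge0.
    by move: (\sum_(_ <= _ < _) _)%R => s; lra.
  elim: n => [|n IH]; first by rewrite big_geq// expr0; lra.
  by rewrite big_nat_recr//= exprS -[RHS]IH; field.
have hae : {ae mu, forall z, h z < +oo}.
  have : mu.-integrable setT h.
    apply/integrableP; split => //.
    under eq_integral => z _ do rewrite gee0_abs//.
    exact: le_lt_trans h2 (ltry _).
  by move/(integrable_ae measurableT); apply: filterS => z /(_ I); rewrite ge0_fin_numE.
pose G := [set z | h z < +oo].
have mG : measurable G.
  by rewrite -[G]setTI; exact: emeasurable_fun_infty_o.
(* Setting the functions to 0 on the null set where h is infinite makes the sequence converge at
   every point, hence to a measurable limit. *)
pose V n z := (W n z * \1_G z)%R.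
have mV n : measurable_fun setT (V n) by apply: measurable_funM => //; exact: measurable_indic.
pose S z := Num.sqrt (fine (h z)).
have Vstep z n : (`|V n z - V n.+1 z| <= S z * 2^-1 ^+ n)%R.
  rewrite /V indicE; case: (boolP (z \in G)) => [|_]; last first.
    by rewrite !mulr0 subrr normr0 mulr_ge0 ?sqrtr_ge0 ?exprn_ge0 ?invr_ge0.
  rewrite inE /G /= => hz; rewrite !mulr1.
  have fz : (4 ^+ n * (W n z - W n.+1 z) ^+ 2 <= fine (h z))%R.
    rewrite -lee_fin fineK ?ge0_fin_numE//.
    apply: le_trans (nneseries_lim_ge n.+1 (fun k _ _ => f0 k z)).
    by rewrite big_mkord big_ord_recr/= leeDr// sume_ge0.
  rewrite -sqrtr_sqr exprVn ler_pdivlMr ?exprn_gt0//.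
  rewrite -[X in (_ * X)%R]ger0_norm ?exprn_ge0// -sqrtr_sqr -sqrtrM ?sqr_ge0//.
  apply: ler_wsqrtr; apply: le_trans fz.
  rewrite mulrC ler_wpM2r ?sqr_ge0// -exprM mulnC exprM.
  by rewrite (_ : 2 ^+ 2 = 4 :> R)%R// -natrX.
have [L HL] := choice (fun z => fast_cauchy_limit (Vstep z)).
have mL : measurable_fun setT L.
  apply: (@measurable_fun_cvg _ _ _ setT V) => // z _.
  apply/cvgrPdist_le => e e0.
  have c0 : (fun n => 2 * S z * 2^-1 ^+ n)%R @ \oo --> (0 : R)%R.
    rewrite -[X in _ --> X](mulr0 (2 * S z)%R); apply: cvgM; first exact: cvg_cst.
    by apply: cvg_expr; rewrite ger0_norm ?invr_ge0// invf_lt1// ltr1n.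
  move/cvgrPdist_le : c0 => /(_ e e0); apply: filterS => n.
  rewrite sub0r normrN => hn; rewrite distrC.
  by apply: le_trans (HL z n) _; apply: le_trans (ler_norm _) hn.
have q4 n : ((2^-1 ^+ n) ^+ 2 = 4^-1 ^+ n :> R)%R.
  by rewrite -exprM mulnC exprM; congr (_ ^+ n)%R; rewrite exprVn -natrX.
(* The pointwise error 2 S 2^(-n) has square 4 h 4^(-n), whose integral is at most 8 4^(-n); the
   constant 3 comes from 8 <= 3^2. *)
have err n : \int[mu]_z ((W n z - L z) ^+ 2)%:E <= (8 * 4^-1 ^+ n)%:E.
  apply: (@le_trans _ _ ((4 * 4^-1 ^+ n)%:E * \int[mu]_z h z)); last first.
    apply: le_trans (lee_wpmul2l _ h2) _.
      by rewrite lee_fin mulr_ge0 ?exprn_ge0 ?invr_ge0.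
    by rewrite -EFinM lee_fin mulrAC -natrM.
  rewrite -ge0_integralZl//.
  apply: ae_ge0_le_integral => //.
  - by move=> z _; rewrite lee_fin sqr_ge0.
  - by apply/measurable_EFinP; apply: measurable_funX; exact: measurable_funB.
  - by move=> z _; rewrite mule_ge0// lee_fin mulr_ge0 ?exprn_ge0 ?invr_ge0.
  - exact: emeasurable_funM.
  apply: filterS hae => z hz _.
  have := HL z n; rewrite /V indicE mem_set// mulr1 => hn.
  have -> : h z = (S z ^+ 2)%:E.
    by rewrite /S sqr_sqrtr ?fine_ge0// fineK// ge0_fin_numE.
  rewrite -EFinM lee_fin -real_normK ?num_real//.
  apply: (@le_trans _ _ ((2 * S z * 2^-1 ^+ n) ^+ 2)%R).
    by rewrite ler_pXn2r ?nnegrE// (le_trans (normr_ge0 _) hn).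
  by rewrite !exprMn q4 -natrX mulrAC.
have Loo : \int[mu]_z (L z ^+ 2)%:E < +oo.
  have := integral_sqr_sub_lty (mW 0%N) (measurable_funB (mW 0%N) mL) (L2_sqr_lty (w 0%N))
    (le_lt_trans (err 0%N) (ltry _)).
  by under eq_integral => z _ do rewrite /= subKr.
have [U HU] := L2_of_fun mL Loo.
exists U => n; have := err n; rewrite -(HU _ (mW n)) -Lspace_dist_sqr lee_fin => hn.
have d0 : (0 <= Lspace_dist (w n) U)%R by rewrite /Lspace_dist fine_ge0// Lnorm_ge0.
have q0 : (0 <= 2^-1 ^+ n :> R)%R by rewrite exprn_ge0 ?invr_ge0.
rewrite -(@ler_pXn2r _ 2)// ?nnegrE ?mulr_ge0//; apply: le_trans hn _.
rewrite exprMn q4 -natrX.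
by rewrite ler_wpM2r ?exprn_ge0 ?invr_ge0// ler_nat.
Qed.

End fast_cauchy.

(** An ultrafilter on the closure of A contains sets of arbitrarily small diameter, since finitely
    many classes nearly cover it. Points picked from these sets form a fast Cauchy sequence, and its
    limit attracts the ultrafilter. *)
Lemma precompact_of_finite_classes {R : realType} (M : metricType R) (A : set M) :
  (forall w : nat -> M, (forall n, mdist (w n) (w n.+1) <= 4^-1 ^+ n) ->
    exists U, forall n, mdist (w n) U <= 3 * 2^-1 ^+ n) ->
  (forall eps : R, 0 < eps -> exists (T : finType) (cls : M -> T),
    forall u v, A u -> A v -> cls u = cls v -> mdist u v <= eps) ->
  precompact A.
Proof.
move=> cplt fin; rewrite precompactE compact_ultra => F FU FA.
have small eps : 0 < eps -> exists S : set M, F S /\ forall u v, S u -> S v -> mdist u v <= eps.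
  move=> e0; have e30 : 0 < eps / 3 by rewrite divr_gt0.
  have [T [cls Hcls]] := fin _ e30.
  (* The class t enlarged by eps / 3, so as to reach the closure of A. If F contained none of these
     sets, it would contain all their complements, finitely many, and hence a point of the closure
     near no class. *)
  pose B t : set M := [set x | exists y, [/\ A y, cls y = t & mdist x y < eps / 3]].
  case: (pselect (exists t, F (B t))) => [[t FB]|nB].
    exists (B t); split => // u v [u' [Au ut du]] [v' [Av vt dv]].
    have h1 := Hcls _ _ Au Av (etrans ut (esym vt)).
    have h2 := metric_triangle u u' v; have h3 := metric_triangle u' v' v.
    by rewrite (metric_sym v' v) in h3; lra.
  have H t : F (~` B t).
    by case: (in_ultra_setVsetC (B t) FU) => // FB; case: nB; exists t.
  have [x [Ax Hx]] := filter_ex (filterI FA (filter_forall _ H)).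
  have /Ax : nbhs x (ball x (eps / 3)) by exact: nbhsx_ballx.
  move=> [y [Ay]]; rewrite ballEmdist/= => xy.
  by exfalso; apply: (Hx (cls y)); exists y.
have [S HS] := choice (fun n => small (4^-1 ^+ n) ltac:(by rewrite exprn_gt0 ?invr_gt0)).
have FS n : F (S n) by case: (HS n).
have dS n u v : S n u -> S n v -> mdist u v <= 4^-1 ^+ n by case: (HS n) => _; apply.
(* Taking w_n in both S_n and S_(n+1) puts w_n and w_(n+1) together in S_(n+1). *)
have [w Hw] := choice (fun n => filter_ex (filterI (FS n) (FS n.+1))).
have le4 n : 4^-1 ^+ n.+1 <= 4^-1 ^+ n :> R.
  by rewrite exprS ler_piMl ?exprn_ge0 ?invr_ge0// invf_le1// ler1n.
have [|U HU] := cplt w.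
  move=> n; apply: le_trans (le4 n); apply: dS; first by case: (Hw n).
  by case: (Hw n.+1).
have FcU : F --> U.
  move=> B; rewrite -nbhs_ballE => -[e /= e0 eB].
  (* A point of S_n is within 3 2^(-n) + 4^(-n) <= 4 2^(-n) of U. *)
  have [n Hn] : exists n : nat, 4 * 2^-1 ^+ n < e.
    pose n := (Num.truncn (4 / e)).+1; exists n.
    have h : 4 / e < n%:R := truncnS_gt _.
    rewrite ltr_pdivrMr// in h.
    have h2 : n%:R <= 2 ^+ n :> R by rewrite -natrX ler_nat ltnW// ltn_expl.
    rewrite exprVn ltr_pdivrMr ?exprn_gt0//; apply: lt_le_trans h _.
    by rewrite mulrC ler_pM2l.
  apply: filterS (FS n) => x Sx; apply: eB; rewrite ballEmdist/=.
  apply: le_lt_trans Hn; apply: le_trans (metric_triangle U (w n) x) _.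
  rewrite metric_sym.
  have h1 : mdist (w n) x <= 4^-1 ^+ n by apply: dS => //; case: (Hw n).
  have h2 : 4^-1 ^+ n <= 2^-1 ^+ n :> R.
    by rewrite lerXn2r ?nnegrE ?invr_ge0// lef_pV2 ?posrE// ler_nat.
  by have := HU n; lra.
exists U; split => //; rewrite (closure_id (closure A)).1; last exact: closed_closure.
move=> B /FcU FB; have [x [clAx Bx]] := filter_ex (filterI FA FB).
by exists x.
Qed.

(** * Bounded sets of the Sobolev space *)

Section weighted_sobolev_bounds.
Context {R : realType} (N : nat) (c a : R).
Local Notation mu := (@weighted_measure R N c a : {measure set 'rV[R]_N.+1 -> \bar R}).

Lemma energyE (f : 'rV[R]_N.+1 -> R) : measurable_fun setT f ->
  energy c a f = (\int[mu]_z (f z ^+ 2)%:E)%E.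
Proof.
move=> mf; rewrite integral_weighted_measure//.
- by apply/measurable_EFinP; exact: measurable_funX.
- by move=> z; rewrite lee_fin sqr_ge0.
Qed.

Lemma energy_L2 (u : L2_mu N c a) : energy c a u = (L2_dot u u)%:E.
Proof.
rewrite energyE; last exact: measurable_L2.
rewrite /L2_dot /Rintegral; under [in RHS]eq_integral => z _ do rewrite -expr2.
rewrite fineK// ge0_fin_numE ?L2_sqr_lty//.
by apply: integral_ge0 => z _; rewrite lee_fin sqr_ge0.
Qed.

Lemma L2_dot_ge0 (u : L2_mu N c a) : 0 <= L2_dot u u.
Proof. by rewrite -lee_fin -energy_L2 energy_ge0. Qed.

Lemma L2_dist_energy (u v : L2_mu N c a) :
  ((mdist u v) ^+ 2)%:E = energy c a ((u : _ -> R) \- (v : _ -> R)).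
Proof.
rewrite energyE; last by apply: measurable_funB; exact: measurable_L2.
exact: Lspace_dist_sqr.
Qed.

Lemma H1_norm_bounds (x : H1_mu N c a) (M : R) : H1_norm x <= M ->
  (L2_dot (H1_val x) (H1_val x) <= M ^+ 2) /\
  forall i, L2_dot (H1_grad x i) (H1_grad x i) <= M ^+ 2.
Proof.
move=> xM; have S0 : 0 <= \sum_i L2_dot (H1_grad x i) (H1_grad x i).
  by apply: sumr_ge0 => i _; exact: L2_dot_ge0.
have v0 := L2_dot_ge0 (H1_val x).
have dM : H1_dot x x <= M ^+ 2.
  rewrite -[leLHS]sqr_sqrtr; last by rewrite addr_ge0.
  by rewrite ler_pXn2r ?nnegrE ?sqrtr_ge0// (le_trans _ xM)// sqrtr_ge0.
split=> [|i]; apply: le_trans dM; rewrite /H1_dot; first by rewrite lerDl.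
rewrite (bigD1 i)//= addrCA lerDl addr_ge0//.
by apply: sumr_ge0 => j _; exact: L2_dot_ge0.
Qed.

End weighted_sobolev_bounds.

Theorem theorem3p6 (R : realType) (N : nat) (c a : R)
    (hc : 0 < c + 1) (ha : 0 < a) :
  compact_map (@H1_norm R N c a) (@H1_val R N c a).
Proof.
move=> B [M BM]; apply: precompact_of_finite_classes.
  by move=> w Hw; exact: L2_fast_cauchy.
move=> eps e0.
pose X := {x : H1_mu N c a | B x}.
(* The 1 is added to have a positive bound, since M may be 0. *)
have K0 : 0 < M ^+ 2 + 1 by rewrite ltr_wpDl ?sqr_ge0.
have bound (x : X) : (energy c a (H1_val (sval x)) <= (M ^+ 2 + 1)%:E)%E /\
    forall i, (energy c a (H1_grad (sval x) i) <= (M ^+ 2 + 1)%:E)%E.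
  have [h1 h2] := H1_norm_bounds (BM _ (svalP x)).
  by split=> [|i]; rewrite energy_L2 lee_fin; [have := h1|have := h2 i]; lra.
have mL (u : L2_mu N c a) : measurable_fun setT (u : 'rV[R]_N.+1 -> R).
  exact: measurable_L2.
have Loo (u : L2_mu N c a) : (energy c a u < +oo)%E by rewrite energy_L2 ltry.
have hh (x : X) i : {ae lebesgue_rV N, forall y : 'rV[R]_N,
    half_holder [set t | half_space N (ins i (y, t))]
      (fun t => H1_val (sval x) (ins i (y, t)))
      (fun t => H1_grad (sval x) i (ins i (y, t)))}.
  apply: ae_half_holder; [exact: mL|exact: mL|..].
  - by move=> P Q P0; exact: (@integrable_cbox R N c a ha).
  - by move=> P Q P0; exact: (@integrable_cbox R N c a ha).
  - by move=> phi /(H1_gradP (sval x)); apply.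
have e20 : 0 < eps ^+ 2 by rewrite exprn_gt0.
have [T [cls Hcls]] := energy_finite_classes hc ha K0 e20
  (fun x : X => mL (H1_val (sval x))) (fun (x : X) i => mL (H1_grad (sval x) i))
  (fun x => (bound x).1) (fun x => (bound x).2) hh.
(* The classes found are classes of elements of B, whereas a classification of L^2_mu is wanted: a
   class in the image is sent to that of a chosen preimage in B, any other to [None]. *)
pose pre (u : L2_mu N c a) : option X :=
  if pselect (exists x : X, H1_val (sval x) = u) is left h then Some (projT1 (cid h)) else None.
have preP (u : L2_mu N c a) : (@H1_val R N c a @` B) u ->
    exists2 x, pre u = Some x & H1_val (sval x) = u.
  move=> [x Bx xu]; rewrite /pre; case: pselect => [h|]; last first.
    by move=> nh; exfalso; apply: nh; exists (exist _ x Bx).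
  by exists (projT1 (cid h)) => //; exact: projT2 (cid h).
exists (option T), (fun u => omap cls (pre u)) => u v /preP[x -> <-] /preP[y -> <-] /= [].
move=> /Hcls; rewrite -L2_dist_energy lee_fin.
by rewrite ler_pXn2r ?nnegrE ?mdist_ge0 ?(ltW e0).
Qed.
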